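(* There exists a dimensional constant $\mu\in(0,1)$ (depending only on the dimension $4$) such that the following holds. Let $f_0>0$ be a constant and let $u$ be a smooth function on $B_3\subset\mathbb{R}^4$ whose graph $\Sigma=\{(x,u(x)):x\in B_3\}$ is $2$-convex and satisfies $\sigma_2(\kappa)=f_0$ on $B_3$. If $|Du|\le\mu$ in $B_3$, then $$\sup_{B_2}H\le C\,\sup_{B_1}H,$$ where $C$ is a constant depending only on $\|u\|_{L^\infty(B_3)}$, $\sqrt{f_0}$ and $f_0^{-1}$ (and the dimension $4$).
   Context: $B_r$ is the open ball of radius $r$ centered at $0$. For a smooth function $u$ on an open subset of $\mathbb{R}^n$, the principal curvatures $\kappa=(\kappa_1,\dots,\kappa_n)$ of its graph at $(x,u(x))$ are the eigenvalues of $g^{-1}h$, with $g_{ij}=\delta_{ij}+u_iu_j$, $h_{ij}=u_{ij}/\sqrt{1+|Du|^2}$. $\sigma_1(\kappa)=\sum_i\kappa_i$, $\sigma_2(\kappa)=\sum_{i<j}\kappa_i\kappa_j$. The mean curvature $H=\sigma_1(\kappa)$ is regarded as a function of $x$. The graph is $2$-convex if $\kappa\in\Gamma_2=\{\sigma_1>0,\sigma_2>0\}$ at every point. *)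

(* Defs.v *)
From HB Require Import structures.
From mathcomp Require Import all_boot all_order all_algebra.
From mathcomp Require Import all_classical all_reals all_analysis.
From mathcomp Require Import complex.

Set Implicit Arguments.
Unset Strict Implicit.
Unset Printing Implicit Defensive.

Import Order.TTheory GRing.Theory Num.Theory.
Import numFieldNormedType.Exports.

Local Open Scope classical_set_scope.
Local Open Scope ring_scope.

(* The library norm on ['rV[R]_n] is the sup norm, so the Euclidean norm and the
   Euclidean balls are defined here.  The two norms induce the same topology,
   and directional derivatives do not depend on the choice. *)
Definition enorm (R : realType) (n : nat) (x : 'rV[R]_n) : R :=
  Num.sqrt (\sum_(i < n) x 0 i ^+ 2).

Definition eball (R : realType) (n : nat) (r : R) : set 'rV[R]_n :=
  [set x | enorm x < r].

Definition partial (R : realType) (n : nat) (i : 'I_n) (u : 'rV[R]_n -> R) :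
  'rV[R]_n -> R := fun x => 'D_(delta_mx 0 i) u x.

(* Meant for an open set U: every iterated partial derivative of u exists and is
   continuous at every point of U.  Nothing is required of u outside U. *)
Definition smooth_on (R : realType) (n : nat) (U : set 'rV[R]_n)
    (u : 'rV[R]_n -> R) : Prop :=
  forall (s : seq 'I_n) (x : 'rV[R]_n), U x ->
    {for x, continuous (foldr (@partial R n) u s)} /\
    (forall i : 'I_n, derivable (foldr (@partial R n) u s) x (delta_mx 0 i)).

Definition grad (R : realType) (n : nat) (u : 'rV[R]_n -> R) (x : 'rV[R]_n) :
  'rV[R]_n := \row_i partial i u x.

Definition hess (R : realType) (n : nat) (u : 'rV[R]_n -> R) (x : 'rV[R]_n) :
  'M[R]_n := \matrix_(i, j) partial j (partial i u) x.

Definition first_form (R : realType) (n : nat) (u : 'rV[R]_n -> R)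
    (x : 'rV[R]_n) : 'M[R]_n :=
  \matrix_(i, j) ((i == j)%:R + grad u x 0 i * grad u x 0 j).

Definition second_form (R : realType) (n : nat) (u : 'rV[R]_n -> R)
    (x : 'rV[R]_n) : 'M[R]_n :=
  \matrix_(i, j) (hess u x i j / Num.sqrt (1 + enorm (grad u x) ^+ 2)).

Definition weingarten (R : realType) (n : nat) (u : 'rV[R]_n -> R)
    (x : 'rV[R]_n) : 'M[R]_n :=
  invmx (first_form u x) *m second_form u x.

(* The eigenvalues of g^-1 h listed with multiplicity, in an arbitrary order.
   They exist as soon as the Hessian is symmetric, see
   [principal_curvaturesP]. *)
Definition principal_curvatures (R : realType) (n : nat) (u : 'rV[R]_n -> R)
    (x : 'rV[R]_n) : 'rV[R]_n :=
  xget 0 [set k : 'rV[R]_n |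
    char_poly (weingarten u x) = \prod_(i < n) ('X - (k 0 i)%:P)].

Definition sigma1 (R : realType) (n : nat) (k : 'rV[R]_n) : R :=
  \sum_(i < n) k 0 i.

Definition sigma2 (R : realType) (n : nat) (k : 'rV[R]_n) : R :=
  \sum_(i < n) \sum_(j < n | (i < j)%N) k 0 i * k 0 j.

Definition Gamma2 (R : realType) (n : nat) : set 'rV[R]_n :=
  [set k | 0 < sigma1 k /\ 0 < sigma2 k].

Definition two_convex_on (R : realType) (n : nat) (U : set 'rV[R]_n)
    (u : 'rV[R]_n -> R) : Prop :=
  forall x, U x -> Gamma2 (principal_curvatures u x).

Definition mean_curvature (R : realType) (n : nat) (u : 'rV[R]_n -> R)
    (x : 'rV[R]_n) : R := sigma1 (principal_curvatures u x).

(* For continuous u and open U this is the L^oo norm of u on U. *)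
Definition sup_norm_on (R : realType) (n : nat) (U : set 'rV[R]_n)
    (u : 'rV[R]_n -> R) : \bar R := ereal_sup [set (`|u x|)%:E | x in U].

Section principal_curvatures_exist.
Variables (R : realType) (n : nat).
Local Notation C := (complex R).
Local Notation toC := (@real_complex R).
Local Notation cmx := (map_mx toC).

Lemma conj_toC (a : R) : Num.conj (toC a) = toC a.
Proof. by apply/CrealP; rewrite complex_real. Qed.

Lemma real_form (w : 'rV[C]_n) (H : 'M[R]_n) : H^T = H ->
  (w *m (cmx H) *m (map_mx Num.conj w)^T) 0 0 \is Num.real.
Proof.
move=> Hs; apply/CrealP; set a := (_ *m _).
have cH : map_mx Num.conj (cmx H) = cmx H.
  by apply/matrixP => i j; rewrite !mxE conj_toC.
have cw : map_mx Num.conj (map_mx Num.conj w) = w.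
  by apply/matrixP => i j; rewrite !mxE conjCK.
have aT : a^T = map_mx Num.conj a.
  rewrite /a !trmx_mul trmxK (map_trmx toC H) Hs !map_mxM cH -map_trmx cw.
  by rewrite mulmxA.
by move/matrixP: aT => /(_ 0 0); rewrite !mxE => <-.
Qed.

Lemma pos_form (w : 'rV[C]_n) (p : 'rV[R]_n) (G : 'M[R]_n) :
  G = 1%:M + p^T *m p -> w != 0 ->
  0 < (w *m (cmx G) *m (map_mx Num.conj w)^T) 0 0.
Proof.
move=> -> w0.
have -> : (w *m cmx (1%:M + p^T *m p) *m (map_mx Num.conj w)^T) 0 0 =
  \sum_i `|w 0 i| ^+ 2 + `|(w *m (cmx p)^T) 0 0| ^+ 2.
  rewrite map_mxD map_mx1 map_mxM mulmxDr mulmx1 mulmxDl mxE; congr (_ + _).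
    by rewrite mxE; apply: eq_bigr => i _; rewrite !mxE normCK.
  rewrite normCK -map_trmx mulmxA -mulmxA mxE big_ord1; congr (_ * _).
  rewrite !mxE rmorph_sum; apply: eq_bigr => i _; rewrite !mxE rmorphM.
  by rewrite mulrC; congr (_ * _); apply/esym/conj_toC.
apply: ltr_pwDl; last exact: exprn_ge0.
have [i wi] : exists i, w 0 i != 0.
  apply/existsP; apply: contra_neqT w0 => /existsPn w0.
  by apply/rowP => i; rewrite mxE; apply/eqP; move: (w0 i); rewrite negbK.
rewrite (bigD1 i) //= ltr_pwDl ?exprn_gt0 ?normr_gt0//.
by apply: sumr_ge0 => j _; exact: exprn_ge0.
Qed.

Lemma pencil_eigenvalues (p : 'rV[R]_n) (G H : 'M[R]_n) :
  G = 1%:M + p^T *m p -> H^T = H ->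
  exists k : 'rV[R]_n,
    char_poly (invmx G *m H) = \prod_(i < n) ('X - (k 0 i)%:P).
Proof.
move=> GE Hs.
have Gu : (cmx G) \in unitmx.
  rewrite -row_free_unit; apply/row_freeP.
  have : row_free (cmx G).
    rewrite -kermx_eq0; apply/negPn/negP => /rowV0Pn[v /sub_kermxP vG v0].
    by have := pos_form GE v0; rewrite vG mul0mx mxE ltxx.
  by move/row_freeP.
set A := invmx G *m H.
have [r rE] := closed_field_poly_normal (map_poly toC (char_poly A)).
rewrite lead_coef_map (monicP (char_poly_monic A)) rmorph1 scale1r in rE.
have rR z : z \in r -> z \is Num.real.
  move=> zr.
  have : root (char_poly (cmx A)) z.
    by rewrite -map_char_poly rE root_prod_XsubC.
  rewrite -eigenvalue_root_char => /eigenvalueP[v vA v0].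
  have AE : (cmx A) = invmx (cmx G) *m (cmx H) by rewrite map_mxM map_invmx.
  pose w := v *m invmx (cmx G).
  have vE : v = w *m (cmx G) by rewrite /w mulmxKV.
  have w0 : w != 0 by apply: contra_neq v0 => w0; rewrite vE w0 mul0mx.
  have wH : w *m (cmx H) = z *: (w *m (cmx G)) by rewrite -vE -vA AE mulmxA.
  have := real_form w Hs; rewrite wH -scalemxAl mxE.
  have Gp := pos_form GE w0.
  move=> zG; rewrite -[z](mulfK (lt0r_neq0 Gp)).
  by apply: realM => //; rewrite realV gtr0_real.
have sr : size r = n.
  have := congr1 (fun q : {poly C} => size q) rE.
  by rewrite size_map_poly size_char_poly size_prod_XsubC => -[].
exists (\row_i complex.Re r`_i).
apply: (map_poly_inj toC); rewrite rE rmorph_prod /=.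
rewrite (big_nth 0) big_mkord sr; apply: eq_bigr => i _.
rewrite rmorphB /= map_polyX map_polyC /= mxE.
have ri : r`_i \in r by rewrite mem_nth ?sr.
by congr (_ - _%:P); rewrite -[LHS](RRe_real (rR _ ri)).
Qed.

End principal_curvatures_exist.

Lemma principal_curvaturesP (R : realType) (n : nat) (u : 'rV[R]_n -> R)
    (x : 'rV[R]_n) : (hess u x)^T = hess u x ->
  char_poly (weingarten u x) =
    \prod_(i < n) ('X - (principal_curvatures u x 0 i)%:P).
Proof.
move=> hs; rewrite /principal_curvatures; case: xgetP => [k _ //|].
have [||k kE] := @pencil_eigenvalues R n (grad u x) (first_form u x)
  (second_form u x).
- by apply/matrixP => i j; rewrite !mxE big_ord1 !mxE.
- apply/matrixP => i j; have /matrixP/(_ i j) := hs.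
  by rewrite !mxE => ->.
- by move=> /(_ k) [].
Qed.

(* Main.v *)
(* Let L be the linearised operator of [sigma2] along the graph, with weights
   f_c = H - k_c in a principal frame, and K = sum_c f_c k_c^2.  In dimension 4 the
   Simons identity and the equation give a Jacobi inequality
   H L H >= (1 + e) |DH|_f^2 - H^2 K, with e = 0 always and e = 1/18 where no
   curvature is below -H/4.  With m = sup_{B_1} H, N the Gauss map and
   rho = 8 - |x|^2, apply the maximum principle to
   2 ln rho + beta (x . N + |N|^2 / 2) + ln (ln (H / m)) on {rho > 0, H > m}.  A
   maximum point lies outside B_1; there the gain in e, the coercive term beta K
   and the ellipticity of L in a radial direction bound rho^2 ln (H / m) by a
   constant, hence ln (H / m) is bounded on B_2. *)

(* The obstacle is the Jacobi inequality: in dimension 4 the cone only gives [f c <= 3 * H / 2], and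
   where this is nearly an equality no fixed e > 0 is available. The iterated logarithm makes this
   harmless. With b = ln (H / m) and B = D ln b, the terms in |B|_f^2 at a maximum add up to (1 + e)
   b - b - 1 = e b - 1. A fixed e > 0 is thus amplified by b, while e = 0 leaves only - |B|_f^2,
   which can be absorbed because a curvature below -H/4 forces K >= H^3 / 16. The price is a term K
   / b, so b has to dominate 1 / beta; beta in turn is small against the constant E that bounds the
   cutoff terms. The bound |Du| <= 1/100 keeps x almost tangential, so that its frame components
   cannot all be small, and keeps the coefficient of K in L (x . N + |N|^2 / 2) close to 1.

   Derivatives are taken along a basis that is constant in x and orthonormal for g only at the
   maximum point. The connection then appears as an explicit first-order term of L and as explicit
   corrections in the Codazzi and Simons identities. *)
Require Import Defs.
From mathcomp Require Import all_boot all_order all_algebra.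
From mathcomp Require Import ring lra.
Import Order.TTheory GRing.Theory Num.Theory.
Local Open Scope ring_scope.
Set Implicit Arguments.
Unset Strict Implicit.
Unset Printing Implicit Defensive.

(** * The Jacobi inequality *)

Section jacobi.
Context {R : realFieldType}.
Implicit Types (k u y f : 'I_4 -> R).

(* Multiplying the trace constraint [\sum_a f a * y a = 0] by [theta] leaves the
   sum of [y] unchanged; Cauchy-Schwarz with the optimal [theta] does the rest. *)
Lemma weighted_square_bound f y (i : 'I_4) (H e : R) : 0 < H ->
  \sum_a f a = 3 * H -> \sum_a f a ^+ 2 <= 3 * H ^+ 2 ->
  \sum_a f a * y a = 0 -> 0 < f i ->
  e * (8 * f i ^+ 2 - 12 * f i * H + 9 * H ^+ 2) <=
    (4 * f i + H) * (3 * H - 2 * f i) -> 0 <= e ->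
  (\sum_a y a) ^+ 2 * (1 + (1 + e) * (f i / H)) <=
    3 * \sum_a y a ^+ 2 - 2 * y i ^+ 2.
Proof.
move=> H0 f1 f2 fy fi0 eH e0.
pose t := f i / H; pose th := (1 + 2 * t / 3) / (H * (1 + 2 * t ^+ 2 / 3)).
have t0 : 0 < t by rewrite divr_gt0.
have fiE : f i = t * H by rewrite /t divfK// gt_eqF.
pose z a := 1 - th * f a.
pose s := \sum_a y a; pose m := 1 + (1 + e) * t.
have zy : \sum_a z a * y a = s.
  rewrite /z /s; transitivity (\sum_a (y a - th * (f a * y a))).
    by apply: eq_bigr => a _; ring.
  by rewrite sumrB -mulr_sumr fy mulr0 subr0.
(* The quadratic form in the goal has weight 1 at [i] and 3 elsewhere. [D] is the dual form at [z],
   so that Cauchy-Schwarz bounds [s ^+ 2] by [D] times the form and [m * D <= 1] is enough; [th]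
   minimises the upper bound [D0] of [D]. *)
pose D := 1 / 3 * (\sum_a z a ^+ 2) + 2 / 3 * z i ^+ 2.
pose q := 1 + 2 * t ^+ 2 / 3.
have q0 : 0 < q by rewrite ltr_pwDl// divr_ge0// mulr_ge0// sqr_ge0.
have Hn0 : H != 0 by rewrite gt_eqF.
have qn0 : q != 0 by rewrite gt_eqF.
have thE : th * H = (1 + 2 * t / 3) / q by rewrite /th -/q; field; rewrite qn0.
have D0 : D <= 2 - (1 + 2 * t / 3) ^+ 2 / q.
  have -> : D = 2 - 2 * th * (H + 2 * f i / 3) +
      th ^+ 2 * (1 / 3 * (\sum_a f a ^+ 2) + 2 / 3 * f i ^+ 2).
    have -> : D = 1 / 3 * (\sum_(a < 4) 1 - 2 * th * \sum_a f a +
       th ^+ 2 * \sum_a f a ^+ 2) + 2 / 3 * z i ^+ 2.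
      congr (_ * _ + _); rewrite !mulr_sumr -sumrB -big_split.
      by apply: eq_bigr => a _ /=; rewrite /z; ring.
    by rewrite f1 sumr_const card_ord /z; field.
  apply: (@le_trans _ _ (2 - 2 * (th * H) * (1 + 2 * t / 3) + (th * H) ^+ 2 * q)).
    rewrite fiE /q -subr_ge0.
    rewrite (_ : _ - _ = th ^+ 2 / 3 * (3 * H ^+ 2 - \sum_a f a ^+ 2)); last by field.
    by rewrite mulr_ge0 ?subr_ge0// divr_ge0// sqr_ge0.
  by rewrite thE le_eqVlt; apply/orP; left; apply/eqP; field.
have e1 : 0 <= 1 + e by rewrite addr_ge0.
have m0 : 0 < m by rewrite ltr_pwDl// mulr_ge0// ltW.
(* This is [t] times the hypothesis on [e], because [9 + 6 * t ^+ 2 - (1 + t) * (9 - 12 * t + 8 * t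
   ^+ 2) = t * (4 * t + 1) * (3 - 2 * t)]. *)
have mD : m * D <= 1.
  apply: (le_trans (ler_wpM2l (ltW m0) D0)).
  rewrite (_ : 2 - _ = (9 - 12 * t + 8 * t ^+ 2) / (9 * q)); last first.
    by rewrite /q; field; rewrite lt0r_neq0//; move: (sqr_ge0 t); lra.
  rewrite mulrA ler_pdivrMr ?mulr_gt0// mul1r /m /q.
  have : e * (8 * t ^+ 2 - 12 * t + 9) <= (4 * t + 1) * (3 - 2 * t).
    rewrite -(@ler_pM2r _ (H ^+ 2)) ?exprn_gt0//.
    by apply: le_trans (le_trans _ eH) _; rewrite fiE le_eqVlt;
      apply/orP; left; apply/eqP; ring.
  by move=> /(ler_wpM2l (ltW t0)) ?; lra.
have Q : 0 <= 3 * (\sum_a y a ^+ 2) - 2 * y i ^+ 2 - 2 * (m * s) * s + (m * s) ^+ 2 * D.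
  rewrite (_ : _ + _ = \sum_(a | a != i) 3 * (y a - m * s * z a / 3) ^+ 2 +
      (y i - m * s * z i) ^+ 2).
    by rewrite addr_ge0 ?sqr_ge0// sumr_ge0// => a _; rewrite mulr_ge0// sqr_ge0.
  have -> : \sum_(a | a != i) 3 * (y a - m * s * z a / 3) ^+ 2 =
    \sum_a 3 * (y a - m * s * z a / 3) ^+ 2 - 3 * (y i - m * s * z i / 3) ^+ 2.
    by rewrite [in RHS](bigD1 i)//=; ring.
  have -> c : \sum_a 3 * (y a - c * z a / 3) ^+ 2 = 3 * (\sum_a y a ^+ 2) -
      2 * c * (\sum_a z a * y a) + c ^+ 2 / 3 * (\sum_a z a ^+ 2).
    rewrite !mulr_sumr -sumrB -big_split; apply: eq_bigr => a _ /=.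
    by move: (z a) => w; field.
  by rewrite zy /D; field.
have : (m * s) ^+ 2 * D <= m * s ^+ 2.
  rewrite (_ : _ * D = m * s ^+ 2 * (m * D)); last by ring.
  by rewrite ler_piMr// mulr_ge0 ?sqr_ge0// ltW.
rewrite -/t -/s -/m; lra.
Qed.

End jacobi.

(** * The linearised operator applied to the mean curvature and to the Gauss map *)

Section simons.
Context {R : realFieldType}.
Variables (k u : 'I_4 -> R) (W f0 : R).
Variables (N2 : 'I_4 -> 'I_4 -> 'I_4 -> R) (N3 : 'I_4 -> 'I_4 -> 'I_4 -> 'I_4 -> R).
Let H := \sum_a k a.
Let f c := H - k c.
Let K := \sum_c f c * k c ^+ 2.
Let dH c := \sum_a N2 a a c.
Hypothesis W2 : W ^+ 2 * (1 - \sum_a u a ^+ 2) = 1.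
Hypothesis f0E : \sum_c f c * k c = 2 * f0.
Hypothesis N2C : forall a c d, N2 a c d = N2 a d c.
Hypothesis codazzi : forall a c d, N2 a c d - N2 c a d =
  (k a - k c) * W * (k a * (a == d)%:R * u c + u a * k c * (c == d)%:R).
Hypothesis dF : forall d, \sum_c f c * N2 c c d = 0.
Hypothesis ddF : forall a, \sum_c f c * N3 c c a a + dH a ^+ 2 -
  \sum_c \sum_d N2 c d a * N2 d c a = 0.
Let Rc c := \sum_b u b * N2 b c c.
Hypothesis commute : forall a c, N3 a a c c - N3 c c a a =
  W * (k c * Rc a - k a * Rc c) + W ^+ 2 * k a * k c * (k a - k c) +
  2 * W * (u c * k a * N2 a a c - u a * k c * N2 c c a).

(** In a constant basis the second derivatives of the Gauss map are not symmetric in all indices;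
    the defect in [codazzi] is the first derivative of the metric times a difference of
    curvatures. *)
Lemma N2_caa a c : N2 c a a = N2 a a c + (k c - k a) * W * u c * k a.
Proof.
have := codazzi c a a; rewrite (N2C a c a) eqxx.
have [->|ca] := eqVneq c a; first by move=> _; ring.
by rewrite /= => E; lra.
Qed.

Lemma laplace_H : \sum_c f c * (\sum_a N3 a a c c) - 2 * f0 * W * \sum_c u c * dH c =
  \sum_a (\sum_c \sum_d N2 c d a * N2 d c a)
  + 2 * W * (\sum_c \sum_a (f c * (u c * k a * N2 a a c - u a * k c * N2 c c a)))
  - \sum_c dH c ^+ 2 + 2 * f0 * \sum_a k a ^+ 2 - H * K.
Proof.
have RE c : Rc c = \sum_b u b * (N2 c c b + (k b - k c) * W * u b * k c).
  by apply: eq_bigr => b _; rewrite N2_caa.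
have sumR : \sum_c Rc c = \sum_c u c * dH c +
    W * (H * (\sum_c u c ^+ 2 * k c) - (\sum_c u c ^+ 2) * \sum_c k c ^+ 2).
  by rewrite /dH /H !big_ord_recl !big_ord0 !RE !big_ord_recl !big_ord0; ring.
have sumfR : \sum_c f c * Rc c =
    W * (2 * f0 * (\sum_c u c ^+ 2 * k c) - (\sum_c u c ^+ 2) * K).
  have -> : \sum_c f c * Rc c = (\sum_b u b * (\sum_c f c * N2 c c b)) +
     W * ((\sum_c f c * k c) * (\sum_c u c ^+ 2 * k c) - (\sum_c u c ^+ 2) * K).
    rewrite /K; move: f => g.
    by rewrite !big_ord_recl !big_ord0 !RE !big_ord_recl !big_ord0; ring.
  by rewrite f0E big1 ?add0r// => b _; rewrite dF mulr0.
have -> : \sum_c f c * (\sum_a N3 a a c c) =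
   \sum_c \sum_a f c * N3 c c a a +
   W * (\sum_c \sum_a f c * (k c * Rc a - k a * Rc c)) +
   W ^+ 2 * (\sum_c \sum_a f c * (k a * k c * (k a - k c))) +
  2 * W * (\sum_c \sum_a f c * (u c * k a * N2 a a c - u a * k c * N2 c c a)).
  rewrite !mulr_sumr -!big_split; apply: eq_bigr => c _ /=.
  rewrite !mulr_sumr -!big_split; apply: eq_bigr => a _ /=.
  have -> : N3 a a c c = N3 c c a a + (N3 a a c c - N3 c c a a) by ring.
  by rewrite commute; ring.
have -> : \sum_c \sum_a f c * N3 c c a a =
    \sum_a (\sum_c \sum_d N2 c d a * N2 d c a) - \sum_c dH c ^+ 2.
  rewrite exchange_big -sumrB; apply: eq_bigr => a _ /=.
  by have := ddF a; lra.
have -> : \sum_c \sum_a f c * (k c * Rc a - k a * Rc c) =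
    2 * f0 * (\sum_c Rc c) - H * (\sum_c f c * Rc c).
  rewrite -f0E /H; move: f Rc => g S.
  by rewrite !big_ord_recl !big_ord0; ring.
have -> : \sum_c \sum_a f c * (k a * k c * (k a - k c)) =
    2 * f0 * (\sum_c k c ^+ 2) - H * K.
  rewrite -f0E /K /H; move: f => g.
  by rewrite !big_ord_recl !big_ord0; ring.
rewrite sumR sumfR.
have -> : W * (2 * f0 * (\sum_c u c * dH c +
    W * (H * (\sum_c u c ^+ 2 * k c) - (\sum_c u c ^+ 2) * (\sum_c k c ^+ 2))) -
    H * (W * (2 * f0 * (\sum_c u c ^+ 2 * k c) - (\sum_c u c ^+ 2) * K))) =
  2 * f0 * W * (\sum_c u c * dH c) +
  (W ^+ 2 - 1) * (H * K - 2 * f0 * (\sum_c k c ^+ 2)).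
  (* This brings the factor [W ^+ 2] of the commutator terms back to 1. *)
  have -> : W ^+ 2 - 1 = W ^+ 2 * \sum_c u c ^+ 2 by have := W2; lra.
  ring.
ring.
Qed.

(** The components of the Gauss map satisfy L N = - K N; the value of component [a] at the point is
    [W * u a]. *)
Lemma laplace_N a :
  \sum_c f c * N2 a c c - 2 * f0 * W * u a * k a = - (W * u a * K).
Proof.
have -> : \sum_c f c * N2 a c c = \sum_c f c * N2 c c a +
    W * u a * (k a * (\sum_c f c * k c) - K).
  rewrite [k a * _]mulr_sumr -sumrB mulr_sumr -big_split; apply: eq_bigr => c _ /=.
  by rewrite N2_caa; ring.
by rewrite dF f0E; ring.
Qed.

Let G a d := N2 a a d * (N2 a a d + (k d - k a) * W * u d * k a).

(** Only the terms with three distinct indices are dropped. They are squares, since the Codazzi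
    defect vanishes when neither of the first two indices equals the third. *)
Lemma sum_N2_sq a : 2 * (\sum_d G a d) + \sum_c N2 c c a ^+ 2 - 2 * N2 a a a ^+ 2 <=
  \sum_c \sum_d N2 c d a * N2 d c a.
Proof.
have Gl d : N2 a d a * N2 d a a = G a d by rewrite (N2C a d a) N2_caa.
have Gr c : N2 c a a * N2 a c a = G a c by rewrite mulrC Gl.
have Ga : G a a = N2 a a a ^+ 2 by rewrite /G; ring.
have Gs : \sum_d N2 a d a * N2 d a a = \sum_d G a d by apply: eq_bigr.
rewrite [X in _ <= X](bigD1 a) //= Gs.
have -> : 2 * (\sum_d G a d) + \sum_c N2 c c a ^+ 2 - 2 * N2 a a a ^+ 2 =
    \sum_d G a d + \sum_(c | c != a) (G a c + N2 c c a ^+ 2).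
  rewrite big_split /= (bigD1 a (P := xpredT) (F := G a))//=.
  rewrite (bigD1 a (P := xpredT) (F := fun c => N2 c c a ^+ 2))//= Ga; ring.
rewrite lerD2l; apply: ler_sum => c ca.
rewrite (bigD1 a) //= Gr lerD2l (bigD1 c) //= expr2 lerDl.
apply: sumr_ge0 => d /andP[da dc].
suff -> : N2 d c a = N2 c d a by rewrite -expr2 sqr_ge0.
apply/eqP; rewrite -subr_eq0; apply/eqP.
by rewrite codazzi (negPf da) (negPf ca) !mulr0 mul0r addr0 mulr0.
Qed.

Lemma laplace_H_ge : \sum_a (3 * (\sum_c N2 c c a ^+ 2) - 2 * N2 a a a ^+ 2 - dH a ^+ 2)
    + 2 * f0 * \sum_a k a ^+ 2 - H * K <=
  \sum_c f c * (\sum_a N3 a a c c) - 2 * f0 * W * \sum_c u c * dH c.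
Proof.
rewrite laplace_H.
have -> : \sum_a (3 * (\sum_c N2 c c a ^+ 2) - 2 * N2 a a a ^+ 2 - dH a ^+ 2) =
  \sum_a (2 * (\sum_d G a d) + \sum_c N2 c c a ^+ 2 - 2 * N2 a a a ^+ 2) +
  2 * W * (\sum_c \sum_a (f c * (u c * k a * N2 a a c - u a * k c * N2 c c a)))
  - \sum_c dH c ^+ 2.
  have e (s : R) : s = s + 2 * 0 by ring.
  rewrite !sumrB; congr (_ - _); rewrite big_split /= addrAC; congr (_ - _).
  rewrite -!mulr_sumr.
  (* The corrections contained in [G] cancel the gradient terms with factor [2 * W] in [laplace_H]:
     after exchanging summations the latter carry [f c - f a], which is [k a - k c]. *)
  have -> : \sum_a \sum_d G a d = \sum_a \sum_c N2 c c a ^+ 2 -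
      W * (\sum_c \sum_a f c * (u c * k a * N2 a a c - u a * k c * N2 c c a)).
    rewrite [X in _ = X - _]exchange_big.
    have -> : \sum_c \sum_a f c * (u c * k a * N2 a a c - u a * k c * N2 c c a) =
        \sum_a \sum_c (f c - f a) * (u c * k a * N2 a a c).
      have -> : \sum_a \sum_c (f c - f a) * (u c * k a * N2 a a c) =
          \sum_a \sum_c f c * (u c * k a * N2 a a c) -
          \sum_a \sum_c f a * (u c * k a * N2 a a c).
        rewrite -sumrB; apply: eq_bigr => a _; rewrite -sumrB.
        by apply: eq_bigr => c _; ring.
      rewrite [X in _ = X - _]exchange_big -sumrB; apply: eq_bigr => c _.
      by rewrite -sumrB; apply: eq_bigr => a _; ring.
    rewrite mulr_sumr -sumrB; apply: eq_bigr => a _.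
    rewrite mulr_sumr -sumrB; apply: eq_bigr => d _.
    by rewrite /G /f; ring.
  ring.
rewrite !lerD2r.
by apply: ler_sum => a _; exact: sum_N2_sq.
Qed.

(** For each direction [a], [weighted_square_bound] applies to the numbers [N2 c c a] with
    distinguished index [a]; their trace constraint is the differentiated equation [dF]. The term
    [2 * f0 * \sum_a k a ^+ 2] is nonnegative and is given away. *)
Lemma laplace_H_jacobi e : 0 < H -> 0 <= f0 -> (forall i, 0 < f i) ->
  \sum_a f a ^+ 2 <= 3 * H ^+ 2 -> 0 <= e ->
  (forall i, e * (8 * f i ^+ 2 - 12 * f i * H + 9 * H ^+ 2) <=
    (4 * f i + H) * (3 * H - 2 * f i)) ->
  (1 + e) / H * (\sum_c f c * dH c ^+ 2) - H * K <=
  \sum_c f c * (\sum_a N3 a a c c) - 2 * f0 * W * \sum_c u c * dH c.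
Proof.
move=> H0 f00 fgt f2 e0 he; apply: le_trans laplace_H_ge; rewrite lerD2r.
rewrite -[X in X <= _]addr0; apply: lerD; last first.
  by rewrite mulr_ge0 ?mulr_ge0// sumr_ge0// => a _; exact: sqr_ge0.
rewrite mulr_sumr; apply: ler_sum => a _.
have sf : \sum_c f c = 3 * H by rewrite sumrB sumr_const card_ord -/H; ring.
have := weighted_square_bound H0 sf f2 (dF a) (fgt a) (he a) e0.
by rewrite -/(dH a); set S := \sum_c _; move: (dH a) (f a) S => d g S; lra.
Qed.

End simons.

(** * The inequality at a maximum point *)

Section cone.
Context {R : realFieldType}.
Variables (k : 'I_4 -> R) (f0 : R).
Let H := \sum_a k a.
Let f c := H - k c.
Hypothesis H0 : 0 < H.
Hypothesis f00 : 0 < f0.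
Hypothesis f0E : 2 * f0 = H ^+ 2 - \sum_a k a ^+ 2.

Lemma cone_sum_f : \sum_c f c = 3 * H.
Proof. by rewrite sumrB sumr_const card_ord -/H; ring. Qed.

Lemma cone_sum_f2 : \sum_c f c ^+ 2 <= 3 * H ^+ 2.
Proof.
have g (h : R) : \sum_c (h - k c) ^+ 2 =
    \sum_(c < 4) h ^+ 2 - 2 * h * (\sum_a k a) + \sum_a k a ^+ 2.
  by rewrite mulr_sumr -sumrB -big_split; apply: eq_bigr => a _ /=; ring.
by rewrite g sumr_const card_ord -/H; move: f0E f00; lra.
Qed.

Lemma cone_sqr_le c : k c ^+ 2 + 2 * f0 <= H ^+ 2.
Proof.
have : k c ^+ 2 <= \sum_a k a ^+ 2.
  by rewrite (bigD1 c)//= lerDl sumr_ge0// => a _; exact: sqr_ge0.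
by move: f0E; lra.
Qed.

Lemma cone_f_gt0 c : 0 < f c.
Proof.
rewrite subr_gt0 ltNge; apply/negP => kc.
have := ler_pM (ltW H0) (ltW H0) kc kc.
by have := cone_sqr_le c; rewrite -!expr2; move: f00; lra.
Qed.

(** Cauchy-Schwarz for the three other curvatures gives [(H - k c) ^+ 2 <= 3 * (H ^+ 2 - k c ^+ 2)],
    and the positive factor [H - k c] cancels. The number three is where the dimension enters. *)
Lemma cone_k_ge c : - H <= 2 * k c.
Proof.
have h1 : (H - k c) ^+ 2 <= 3 * (H ^+ 2 - k c ^+ 2).
  have E1 : H - k c = \sum_(a | a != c) k a.
    by rewrite /H (bigD1 c)//=; ring.
  have E2 : H ^+ 2 - k c ^+ 2 = 2 * f0 + \sum_(a | a != c) k a ^+ 2.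
    by rewrite f0E (bigD1 c)//=; ring.
  pose m := (H - k c) / 3.
  have : 0 <= \sum_(a | a != c) (k a - m) ^+ 2.
    by apply: sumr_ge0 => a _; exact: sqr_ge0.
  have -> : \sum_(a | a != c) (k a - m) ^+ 2 = \sum_(a | a != c) k a ^+ 2 -
     2 * m * (\sum_(a | a != c) k a) + m ^+ 2 *+ 3.
    have -> : m ^+ 2 *+ 3 = \sum_(a : 'I_4 | a != c) m ^+ 2.
      rewrite sumr_const; congr (_ *+ _).
      have := cardC1 c; rewrite card_ord => /= E.
      by rewrite -[LHS]E; apply: eq_card => a; rewrite !inE.
    rewrite mulr_sumr -sumrB -big_split; apply: eq_bigr => a _ /=; ring.
  rewrite -E1 E2 -mulr_natr /m => h; move: h f00; nra.
have := cone_f_gt0 c; rewrite /f; move: h1; nra.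
Qed.

(** From [2 * f0 <= (H - k c) * (H + k c)] and [H + k c <= 2 * H]. This is the only lower bound for
    [f c] in the direction of a dominant curvature. *)
Lemma cone_fH_ge c : f0 <= f c * H.
Proof.
have := cone_sqr_le c; have := cone_f_gt0 c; rewrite /f; nra.
Qed.

End cone.

Lemma sqr_le_sqr (R : realDomainType) (a b : R) : 0 <= a -> a <= b ->
  a ^+ 2 <= b ^+ 2.
Proof. by move=> a0 ab; rewrite !expr2 ler_pM. Qed.

Lemma le_of_sqr_le (R : realDomainType) (a b : R) : 0 <= b ->
  a ^+ 2 <= b ^+ 2 -> a <= b.
Proof.
move=> b0 ab; rewrite leNgt; apply/negP => ba.
by have := ltr_pM b0 b0 ba ba; rewrite -!expr2 ltNge ab.
Qed.

Section max_point.
Context {R : realFieldType}.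
Implicit Types (k x nn f B : 'I_4 -> R) (s rho b H K E be Y : R).

(** This fixes [E = 300 + 2 * s]: with [rho <= 8] the terms in [H] add up to
    [8 * 13 + 8 * 24 = 296], and those in [f0 <= s * H] to [8 * 24 / 100 < 2]. *)
Lemma barrier_terms_ge f x (f0 : R) s rho H :
  0 < H -> 0 < f0 -> 0 <= s -> 0 < rho -> rho <= 8 ->
  (forall c, 0 < f c) -> \sum_c f c = 3 * H -> (forall c, x c ^+ 2 <= 8) ->
  f0 <= s * H ->
  - ((300 + 2 * s) * H / rho ^+ 2) <=
  - (13 * H + 24 / 100 * f0) / rho - 8 * (\sum_c f c * x c ^+ 2) / rho ^+ 2.
Proof.
move=> H0 f00 s0 rho0 rho8 fgt sf x8 f0sH.
have q1 : \sum_c f c * x c ^+ 2 <= 24 * H.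
  have -> : 24 * H = \sum_c f c * 8 by rewrite -mulr_suml sf; ring.
  by apply: ler_sum => c _; rewrite ler_wpM2l// ltW.
have -> : - (13 * H + 24 / 100 * f0) / rho =
    - ((13 * H + 24 / 100 * f0) * rho) / rho ^+ 2.
  by field; rewrite gt_eqF.
rewrite -!mulNr -mulrDl ler_pM2r ?invr_gt0 ?exprn_gt0//.
have q2 : (13 * H + 24 / 100 * f0) * rho <= (13 * H + 24 / 100 * (s * H)) * 8.
  apply: ler_pM => //; last by rewrite lerD2l ler_wpM2l// divr_ge0.
    by rewrite addr_ge0// mulr_ge0// ?divr_ge0// ltW.
  exact: ltW.
have sH0 : 0 <= s * H by rewrite mulr_ge0// ltW.
by move: q1 q2 sH0 H0; clear; lra.
Qed.

Lemma norm_le_of_sqr8 (y : R) : y ^+ 2 <= 8 -> `|y| <= 29 / 10.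
Proof.
move=> y8; apply: le_of_sqr_le; first by rewrite divr_ge0.
by rewrite real_normK ?num_real//; apply: le_trans y8 _; lra.
Qed.

(** The part without curvature is at most [13 / rho], the part with curvature at most
    [3 * be * |kc|]; the constants are [2 * 13 ^+ 2] and [2 * 3 ^+ 2]. *)
Lemma gradient_term_sqr_le (y n kc be rho : R) : `|y| <= 29 / 10 -> `|n| <= 1 / 100 ->
  0 < rho -> 1 / 8 <= rho^-1 -> 0 < be -> be <= 1 ->
  (4 * y / rho - be * (n + kc * (y + n))) ^+ 2 <=
  338 / rho ^+ 2 + 18 * be ^+ 2 * kc ^+ 2.
Proof.
move=> x3 nnle rho0 rinv be0 be1.
pose p := 4 * y / rho - be * n; pose q := be * (y + n) * kc.
rewrite (_ : _ - _ = p - q); last by rewrite /p /q; ring.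
have p1 : p ^+ 2 <= 169 / rho ^+ 2.
  have -> : 169 / rho ^+ 2 = (13 / rho) ^+ 2 by field; rewrite gt_eqF.
  rewrite -[p ^+ 2]real_normK ?num_real//; apply: sqr_le_sqr => //.
  rewrite /p (le_trans (ler_normB _ _))// !normrM (gtr0_norm be0).
  rewrite normfV (gtr0_norm rho0) (ger0_norm (_ : 0 <= 4))//.
  have h1 : be * `|n| <= 1 * (1 / 100) by apply: ler_pM => //; exact: ltW.
  have h2 : 4 * `|y| / rho <= 116 / 10 / rho.
    by rewrite ler_pM2r ?invr_gt0//; move: x3; clear; lra.
  by move: h1 h2 rinv; clear; lra.
have q1 : q ^+ 2 <= 9 * be ^+ 2 * kc ^+ 2.
  rewrite /q !exprMn ler_wpM2r ?sqr_ge0// [9 * _]mulrC ler_wpM2l ?sqr_ge0//.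
  rewrite (_ : 9 = 3 ^+ 2); last by ring.
  rewrite -[X in X <= _]real_normK ?num_real//; apply: sqr_le_sqr => //.
  by rewrite (le_trans (ler_normD _ _))//; move: x3 nnle; clear; lra.
have h : 0 <= (p + q) ^+ 2 by exact: sqr_ge0.
have -> : 338 / rho ^+ 2 = 2 * (169 / rho ^+ 2) by ring.
have -> : (p - q) ^+ 2 = 2 * p ^+ 2 + 2 * q ^+ 2 - (p + q) ^+ 2 by ring.
by move: p1 q1 h; clear; lra.
Qed.

(* A very negative curvature makes [K] of order [H ^+ 3], which beats every other
   term. *)
Lemma max_point_negative k f B (f0 : R) rho b H K E be c :
  0 < H -> 0 < f0 -> 0 < rho -> 300 <= E ->
  0 < be -> be <= 1 / (300 * 1000) ->
  (forall a, f a = H - k a) -> (forall a, 0 < f a) -> \sum_a f a = 3 * H ->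
  K = \sum_a f a * k a ^+ 2 -> 4 * k c <= - H ->
  (forall a, B a ^+ 2 <= 338 / rho ^+ 2 + 18 * be ^+ 2 * k a ^+ 2) ->
  - (E * H / rho ^+ 2) + 6 / 10 * be * K - \sum_a f a * B a ^+ 2 <= 0 ->
  be * (H ^+ 2 * rho ^+ 2) <= 160 * E.
Proof.
move=> H0 f00 rho0 E300 be0 be1 fE fgt sf KE kc B2 m1.
have r2 : 0 < rho ^+ 2 by rewrite exprn_gt0.
have K0 : f c * k c ^+ 2 <= K.
  rewrite KE (bigD1 c)//= lerDl sumr_ge0// => a _.
  by rewrite mulr_ge0 ?sqr_ge0// ltW.
have {}B2 : \sum_a f a * B a ^+ 2 <= 1014 * H / rho ^+ 2 + 18 * be ^+ 2 * K.
  have -> : 1014 * H / rho ^+ 2 + 18 * be ^+ 2 * K =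
    \sum_a f a * (338 / rho ^+ 2 + 18 * be ^+ 2 * k a ^+ 2).
    rewrite (_ : 1014 * H / rho ^+ 2 = 338 / rho ^+ 2 * (3 * H)); last by ring.
    rewrite -sf KE !mulr_sumr -big_split; apply: eq_bigr => a _ /=.
    by ring.
  by apply: ler_sum => a _; rewrite ler_wpM2l// ltW.
(* A single summand suffices: [f c >= H] because [k c] is negative, and
   [k c ^+ 2 >= H ^+ 2 / 16]. *)
have KH : H ^+ 3 <= 16 * K.
  have h1 : H <= f c by rewrite fE; move: kc H0; clear; lra.
  have h2 : H ^+ 2 <= 16 * k c ^+ 2.
    have -> : 16 * k c ^+ 2 = (- (4 * k c)) ^+ 2 by ring.
    by apply: sqr_le_sqr; [exact: ltW|rewrite lerNr].
  have := ler_pM (ltW H0) (sqr_ge0 H) h1 h2; rewrite -exprS => h3.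
  by move: h3 K0; clear; lra.
have K1 : 0 <= K by apply: le_trans K0; rewrite mulr_ge0 ?sqr_ge0// ltW.
have be2 : 18 * be ^+ 2 * K <= 1 / 10 * be * K.
  rewrite ler_wpM2r// expr2 mulrA ler_pM2r//.
  by move: be1; clear; lra.
have m2 : 5 / 10 * be * K <= 5 * E * H / rho ^+ 2.
  have : 1014 * H / rho ^+ 2 <= 4 * E * H / rho ^+ 2.
    by rewrite ler_pM2r ?invr_gt0// ler_pM2r//; move: E300; clear; lra.
  have -> : 5 * E * H / rho ^+ 2 = 4 * E * H / rho ^+ 2 + E * H / rho ^+ 2 by ring.
  by move: m1 B2 be2; clear; lra.
move: m2; rewrite ler_pdivlMr// => m2.
rewrite -(@ler_pM2l _ H)//.
have := ler_wpM2l (mulr_ge0 (ltW be0) (ltW r2)) KH.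
by rewrite exprS; move: m2; clear; lra.
Qed.

(* Where [f c] is comparable to [H], either [B c] is of order [1 / rho] or the
   curvature [k c] is of order [1 / (be * rho)]. *)
Lemma max_point_elliptic k f B (xc nc : R) rho b H K E be c :
  0 < H -> 0 < rho -> 1 / 8 <= rho^-1 -> 300 <= E ->
  0 < be -> be <= 1 / (300 * 1000) -> be * E = 1 / 1000 -> 4000 * E < b ->
  0 < f c -> f c * k c ^+ 2 <= K -> H / 4 <= f c ->
  `|xc| <= 29 / 10 -> 44 / 100 <= `|xc| -> `|nc| <= 1 / 100 ->
  B c = 4 * xc / rho - be * (nc + k c * (xc + nc)) ->
  6 / 10 * be * K + b / 36 * (f c * B c ^+ 2) <= E * H / rho ^+ 2 -> False.
Proof.
move=> H0 rho0 rinv E300 be0 be1 beE bE fgt K0 fc x3 xa nnle BE M.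
have r2 : 0 < rho ^+ 2 by rewrite exprn_gt0.
have E0 : 0 < E by apply: lt_le_trans E300.
have b0 : 0 < b by apply: lt_trans bE; rewrite mulr_gt0.
have K1 : 0 <= K by apply: le_trans K0; rewrite mulr_ge0 ?sqr_ge0// ltW.
have nb : be * `|nc| <= 1 / 100 / rho.
  have h : be * `|nc| <= 1 / 100 * (1 / 100).
    by apply: ler_pM => //; [exact: ltW|move: be1; clear; lra].
  by move: h rinv; clear; lra.
(* If the curvature part of [B c] is at most [1 / rho], the radial part [4 * xc / rho] survives and
   the gradient term contradicts [4000 * E < b]. Otherwise [k c] is so large that [be * K]
   contradicts [be * E = 1 / 1000]. *)
have [kx|kx] := leP (be * `|k c * (xc + nc)|) (1 / rho).
  have Bc : 1 / 2 / rho <= `|B c|.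
    have h1 : `|4 * xc / rho| <= `|B c| + (be * `|nc| + be * `|k c * (xc + nc)|).
      rewrite (_ : 4 * xc / rho = B c + (be * nc + be * (k c * (xc + nc)))).
        rewrite (le_trans (ler_normD _ _))// lerD2l.
        by rewrite (le_trans (ler_normD _ _))// !normrM (gtr0_norm be0).
      by rewrite BE; ring.
    have h2 : 176 / 100 / rho <= `|4 * xc / rho|.
      rewrite !normrM normfV (gtr0_norm rho0) (ger0_norm (_ : 0 <= 4))//.
      by rewrite ler_pM2r ?invr_gt0//; move: xa; clear; lra.
    by move: h1 h2 kx nb rinv; clear; lra.
  have Bc2 : 1 / 4 / rho ^+ 2 <= B c ^+ 2.
    rewrite -[B c ^+ 2]real_normK ?num_real//.
    have -> : 1 / 4 / rho ^+ 2 = (1 / 2 / rho) ^+ 2 by field; rewrite gt_eqF.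
    by apply: sqr_le_sqr => //; rewrite divr_ge0 ?divr_ge0// ltW.
  have h1 : H / 4 * (1 / 4 / rho ^+ 2) <= f c * B c ^+ 2.
    by apply: ler_pM => //; rewrite ?divr_ge0 ?divr_ge0 ?ltW.
  have b36 : 0 <= b / 36 by rewrite divr_ge0 ?ltW.
  have h2 := ler_wpM2l b36 h1.
  have h3 : b / 36 * (H / 4 * (1 / 4 / rho ^+ 2)) <= E * H / rho ^+ 2.
    have h4 : 0 <= 6 / 10 * be * K.
      by rewrite mulr_ge0// mulr_ge0 ?ltW// divr_gt0.
    by move: M h2 h4; clear; lra.
  move: h3; rewrite (_ : b / 36 * _ = b / 576 * H / rho ^+ 2); last first.
    by field; rewrite gt_eqF.
  rewrite ler_pM2r ?invr_gt0// ler_pM2r//.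
  by move: bE E0; clear; lra.
have k1 : 1 <= (9 * be ^+ 2 * rho ^+ 2) * k c ^+ 2.
  have h1 : 1 <= 3 * be * rho * `|k c|.
    have h2 : be * `|k c * (xc + nc)| <= be * (`|k c| * 3).
      rewrite ler_pM2l// normrM ler_wpM2l//.
      by rewrite (le_trans (ler_normD _ _))//; move: x3 nnle; clear; lra.
    have := le_trans (ltW kx) h2.
    by rewrite ler_pdivrMr//; clear; lra.
  have := ler_pM ler01 ler01 h1 h1; rewrite mulr1 -expr2 !exprMn real_normK ?num_real//.
  by rewrite (_ : 3 ^+ 2 = 9)//; clear; lra.
have h1 : H / 4 * k c ^+ 2 <= K.
  by apply: le_trans K0; rewrite ler_wpM2r ?sqr_ge0.
have h2 : 6 / 10 * be * K <= E * H / rho ^+ 2.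
  have h4 : 0 <= b / 36 * (f c * B c ^+ 2).
    apply: mulr_ge0; first by rewrite divr_ge0 ?ltW.
    by rewrite mulr_ge0 ?sqr_ge0// ltW.
  by move: M h4; clear; lra.
move: h2; rewrite ler_pdivlMr// => h2.
have H4 : 0 <= H / 4 by rewrite divr_ge0 ?ltW.
have h3 : H / 4 <= 9 * be ^+ 2 * rho ^+ 2 * K.
  have := ler_wpM2l H4 k1; rewrite mulr1 => h; apply: le_trans h _.
  rewrite mulrCA; apply: ler_wpM2l h1.
  by rewrite mulr_ge0 ?sqr_ge0// mulr_ge0 ?sqr_ge0.
have h4 : be * (6 / 10 * be * K * rho ^+ 2) <= 1 / 1000 * H.
  by rewrite -beE -[X in _ <= X]mulrA; exact: ler_wpM2l (ltW be0) _ _ h2.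
have h5 : 9 * be ^+ 2 * rho ^+ 2 * K = 15 * (be * (6 / 10 * be * K * rho ^+ 2)).
  by field.
by move: h3 h4 H0; rewrite h5; clear; lra.
Qed.

(* Otherwise [k c] is the dominant curvature and [B c] is of order [be * H]. *)
Lemma max_point_degenerate k f B (xc nc f0 : R) rho b H K E be c :
  0 < H -> 0 < f0 -> 0 < rho -> 1 / 8 <= rho^-1 -> 300 <= E ->
  0 < be -> be <= 1 / (300 * 1000) -> 0 < b ->
  0 < f c -> f c * k c ^+ 2 <= K -> f c = H - k c -> f c < H / 4 ->
  f0 <= f c * H -> 65 <= be * (H * rho) ->
  `|xc| <= 29 / 10 -> 44 / 100 <= `|xc| -> `|nc| <= 1 / 100 ->
  B c = 4 * xc / rho - be * (nc + k c * (xc + nc)) ->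
  6 / 10 * be * K + b / 36 * (f c * B c ^+ 2) <= E * H / rho ^+ 2 ->
  b * rho ^+ 2 * (be ^+ 2 * f0) <= 3600 * E.
Proof.
move=> H0 f00 rho0 rinv E300 be0 be1 b0 fgt K0 fE fc f0H Hr x3 xa nnle BE M.
have r2 : 0 < rho ^+ 2 by rewrite exprn_gt0.
have K1 : 0 <= K by apply: le_trans K0; rewrite mulr_ge0 ?sqr_ge0// ltW.
have nb : be * `|nc| <= 1 / 100 / rho.
  have h : be * `|nc| <= 1 / 100 * (1 / 100).
    by apply: ler_pM => //; [exact: ltW|move: be1; clear; lra].
  by move: h rinv; clear; lra.
have kc : 3 / 4 * H < k c by move: fc; rewrite fE; clear; lra.
(* The curvature part is at least [be * (3 / 4 * H) * (43 / 100)]. Since [65 / rho <= be * H], the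
   radial part, at most [116 / 10 / rho], cannot cancel it. *)
have Bc : be * H / 10 <= `|B c|.
  have h0 : `|be * (k c * (xc + nc))| <= `|B c| + (`|4 * xc / rho| + be * `|nc|).
    have -> : be * (k c * (xc + nc)) = - B c + (4 * xc / rho - be * nc).
      by rewrite BE; ring.
    rewrite (le_trans (ler_normD _ _))// normrN lerD2l.
    by rewrite (le_trans (ler_normB _ _))// [`|be * nc|]normrM (gtr0_norm be0).
  have h1 : 43 / 100 <= `|xc + nc|.
    have : `|xc| <= `|xc + nc| + `|nc|.
      by rewrite -{1}(addrK nc xc) ler_normB.
    by move: xa nnle; clear; lra.
  have h2 : be * (3 / 4 * H * (43 / 100)) <= `|be * (k c * (xc + nc))|.
    rewrite !normrM (gtr0_norm be0) ler_pM2l//; apply: ler_pM => //.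
    - by rewrite mulr_ge0 ?ltW// divr_gt0.
    - by rewrite divr_ge0.
    - by rewrite (le_trans (ltW kc))// ler_norm.
  have h3 : `|4 * xc / rho| <= 116 / 10 / rho.
    rewrite !normrM normfV (gtr0_norm rho0) (ger0_norm (_ : 0 <= 4))//.
    by rewrite ler_pM2r ?invr_gt0//; move: x3; clear; lra.
  have h4 : 65 / rho <= be * H by rewrite ler_pdivrMr// -mulrA.
  have h5 : 0 < rho^-1 by rewrite invr_gt0.
  have h6 : 0 < be * H by rewrite mulr_gt0.
  by move: h0 h2 h3 h4 nb h5 h6; clear; lra.
have Bc2 : (be * H / 10) ^+ 2 <= B c ^+ 2.
  rewrite -[B c ^+ 2]real_normK ?num_real//.
  by apply: sqr_le_sqr => //; rewrite divr_ge0// mulr_ge0// ltW.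
have h1 : b / 36 * (f c * (be * H / 10) ^+ 2) <= E * H / rho ^+ 2.
  have h2 : b / 36 * (f c * (be * H / 10) ^+ 2) <= b / 36 * (f c * B c ^+ 2).
    by apply: ler_wpM2l; [rewrite divr_ge0// ltW|rewrite ler_pM2l].
  have h4 : 0 <= 6 / 10 * be * K.
    by rewrite mulr_ge0// mulr_ge0 ?ltW// divr_gt0.
  by move: M h2 h4; clear; lra.
have h2 : b * rho ^+ 2 * (be ^+ 2 * (f c * H)) <= 3600 * E.
  move: h1; rewrite ler_pdivlMr// => h1.
  rewrite -(@ler_pM2l _ H)//.
  have -> : H * (b * rho ^+ 2 * (be ^+ 2 * (f c * H))) =
     3600 * (b / 36 * (f c * (be * H / 10) ^+ 2) * rho ^+ 2) by field.
  by move: h1; clear; lra.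
apply: le_trans h2; rewrite ler_pM2l ?mulr_gt0//.
by rewrite ler_pM2l// exprn_gt0.
Qed.

(** By contradiction. Through [256 / be] and [rho ^+ 2 <= 64], a larger [b * rho ^+ 2] forces
    [4 < b * be], so the loss [K / b] is at most [be * K / 4]; the second term is generous enough to
    contradict the bounds of the negative and degenerate cases. The inequality is assumed for every
    admissible [e], because [e] is chosen only after comparing the curvatures with [- H / 4]. *)
Lemma max_point_bound k x nn f B (f0 : R) s rho b H K E be :
  H = \sum_a k a -> (forall c, f c = H - k c) -> K = \sum_c f c * k c ^+ 2 ->
  E = 300 + 2 * s -> be = (1000 * E)^-1 ->
  (forall c, B c = 4 * x c / rho - be * (nn c + k c * (x c + nn c))) ->
  0 < H -> 0 < f0 -> 2 * f0 = H ^+ 2 - \sum_a k a ^+ 2 ->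
  0 <= s -> s ^+ 2 = f0 ->
  (forall c, x c ^+ 2 <= 8) -> 4 / 5 <= \sum_c x c ^+ 2 ->
  (forall c, `|nn c| <= 1 / 100) ->
  0 < rho -> rho <= 8 -> 0 < b -> 2 * f0 * b ^+ 2 <= H ^+ 2 ->
  (forall e, 0 <= e ->
    (forall i, e * (8 * f i ^+ 2 - 12 * f i * H + 9 * H ^+ 2) <=
      (4 * f i + H) * (3 * H - 2 * f i)) ->
    - (13 * H + 24 / 100 * f0) / rho - 8 * (\sum_c f c * x c ^+ 2) / rho ^+ 2 +
    (9 / 10 * be - b^-1) * K + (e * b - 1) * \sum_c f c * B c ^+ 2 <= 0) ->
  b * rho ^+ 2 <= 256 / be + 140 * 1000 * E / (be ^+ 2 * f0) + 1.
Proof.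
move=> HE fE KE EE beE' BE H0 f00 f0E s0 s2 x8 xlow nnle rho0 rho8 b0 Hb main.
have cone_sq c : k c ^+ 2 + 2 * f0 <= H ^+ 2.
  by rewrite HE; apply: cone_sqr_le; rewrite -HE.
have fgt c : 0 < f c.
  by rewrite fE HE; apply: (@cone_f_gt0 _ _ f0); rewrite -?HE.
have sf : \sum_c f c = 3 * H.
  by rewrite HE -cone_sum_f; apply: eq_bigr => c _; rewrite fE HE.
have sH : s <= H.
  apply: le_of_sqr_le; first exact: ltW.
  have := cone_sq ord0; rewrite s2; have := sqr_ge0 (k ord0); move: f00.
  by clear; lra.
have E300 : 300 <= E by rewrite EE; move: s0; clear; lra.
have E0 : 0 < E by apply: lt_le_trans E300.
have be0 : 0 < be by rewrite beE' invr_gt0 mulr_gt0.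
have beE : be * E = 1 / 1000 by rewrite beE'; field; rewrite gt_eqF.
have be1 : be <= 1 / (300 * 1000).
  rewrite beE' mul1r lef_pV2 ?posrE ?mulr_gt0//.
  by rewrite mulrC ler_pM2l.
have f0sH : f0 <= s * H by rewrite -s2 expr2 ler_wpM2l.
rewrite leNgt; apply/negP => YG.
set Y := b * rho ^+ 2 in YG.
have r2 : 0 < rho ^+ 2 by rewrite exprn_gt0.
have r64 : rho ^+ 2 <= 64.
  by rewrite (_ : 64 = 8 ^+ 2); [apply: sqr_le_sqr => //; exact: ltW|ring].
have Y1 : 256 < Y * be.
  rewrite -ltr_pdivrMr//; apply: lt_trans YG; rewrite -addrA ltrDl.
  by rewrite addr_gt0// divr_gt0 ?mulr_gt0// exprn_gt0.
have Y2 : 140 * 1000 * E < Y * (be ^+ 2 * f0).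
  rewrite -ltr_pdivrMr ?mulr_gt0 ?exprn_gt0//; apply: lt_trans YG.
  by rewrite -addrA addrCA ltrDl addr_gt0// divr_gt0.
have Y3 : 1 < Y.
  by apply: lt_trans YG; rewrite ltrDr addr_gt0// divr_gt0 ?mulr_gt0 ?exprn_gt0.
have Y0 : 0 < Y by exact: lt_trans Y3.
have bY : Y <= 64 * b by rewrite /Y [64 * b]mulrC ler_wpM2l// ltW.
have b4 : 4 < b * be.
  by have := ler_wpM2r (ltW be0) bY; move: Y1; clear; lra.
have bE : 4000 * E < b.
  have -> : 4000 * E = 4 / be by rewrite beE'; field; rewrite gt_eqF.
  by rewrite ltr_pdivrMr.
have bi : b^-1 <= be / 4.
  by rewrite -(@ler_pM2l _ b)// mulfV ?gt_eqF//; move: b4; clear; lra.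
have bad := barrier_terms_ge H0 f00 s0 rho0 rho8 fgt sf x8 f0sH.
rewrite -EE in bad.
have K0 c : f c * k c ^+ 2 <= K.
  rewrite KE (bigD1 c)//= lerDl sumr_ge0// => a _.
  by rewrite mulr_ge0 ?sqr_ge0// ltW.
have Kge0 : 0 <= K by apply: le_trans (K0 ord0); rewrite mulr_ge0 ?sqr_ge0// ltW.
have beK : 6 / 10 * be * K <= (9 / 10 * be - b^-1) * K.
  by rewrite ler_wpM2r//; move: bi be0; clear; lra.
have x3 c := norm_le_of_sqr8 (x8 c).
have rinv : 1 / 8 <= rho^-1.
  by rewrite -(@ler_pM2l _ rho)// mulfV ?gt_eqF//; move: rho8; clear; lra.
(* The bound of [b] by [H] turns a lower bound for [Y = b * rho ^+ 2] into one for [H * rho]. *)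
have Hrho : (2 * f0) * Y ^+ 2 <= 64 * (H ^+ 2 * rho ^+ 2).
  have -> : 2 * f0 * Y ^+ 2 = rho ^+ 2 * (rho ^+ 2 * (2 * f0 * b ^+ 2)).
    by rewrite /Y; ring.
  rewrite [H ^+ 2 * _]mulrC; apply: ler_pM => //; first exact: ltW.
    by rewrite !mulr_ge0 ?sqr_ge0// ltW.
  by rewrite ler_pM2l.
case: (boolP [exists c, 4 * k c <= - H]) => [/existsP[c kc]|/existsPn kq].
  have main0 : - (13 * H + 24 / 100 * f0) / rho -
      8 * (\sum_c f c * x c ^+ 2) / rho ^+ 2 + (9 / 10 * be - b^-1) * K +
      (0 * b - 1) * \sum_c f c * B c ^+ 2 <= 0.
    apply: main => // i; rewrite mul0r mulr_ge0//.
      by rewrite addr_ge0 ?mulr_ge0// ltW.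
    have := @cone_k_ge _ k f0; rewrite -HE => /(_ H0 f00 f0E i).
    by rewrite fE; clear; lra.
  rewrite mul0r sub0r mulN1r in main0.
  have m3 : be * (H ^+ 2 * rho ^+ 2) <= 160 * E.
    apply: (@max_point_negative k f B f0 rho b H K E be c) => //.
      move=> a; rewrite BE; apply: gradient_term_sqr_le => //.
      by move: be1; clear; lra.
    by move: main0 bad beK; clear; lra.
  have m4 : be * (2 * f0) * Y ^+ 2 <= 64 * 160 * E.
    by have := ler_wpM2l (ltW be0) Hrho; move: m3; clear; lra.
  have m5 : be * (2 * f0) * Y <= be * (2 * f0) * Y ^+ 2.
    by rewrite ler_pM2l ?mulr_gt0// expr2 ler_pMr// ltW.
  have m6 : Y * (be ^+ 2 * f0) <= Y * (be * f0).
    rewrite ler_pM2l// ler_pM2r// expr2 ler_piMr ?ltW//.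
    by apply: le_lt_trans be1 _; clear; lra.
  by move: m4 m5 m6 Y2 E0; clear; lra.
have m1 : - (13 * H + 24 / 100 * f0) / rho -
    8 * (\sum_c f c * x c ^+ 2) / rho ^+ 2 + (9 / 10 * be - b^-1) * K +
    (1 / 18 * b - 1) * \sum_c f c * B c ^+ 2 <= 0.
  apply: main => [|i]; first by rewrite divr_ge0.
  have := kq i; have := fgt i; rewrite -ltNge fE => h1 h2.
  (* This decomposition certifies the value 1/18: each summand is nonnegative once [k i] lies
     between [- H / 4] and [H]. *)
  rewrite -subr_ge0 (_ : _ - _ = 38 / 9 * ((H - k i) * (H + 2 * k i))
    + H * (H + 4 * k i) / 2); last by field.
  have h3 : 0 <= H + 2 * k i by move: h2 H0; clear; lra.
  have h4 : 0 <= H + 4 * k i by move: h2; clear; lra.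
  apply: addr_ge0; first by rewrite mulr_ge0 ?divr_ge0// mulr_ge0// ltW.
  by rewrite divr_ge0// mulr_ge0// ltW.
have b36 : b / 36 <= 1 / 18 * b - 1 by move: bE E300; clear; lra.
have fB c : b / 36 * (f c * B c ^+ 2) <= (1 / 18 * b - 1) * \sum_c f c * B c ^+ 2.
  apply: ler_pM => //; first by rewrite divr_ge0// ltW.
    by rewrite mulr_ge0 ?sqr_ge0// ltW.
  rewrite (bigD1 c)//= lerDl sumr_ge0// => a _.
  by rewrite mulr_ge0 ?sqr_ge0// ltW.
have M c : 6 / 10 * be * K + b / 36 * (f c * B c ^+ 2) <= E * H / rho ^+ 2.
  by move: m1 bad beK (fB c); clear; lra.
(* Pigeonhole over the four components. In this direction the radial part of [B c] is of order
   [1 / rho], and 44/100 is just below the square root of 1/5. *)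
have [c xc] : exists c, 1 / 5 <= x c ^+ 2.
  apply/existsP; apply: contraT => /existsPn h.
  have : \sum_c x c ^+ 2 < \sum_(c < 4) 1 / 5.
    apply: ltr_sum => [|c _]; first by apply/hasP; exists ord0; rewrite ?mem_index_enum.
    by rewrite ltNge; exact: h.
  by rewrite sumr_const card_ord; move: xlow; clear; lra.
have xa : 44 / 100 <= `|x c|.
  apply: le_of_sqr_le => //; rewrite real_normK ?num_real//.
  by apply: le_trans xc; clear; lra.
have [fc|fc] := leP (H / 4) (f c).
  exact: (@max_point_elliptic k f B (x c) (nn c) rho b H K E be c).
have Hr : 65 <= be * (H * rho).
  apply: le_of_sqr_le; first by rewrite !mulr_ge0 ?ltW.
  rewrite !exprMn.
  have h1 : 140 * 1000 * E * 1 <= Y * (be ^+ 2 * f0) * Y.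
    apply: ler_pM => //; rewrite ?mulr_ge0// ?ltW//.
  have h2 : be ^+ 2 * (2 * f0 * Y ^+ 2) <= be ^+ 2 * (64 * (H ^+ 2 * rho ^+ 2)).
    by rewrite ler_wpM2l ?sqr_ge0.
  by move: h1 h2 E300; clear; lra.
have f0H : f0 <= f c * H.
  have := @cone_fH_ge _ k f0; rewrite -HE fE => h; exact: h.
have := @max_point_degenerate k f B (x c) (nn c) f0 rho b H K E be c H0 f00 rho0 rinv E300
  be0 be1 b0 (fgt c) (K0 c) (fE c) fc f0H Hr (x3 c) xa (nnle c) (BE c) (M c).
by rewrite -/Y; move: Y2 E0; clear; lra.
Qed.

End max_point.

From mathcomp Require Import all_classical all_reals all_analysis.
Import Order.TTheory GRing.Theory Num.Theory.
Import numFieldNormedType.Exports.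
Local Open Scope classical_set_scope.
Local Open Scope ring_scope.

(** * Directional derivatives *)

Section directional.
Context {R : realType} {V : normedModType R}.
Implicit Types (f g : V -> R) (x v w : V) (U : set V).

Lemma derive_line f x v t : derivable f (x + t *: v) v ->
  is_derive t 1 (fun s : R => f (x + s *: v)) ('D_v f (x + t *: v)).
Proof.
have E : (fun h : R => h^-1 *: (f (h *: v + (x + t *: v)) - f (x + t *: v))) =
  (fun h : R => h^-1 *: (((fun s => f (x + s *: v)) \o shift t) (h *: 1) -
    f (x + t *: v))).
  apply/funext => h /=; congr (_ *: (f _ - _)).
  by rewrite [h *: 1]mulr1 scalerDl addrCA.
by move=> df; split; rewrite /derivable /derive -E.
Qed.

Lemma is_derive_line0 f x v d :
  is_derive (0 : R) 1 (fun s : R => f (x + s *: v)) d -> is_derive x v f d.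
Proof.
have E : (fun h : R => h^-1 *: (f (h *: v + x) - f x)) =
  (fun h : R => h^-1 *: (((fun s => f (x + s *: v)) \o shift 0) (h *: 1) -
    f (x + 0 *: v))).
  by apply/funext => h /=; rewrite [h *: 1]mulr1 addr0 scale0r addr0 [x + _]addrC.
by case=> dh dE; split; rewrite /derivable /derive E.
Qed.

Lemma is_derive_comp1 (g : R -> R) f x v a b : is_derive x v f b ->
  is_derive (f x) 1 g a -> is_derive x v (fun y => g (f y)) (a * b).
Proof.
move=> [df fb] dg; apply: is_derive_line0.
apply: (@is_derive1_comp _ g (fun s => f (x + s *: v))).
  by rewrite scale0r addr0.
by have := @derive_line f x v 0; rewrite scale0r addr0 fb; apply.
Qed.

Lemma line_cvg x v : (fun t : R => x + t *: v) @ 0 --> x.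
Proof.
rewrite -[X in _ --> X]addr0 -[X in _ --> _ + X](scale0r v).
by apply: cvgD; [exact: cvg_cst|apply: cvgZr_tmp; exact: cvg_id].
Qed.

Lemma line_near U x v : open U -> U x -> \forall t \near (0 : R), U (x + t *: v).
Proof.
move=> oU Ux; have /(_ U) := @line_cvg x v.
by apply; rewrite nbhsE; exists U.
Qed.

Lemma derive_scale f x v (t : R) : derivable f x v ->
  is_derive x (t *: v) f (t * 'D_v f x).
Proof.
move=> df; apply: is_derive_line0.
have -> : (fun s : R => f (x + s *: (t *: v))) =
    (fun s : R => f (x + s *: v)) \o (fun s => s * t).
  by apply/funext => s /=; rewrite scalerA.
rewrite [t * _]mulrC; apply: is_derive1_comp.
  by have := @derive_line f x v 0; rewrite scale0r addr0 mul0r; apply.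
have := @is_deriveM R R id (cst t) 0 1 1 0 (is_derive_id _ _) (is_derive_cst _ _ _).
by rewrite scaler0 add0r [_ *: _]mulr1; apply.
Qed.

(** The conclusion uses [|c| <= |t|] instead of betweenness, so that both signs of [t] are covered
    at once, as limits over a punctured neighbourhood require. *)
Lemma segment_MVT f x v (t : R) :
  (forall s, `|s| <= `|t| -> derivable f (x + s *: v) v) ->
  exists2 c, `|c| <= `|t| & f (x + t *: v) - f x = t * 'D_v f (x + c *: v).
Proof.
have key y w : (forall s, 0 <= s <= 1 -> derivable f (y + s *: w) w) ->
    exists2 c, 0 <= c <= 1 & f (y + w) - f y = 'D_w f (y + c *: w).
  move=> df.
  have [||c] := @MVT_segment R (fun s => f (y + s *: w))
    (fun s => 'D_w f (y + s *: w)) 0 1 ler01.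
  - move=> s; rewrite in_itv /= => /andP[/ltW s0 /ltW s1].
    by apply: derive_line; apply: df; rewrite s0.
  - apply: derivable_within_continuous => s; rewrite in_itv /= => s01.
    by have [] := derive_line (df s s01).
  rewrite in_itv /= scale0r addr0 scale1r subr0 mulr1 => c01 E.
  by exists c.
move=> df.
have [|c /andP[c0 c1] E] := @key x (t *: v).
  move=> s /andP[s0 s1]; rewrite scalerA.
  have [] := @derive_scale f (x + (s * t) *: v) v t; last by [].
  apply: df.
  by rewrite normrM ger0_norm// ler_piMl.
have ct : `|c * t| <= `|t| by rewrite normrM ger0_norm// ler_piMl.
exists (c * t) => //; rewrite E scalerA.
by rewrite (@derive_val _ _ _ _ _ _ _ (derive_scale t (df _ ct))).
Qed.

Lemma nbhs_radius (P : set V) x : (\forall y \near x, P y) ->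
  exists2 d : R, 0 < d & forall y, `|y - x| < d -> P y.
Proof.
move=> /nbhs_normP[d d0 dP]; exists d => // y yx; apply: dP.
by rewrite /ball_/= distrC.
Qed.

(** Directional derivatives need not be additive in the direction. Here the increment along [w],
    started at the moving point [x + h v], is a value of ['D_w f] near [x] by the mean value
    theorem, and continuity of ['D_w f] gives its limit. *)
Lemma is_derive_add f x v w : derivable f x v ->
  (\forall y \near x, derivable f y w) -> {for x, continuous ('D_w f)} ->
  is_derive x (v + w) f ('D_v f x + 'D_w f x).
Proof.
move=> dv dw cw.
pose q (h : R) := h^-1 *: (f (h *: w + (h *: v + x)) - f (h *: v + x)).
have qw : q @ 0^' --> 'D_w f x.
  apply/cvgrPdist_lt => e e0.
  have /nbhs_radius[d d0 dP] : \forall y \near x,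
      derivable f y w /\ `|'D_w f x - 'D_w f y| < e.
    have /cvgrPdist_lt/(_ _ e0) h1 := cw.
    by apply: filterS2 dw h1.
  pose k : R := `|v| + `|w| + 1.
  have k0 : 0 < k by rewrite ltr_wpDl// addr_ge0.
  have small (h c : R) : `|h| < d / k -> `|c| <= `|h| ->
      `|(h *: v + x) + c *: w - x| < d.
    rewrite ltr_pdivlMr// => hd ch; apply: le_lt_trans hd.
    rewrite [_ + x + _]addrAC addrK (le_trans (ler_normD _ _))// !normrZ.
    rewrite /k !mulrDr mulr1 -addrA lerD2l.
    by rewrite ler_wpDr// ler_wpM2r.
  have hd : 0^' (fun h : R => `|h| < d / k).
    apply: nbhs_dnbhs; apply/nbhs_normP; exists (d / k); first exact: divr_gt0.
    by move=> h; rewrite /ball_/= sub0r normrN.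
  near=> h.
  have h0 : h != 0 by near: h; exact: nbhs_dnbhs_neq.
  have hk : `|h| < d / k by near: h.
  have [c ch E] := @segment_MVT f (h *: v + x) w h
    (fun s sh => (dP _ (small h s hk sh)).1).
  rewrite /q [h *: w + _]addrC E -[_ *: (_ * _)]/(_ * _) mulKf//.
  exact: (dP _ (small h c hk ch)).2.
have E : (fun h : R => h^-1 *: (f (h *: (v + w) + x) - f x)) =
   (fun h : R => h^-1 *: (f (h *: v + x) - f x)) \+ q.
  apply/funext => h /=; rewrite /q -scalerDr; congr (_ *: _).
  rewrite [RHS]addrC addrA subrK; congr (f _ - _).
  by rewrite scalerDr addrA [h *: w + _]addrC.
have cD : (fun h : R => h^-1 *: (f (h *: (v + w) + x) - f x)) @ 0^' -->
    'D_v f x + 'D_w f x by rewrite E; exact: cvgD.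
by split; [apply/cvg_ex; exists ('D_v f x + 'D_w f x)|exact: cvg_lim].
Unshelve. all: by end_near. Qed.

Lemma is_derive_shiftl f x y v d : is_derive (x + y) v f d ->
  is_derive x v (fun z => f (z + y)) d.
Proof.
have E : (fun h : R => h^-1 *: (f (h *: v + (x + y)) - f (x + y))) =
  (fun h : R => h^-1 *: (f ((h *: v + x) + y) - f (x + y))).
  by apply/funext => h /=; rewrite addrA.
by case=> dh dE; split; rewrite /derivable /derive -E.
Qed.

(** The second difference is symmetric in [v] and [w], and two applications of the mean value
    theorem express it by a mixed derivative at a nearby point. Exchanging the directions compares
    the two mixed derivatives, which is how [schwarz] uses this. *)
Lemma derive_swap_near f U x v w : open U -> U x ->
  (forall y, U y -> derivable f y v) ->
  (forall y, U y -> derivable ('D_v f) y w) ->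
  exists2 d : R, 0 < d & forall t : R, t != 0 -> `|t| < d ->
  exists y, `|y - x| <= `|t| * (`|v| + `|w|) /\
   f (x + t *: v + t *: w) - f (x + t *: v) - f (x + t *: w) + f x =
    t * (t * 'D_w ('D_v f) y).
Proof.
move=> oU Ux df ddf.
have /nbhs_radius[d d0 dU] : nbhs x U by rewrite nbhsE; exists U.
pose k : R := `|v| + `|w| + 1.
have k0 : 0 < k by rewrite ltr_wpDl// addr_ge0.
exists (d / k); first exact: divr_gt0.
move=> t t0 td.
have est (a b : R) : `|a| <= `|t| -> `|b| <= `|t| ->
    `|x + a *: v + b *: w - x| <= `|t| * (`|v| + `|w|).
  move=> ta tb; rewrite -[x + _ + _]addrA [x + _]addrC addrK.
  rewrite (le_trans (ler_normD _ _))// !normrZ mulrDr.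
  by apply: lerD; apply: ler_wpM2r.
have inU (a b : R) : `|a| <= `|t| -> `|b| <= `|t| -> U (x + a *: v + b *: w).
  move=> ta tb; apply: dU; apply: le_lt_trans (est _ _ ta tb) _.
  rewrite ltr_pdivlMr// in td; apply: le_lt_trans td.
  by rewrite ler_wpM2l// /k lerDl.
have dg a : `|a| <= `|t| -> is_derive (x + a *: v) v
    (fun z => f (z + t *: w) - f z)
    ('D_v f (x + a *: v + t *: w) - 'D_v f (x + a *: v)).
  move=> ta; apply: is_deriveB.
    by apply: is_derive_shiftl; apply/derivableP/df/inU.
  apply/derivableP/df; have := inU a 0 ta.
  by rewrite scale0r addr0 normr0; exact.
have [a ta E] := @segment_MVT (fun z => f (z + t *: w) - f z) x v t
  (fun s sh => @ex_derive _ _ _ _ _ _ _ (dg s sh)).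
have [b tb E'] := @segment_MVT ('D_v f) (x + a *: v) w t
  (fun s sh => ddf _ (inU a s ta sh)).
exists (x + a *: v + b *: w); split; first exact: est.
rewrite -E' -(@derive_val _ _ _ _ _ _ _ (dg a ta)) -E.
by rewrite opprD opprK addrA.
Qed.

Lemma continuous_eq_of_close (A B : V -> R) x :
  {for x, continuous A} -> {for x, continuous B} ->
  (forall d : R, 0 < d ->
    exists y z, [/\ `|y - x| < d, `|z - x| < d & A y = B z]) -> A x = B x.
Proof.
move=> cA cB AB; apply/eqP; rewrite -subr_eq0 -normr_le0.
apply/ler_addgt0Pl => e e0; rewrite addr0.
have e20 : 0 < e / 2 by rewrite divr_gt0.
have /nbhs_radius[d d0 dP] :
    \forall y \near x, `|A x - A y| < e / 2 /\ `|B x - B y| < e / 2.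
  have /cvgrPdist_lt/(_ _ e20) h1 := cA.
  have /cvgrPdist_lt/(_ _ e20) h2 := cB.
  exact: filterI h1 h2.
have [y [z [yx zx yz]]] := AB d d0.
have [Ey _] := dP _ yx; have [_ Ez] := dP _ zx.
rewrite (_ : _ - _ = (A x - A y) - (B x - B z)); last by rewrite yz; ring.
by rewrite (le_trans (ler_normB _ _))// [e]splitr lerD// ltW.
Qed.

Lemma schwarz f U x v w : open U -> U x ->
  (forall y, U y -> derivable f y v) -> (forall y, U y -> derivable f y w) ->
  (forall y, U y -> derivable ('D_v f) y w) ->
  (forall y, U y -> derivable ('D_w f) y v) ->
  {for x, continuous ('D_w ('D_v f))} -> {for x, continuous ('D_v ('D_w f))} ->
  'D_w ('D_v f) x = 'D_v ('D_w f) x.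
Proof.
move=> oU Ux dv dw dvw dwv cA cB.
apply: (continuous_eq_of_close cA cB) => d d0.
have [d1 d10 PA] := derive_swap_near oU Ux dv dvw.
have [d2 d20 PB] := derive_swap_near oU Ux dw dwv.
pose k : R := `|v| + `|w| + 1.
have k0 : 0 < k by rewrite ltr_wpDl// addr_ge0.
pose t : R := Num.min (d / k) (Num.min d1 d2) / 2.
have m0 : 0 < Num.min (d / k) (Num.min d1 d2) by rewrite !lt_min d10 d20 divr_gt0.
have t0 : 0 < t by rewrite divr_gt0.
have tm : `|t| < Num.min (d / k) (Num.min d1 d2).
  by rewrite gtr0_norm// /t ltr_pdivrMr// ltr_pMr// ltr1n.
move: tm; rewrite !lt_min => /and3P[td td1 td2].
have tn0 : t != 0 by rewrite gt_eqF.
have cancel (a b p q : R) : p = t * (t * a) -> q = t * (t * b) -> p = q -> a = b.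
  by move=> -> -> /(mulfI tn0)/(mulfI tn0).
have [y [yx E1]] := PA _ tn0 td1; have [z [zx E2]] := PB _ tn0 td2.
have tk : `|t| * (`|v| + `|w|) < d.
  rewrite ltr_pdivlMr// in td; apply: le_lt_trans td.
  by rewrite ler_wpM2l// /k lerDl.
exists y, z; split.
- exact: le_lt_trans yx tk.
- by apply: le_lt_trans zx _; rewrite addrC.
refine (cancel _ _ _ _ E1 E2 _).
rewrite -[x + t *: v + _]addrA [t *: v + _]addrC addrA.
move: (f x) (f _) (f _) (f _) => a b c e; ring.
Qed.

End directional.

(** * Functions with continuous directional derivatives up to order k *)

Section Ck.
Context {R : realType} {V : normedModType R}.
Implicit Types (f g : V -> R) (x v w : V) (U : set V) (k : nat).

(** All directions are allowed, so the notion does not depend on a basis and the derivatives along a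
    principal frame are covered; [smooth_on] speaks of coordinate directions only. *)
Fixpoint Ck k U f : Prop :=
  (forall x, U x -> {for x, continuous f}) /\
  if k is j.+1 then
    (forall v x, U x -> derivable f x v) /\ (forall v, Ck j U ('D_v f))
  else True.

Lemma CkS k U f : Ck k.+1 U f <->
  [/\ forall x, U x -> {for x, continuous f},
      forall v x, U x -> derivable f x v & forall v, Ck k U ('D_v f)].
Proof. by split=> [[? []]|[]]. Qed.

Lemma Ck0 U f : (forall x, U x -> {for x, continuous f}) -> Ck 0 U f.
Proof. by []. Qed.

Lemma Ck_continuous k U f x : Ck k U f -> U x -> {for x, continuous f}.
Proof. by case: k => [|k] [fc _] /fc. Qed.

Lemma Ck_derivable k U f x v : Ck k.+1 U f -> U x -> derivable f x v.
Proof. by move=> /CkS[_ fd _] Ux; exact: fd. Qed.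

Lemma Ck_D k U f v : Ck k.+1 U f -> Ck k U ('D_v f).
Proof. by move=> /CkS[_ _]; exact. Qed.

Lemma Ck_ext k U f g : open U -> (forall x, U x -> f x = g x) ->
  Ck k U f -> Ck k U g.
Proof.
move=> oU; have nr (h1 h2 : V -> R) x : (forall x, U x -> h1 x = h2 x) -> U x ->
    \forall y \near x, h1 y = h2 y.
  move=> E Ux; suff : nbhs x U by apply: filterS.
  by rewrite nbhsE; exists U.
have ct (h1 h2 : V -> R) : (forall x, U x -> h1 x = h2 x) ->
    (forall x, U x -> {for x, continuous h1}) ->
    forall x, U x -> {for x, continuous h2}.
  move=> E h1c x Ux; have := h1c x Ux; rewrite /prop_for /continuous_at -E//.
  by apply: cvg_trans; apply: near_eq_cvg; apply: nr => // y Uy; rewrite E.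
elim: k f g => [|k ih] f g E Cf.
  by apply: Ck0; apply: (ct f) => // x; exact: (Ck_continuous Cf).
have [fc fd fD] := (CkS _ _ _).1 Cf; apply/CkS; split; first exact: ct fc.
  by move=> v x Ux; apply: near_eq_derivable (fd v x Ux); exact: nr.
by move=> v; apply: ih (fD v) => x Ux; apply: near_eq_derive; exact: nr.
Qed.

Lemma Ck_is_derive k U f (df : V -> V -> R) : open U ->
  (forall x, U x -> {for x, continuous f}) ->
  (forall x v, U x -> is_derive x v f (df v x)) ->
  (forall v, Ck k U (df v)) -> Ck k.+1 U f.
Proof.
move=> oU fc fd dk; apply/CkS; split=> // [v x Ux|v]; first by case: (fd x v Ux).
by apply: Ck_ext (dk v) => // x Ux; case: (fd x v Ux).
Qed.

Lemma CkW k U f : Ck k.+1 U f -> Ck k U f.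
Proof.
elim: k f => [|k ih] f /CkS[fc fd fD]; first exact: Ck0.
by apply/CkS; split=> // v; exact: ih.
Qed.

Lemma Ck_le k m U f : (k <= m)%N -> Ck m U f -> Ck k U f.
Proof.
move=> /subnK <-; elim: (m - k)%N => // i ih.
by rewrite addSn => /CkW; exact: ih.
Qed.

Lemma Ck_cst k U (c : R) : Ck k U (fun=> c).
Proof.
elim: k c => [|k ih] c; first by apply: Ck0 => x _; exact: cvg_cst.
apply/CkS; split=> [x _|v x _|v]; [exact: cvg_cst|exact: derivable_cst|].
by rewrite (_ : 'D_v _ = fun=> 0)//; apply/funext => x; exact: derive_cst.
Qed.

Lemma Ck_add k U f g : open U -> Ck k U f -> Ck k U g ->
  Ck k U (fun x => f x + g x).
Proof.
move=> oU.
have cD f1 g1 j i : Ck i U f1 -> Ck j U g1 -> forall x, U x ->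
    {for x, continuous (fun x => f1 x + g1 x)}.
  move=> Cf Cg x Ux; apply: cvgD; [exact: Ck_continuous Cf Ux|].
  exact: Ck_continuous Cg Ux.
elim: k f g => [|k ih] f g Cf Cg; first by apply: Ck0; exact: cD Cf Cg.
have [_ fd fD] := (CkS _ _ _).1 Cf; have [_ gd gD] := (CkS _ _ _).1 Cg.
apply: (@Ck_is_derive _ _ _ (fun v x => 'D_v f x + 'D_v g x)) => //.
- exact: cD Cf Cg.
- by move=> x v Ux; apply: is_deriveD; apply: derivableP; [exact: fd|exact: gd].
by move=> v; apply: ih.
Qed.

Lemma Ck_mul k U f g : open U -> Ck k U f -> Ck k U g ->
  Ck k U (fun x => f x * g x).
Proof.
move=> oU.
have cM f1 g1 j i : Ck i U f1 -> Ck j U g1 -> forall x, U x ->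
    {for x, continuous (fun x => f1 x * g1 x)}.
  move=> Cf Cg x Ux; apply: cvgM; [exact: Ck_continuous Cf Ux|].
  exact: Ck_continuous Cg Ux.
elim: k f g => [|k ih] f g Cf Cg; first by apply: Ck0; exact: cM Cf Cg.
have [_ fd fD] := (CkS _ _ _).1 Cf; have [_ gd gD] := (CkS _ _ _).1 Cg.
apply: (@Ck_is_derive _ _ _ (fun v x => f x * 'D_v g x + g x * 'D_v f x)) => //.
- exact: cM Cf Cg.
- by move=> x v Ux; apply: is_deriveM; apply: derivableP; [exact: fd|exact: gd].
by move=> v; apply: Ck_add => //; apply: ih => //; exact: CkW.
Qed.

Lemma Ck_scale k U f (c : R) : open U -> Ck k U f -> Ck k U (fun x => c * f x).
Proof. by move=> oU; apply: Ck_mul => //; exact: Ck_cst. Qed.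

Lemma Ck_sum k U (I : Type) (r : seq I) (F : I -> V -> R) : open U ->
  (forall i, Ck k U (F i)) -> Ck k U (fun x => \sum_(i <- r) F i x).
Proof.
move=> oU FC; elim: r => [|i r ih].
  by apply: (Ck_ext oU _ (Ck_cst k U 0)) => x _; rewrite big_nil.
apply: (Ck_ext oU _ (Ck_add oU (FC i) ih)) => x _.
by rewrite big_cons.
Qed.

Lemma Ck_inv k U f : open U -> (forall x, U x -> f x != 0) -> Ck k U f ->
  Ck k U (fun x => (f x)^-1).
Proof.
move=> oU f0; elim: k => [|k ih] Cf.
  apply: Ck0 => x Ux; apply: cvgV; [exact: f0|exact: Ck_continuous Cf Ux].
have [fc fd fD] := (CkS _ _ _).1 Cf; have Ci := ih (CkW Cf).
apply: (@Ck_is_derive _ _ _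
    (fun v x => -1 * ((f x)^-1 * (f x)^-1) * 'D_v f x)) => //.
- by move=> x Ux; apply: cvgV; [exact: f0|exact: fc].
- move=> x v Ux; split; first by apply: derivableV; [exact: f0|exact: fd].
  by rewrite deriveV//; [rewrite expr2 invfM mulN1r|exact: f0|exact: fd].
by move=> v; apply: Ck_mul => //; apply: Ck_scale => //; exact: Ck_mul.
Qed.

(** The regularity of [dh] along [f] may be derived from that of [h] along [f] at the same order.
    This suits the square root, whose derivative is a rational function of itself, and makes the
    induction on the order close. *)
Lemma Ck_comp k U f (h dh : R -> R) : open U ->
  (forall x, U x -> is_derive (f x) 1 h (dh (f x))) ->
  (forall j, (j <= k)%N -> Ck j U (fun x => h (f x)) -> Ck j U (fun x => dh (f x))) ->
  Ck k.+1 U f -> Ck k.+1 U (fun x => h (f x)).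
Proof.
move=> oU hd dhC Cf.
have hc x : U x -> {for x, continuous (fun y => h (f y))}.
  move=> Ux; apply: continuous_comp; first exact: Ck_continuous Cf Ux.
  have [hdx _] := hd x Ux.
  exact/differentiable_continuous/derivable1_diffP.
suff main j : (j <= k.+1)%N -> Ck j U (fun x => h (f x)) by exact: main.
elim: j => [|j ih] jk; first exact: Ck0.
apply: (@Ck_is_derive _ _ _ (fun v x => dh (f x) * 'D_v f x)) => //.
  move=> x v Ux; apply: is_derive_comp1; last exact: hd.
  by apply: derivableP; exact: Ck_derivable Cf Ux.
move=> v; apply: Ck_mul => //; last exact: Ck_le (Ck_D v Cf).
by apply: dhC => //; apply: ih; exact: ltnW.
Qed.

Lemma Ck_sqrt k U f : open U -> (forall x, U x -> 0 < f x) -> Ck k.+1 U f ->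
  Ck k.+1 U (fun x => Num.sqrt (f x)).
Proof.
move=> oU f0; apply: (@Ck_comp _ _ _ _ (fun y => (2 * Num.sqrt y)^-1)) => //.
  by move=> x Ux; apply: is_derive1_sqrt; exact: f0.
move=> j _ Cs; apply: Ck_inv => //; last exact: Ck_scale.
by move=> x Ux; rewrite mulf_neq0// gt_eqF// sqrtr_gt0 f0.
Qed.

Lemma Ck_ln k U f : open U -> (forall x, U x -> 0 < f x) -> Ck k.+1 U f ->
  Ck k.+1 U (fun x => ln (f x)).
Proof.
move=> oU f0 Cf; apply: (@Ck_comp _ _ _ _ (fun y => y^-1)) (Cf) => //.
  by move=> x Ux; apply: is_derive1_ln; exact: f0.
move=> j jk _; apply: Ck_inv => //; last by apply: Ck_le Cf; exact: leqW.
by move=> x Ux; rewrite gt_eqF// f0.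
Qed.

Lemma Ck_swap U f x v w : open U -> Ck 2 U f -> U x ->
  'D_w ('D_v f) x = 'D_v ('D_w f) x.
Proof.
move=> oU Cf Ux; apply: (schwarz oU Ux).
- by move=> y; exact: Ck_derivable Cf.
- by move=> y; exact: Ck_derivable Cf.
- by move=> y; exact: Ck_derivable (Ck_D v Cf).
- by move=> y; exact: Ck_derivable (Ck_D w Cf).
- exact: Ck_continuous (Ck_D w (Ck_D v Cf)) Ux.
exact: Ck_continuous (Ck_D v (Ck_D w Cf)) Ux.
Qed.

Lemma Ck_deriveD U f x v w : open U -> Ck 1 U f -> U x ->
  'D_(v + w) f x = 'D_v f x + 'D_w f x.
Proof.
move=> oU Cf Ux; have nU : nbhs x U by rewrite nbhsE; exists U.
have [||//] := @is_derive_add _ _ f x v w (Ck_derivable Cf Ux).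
  by apply: filterS nU => y; exact: Ck_derivable Cf.
exact: Ck_continuous (Ck_D w Cf) Ux.
Qed.

Lemma Ck_derive_sum U f x (I : Type) (r : seq I) (c : I -> R) (e : I -> V) :
  open U -> Ck 1 U f -> U x ->
  'D_(\sum_(i <- r) c i *: e i) f x = \sum_(i <- r) c i * 'D_(e i) f x.
Proof.
move=> oU Cf Ux; elim: r => [|i r ih]; first by rewrite !big_nil derive0.
rewrite !big_cons (Ck_deriveD _ _ oU Cf Ux) ih; congr (_ + _).
by have [_ ->] := derive_scale (c i) (@Ck_derivable _ _ _ _ (e i) Cf Ux).
Qed.

End Ck.

Lemma is_derive_coord (R : realType) n (x v : 'rV[R]_n) i :
  is_derive x v (fun y : 'rV[R]_n => y 0 i) (v 0 i).
Proof.
have cv : (fun h : R => h^-1 *: ((h *: v + x) 0 i - x 0 i)) @ 0^' --> v 0 i.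
  apply: cvg_near_cst; near=> h.
  have h0 : h != 0 by near: h; exact: nbhs_dnbhs_neq.
  by rewrite !mxE addrK -[_ *: _]/(_ * _) mulKf.
by split; [apply/cvg_ex; exists (v 0 i)|exact: cvg_lim].
Unshelve. all: by end_near. Qed.

Lemma Ck_coord (R : realType) n k (U : set 'rV[R]_n) i :
  Ck k U (fun x : 'rV[R]_n => x 0 i).
Proof.
have dE (x v : 'rV[R]_n) := is_derive_coord x v i.
have cE (x : 'rV[R]_n) : {for x, continuous (fun x : 'rV[R]_n => x 0 i)}.
  exact: coord_continuous.
case: k => [|k]; first exact: Ck0.
apply/CkS; split=> [//|v x _|v]; first by case: (dE x v).
rewrite (_ : 'D_v _ = fun=> v 0 i); first exact: Ck_cst.
by apply/funext => x; case: (dE x v).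
Unshelve. all: by end_near.
Qed.

Section smooth.
Context {R : realType} {n : nat}.
Implicit Types (u f : 'rV[R]_n -> R) (U : set 'rV[R]_n).

Lemma smooth_on_partial U u i : smooth_on U u -> smooth_on U (partial i u).
Proof.
by move=> us s x Ux; have := us (rcons s i) x Ux; rewrite foldr_rcons.
Qed.

(** Continuous partial derivatives give all directional ones: the coordinate directions of [v] are
    added one at a time by [is_derive_add]. *)
Lemma smooth_on_derive U f x (v : 'rV[R]_n) : open U -> smooth_on U f -> U x ->
  is_derive x v f (\sum_i v 0 i * partial i f x).
Proof.
move=> oU sf Ux; rewrite [X in is_derive _ X](row_sum_delta v).
elim: (index_enum _) => [|i r ih]; first by rewrite !big_nil; exact: is_derive0.
have dp y : U y -> is_derive y (v 0 i *: delta_mx 0 i) f (v 0 i * partial i f y).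
  by move=> Uy; apply: derive_scale; have [_] := sf [::] y Uy; exact.
rewrite !big_cons addrC [X in is_derive _ _ _ X]addrC.
move: (\sum_(j <- r) _) (\sum_(j <- r) _) ih => dw w ih.
pose e : 'rV[R]_n := v 0 i *: delta_mx 0 i.
suff D : is_derive x (w + e) f ('D_w f x + 'D_e f x).
  split; first by case: D.
  have [_ ->] := D; congr (_ + _); first by case: ih.
  by case: (dp x Ux).
apply: is_derive_add; first by case: ih.
  have : nbhs x U by rewrite nbhsE; exists U.
  by apply: filterS => y /dp[].
apply: (@Ck_continuous _ _ 0 U) => //.
apply: (@Ck_ext _ _ _ _ (fun y => v 0 i * partial i f y)) => //.
  by move=> y /dp[].
apply: Ck_scale => //; apply: Ck0 => y Uy.
by have [] := sf [:: i] y Uy.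
Qed.

Lemma smooth_on_Ck U k u : open U -> smooth_on U u -> Ck k U u.
Proof.
move=> oU; elim: k u => [|k ih] u su.
  by apply: Ck0 => x Ux; have [] := su [::] x Ux.
apply: (@Ck_is_derive R 'rV[R]_n k U u
    (fun v x => \sum_i v 0 i * partial i u x)) => //.
- by move=> x Ux; have [] := su [::] x Ux.
- by move=> x v Ux; exact: smooth_on_derive Ux.
move=> v; apply: Ck_sum => // i; apply: Ck_scale => //; apply: ih.
exact: smooth_on_partial.
Qed.

End smooth.

(** * Principal frames *)

Section spectral.
Context {R : realType}.

Definition dotr n (x y : 'rV[R]_n) : R := \sum_i x 0 i * y 0 i.

Lemma dotrE n (x y : 'rV[R]_n) : x *m y^T = (dotr x y)%:M.
Proof.
apply/matrixP => i j; rewrite !ord1 !mxE eqxx mulr1n.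
by apply: eq_bigr => l _; rewrite !mxE.
Qed.

Lemma dotrr_gt0 n (x : 'rV[R]_n) : x != 0 -> 0 < dotr x x.
Proof.
move=> x0; have [i xi] : exists i, x 0 i != 0.
  apply/existsP; apply: contra_neqT x0 => /existsPn h.
  by apply/rowP => i; rewrite mxE; apply/eqP; move: (h i); rewrite negbK.
rewrite /dotr (bigD1 i)//= ltr_pwDl//.
  by rewrite -expr2 exprn_even_gt0//= xi orbT.
by apply: sumr_ge0 => j _; rewrite -expr2 sqr_ge0.
Qed.

Lemma sym_unit_eigenvector n (S : 'M[R]_n.+1) : S^T = S ->
  exists l (x : 'rV[R]_n.+1), dotr x x = 1 /\ x *m S = l *: x.
Proof.
move=> St; have [|k] := @pencil_eigenvalues R n.+1 0 1%:M S _ St.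
  by rewrite mulmx0 addr0.
rewrite invmx1 mul1mx => kE.
have : root (char_poly S) (k 0 ord0).
  rewrite kE; apply/rootP; rewrite horner_prod; apply/eqP.
  by apply/prodf_eq0; exists ord0 => //; rewrite !hornerE subrr.
rewrite -eigenvalue_root_char => /eigenvalueP[x xS x0].
have d0 := dotrr_gt0 x0; have s0 : 0 < Num.sqrt (dotr x x) by rewrite sqrtr_gt0.
exists (k 0 ord0), ((Num.sqrt (dotr x x))^-1 *: x); split; last first.
  by rewrite -scalemxAl xS !scalerA mulrC.
have -> : forall c : R, dotr (c *: x) (c *: x) = c ^+ 2 * dotr x x.
  move=> c; rewrite /dotr mulr_sumr; apply: eq_bigr => i _.
  by rewrite !mxE expr2 mulrACA.
by rewrite exprVn sqr_sqrtr ?ltW// mulVf// gt_eqF.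
Qed.

Lemma mul_id_add_scaled n (P : 'M[R]_n) (a b d : R) : P *m P = d *: P ->
  (1%:M + a *: P) *m (1%:M + b *: P) = 1%:M + (a + b + a * b * d) *: P.
Proof.
move=> PP; rewrite mulmxDl mul1mx mulmxDr mulmx1 -scalemxAl -scalemxAr PP !scalerA.
by rewrite -!addrA; congr (_ + _); rewrite addrCA !scalerDl.
Qed.

Lemma add_scaled_eq0 n (P Q : 'M[R]_n) (a : R) : a = 0 -> P + a *: Q = P.
Proof. by move=> ->; rewrite scale0r addr0. Qed.

Lemma rank_one_mul n (w : 'rV[R]_n) :
  (w^T *m w) *m (w^T *m w) = dotr w w *: (w^T *m w).
Proof.
by rewrite mulmxA -[w^T *m w *m w^T]mulmxA dotrE mul_mx_scalar -scalemxAl.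
Qed.

(* The reflection exchanging [x] and the first basis vector. *)
Lemma orthogonal_first_row n (x : 'rV[R]_n.+1) : dotr x x = 1 ->
  exists O : 'M[R]_n.+1,
    [/\ O^T = O, O *m O = 1%:M & delta_mx 0 0 *m O = x].
Proof.
move=> x1; pose e : 'rV[R]_n.+1 := delta_mx 0 0.
have [->|xe] := eqVneq x e; first by exists 1%:M; rewrite trmx1 !mulmx1.
pose w := x - e; have w0 : w != 0 by rewrite subr_eq0.
have d0 := dotrr_gt0 w0; have dn0 : dotr w w != 0 by rewrite gt_eqF.
have ey (y : 'rV[R]_n.+1) : dotr e y = y 0 0.
  rewrite /dotr (bigD1 0)//= !mxE !eqxx mul1r big1 ?addr0// => i i0.
  by rewrite !mxE (negPf i0) mul0r.
have wx : dotr w w = 2 - 2 * x 0 0.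
  have -> : dotr w w = dotr x x - 2 * dotr e x + dotr e e.
    rewrite /dotr mulr_sumr -sumrB -big_split; apply: eq_bigr => i _ /=.
    by rewrite !mxE; ring.
  by rewrite x1 !ey !mxE !eqxx /=; ring.
pose O := 1%:M + (- 2 / dotr w w) *: (w^T *m w).
exists O; split.
- by rewrite /O linearD /= trmx1 linearZ /= trmx_mul trmxK.
- rewrite (mul_id_add_scaled _ _ (rank_one_mul w)).
  by apply: add_scaled_eq0; field.
- have -> : e *m O = e + (- 2 / dotr w w * dotr e w) *: w.
    by rewrite /O mulmxDr mulmx1 -scalemxAr mulmxA dotrE mul_scalar_mx scalerA.
  rewrite ey (_ : - 2 / dotr w w * w 0 0 = 1); first by rewrite scale1r addrC subrK.
  rewrite mulrAC (_ : - 2 * w 0 0 = dotr w w) ?mulfV// wx !mxE !eqxx /=; ring.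
Qed.

(** Deflation: a reflection moves a unit eigenvector to the first basis vector, after which symmetry
    splits off a 1 by 1 block and the induction applies to the remaining one. *)
Lemma sym_diagonalize n (S : 'M[R]_n) : S^T = S ->
  exists (Q : 'M[R]_n) (d : 'rV[R]_n),
    Q *m Q^T = 1%:M /\ Q *m S *m Q^T = diag_mx d.
Proof.
elim: n S => [|n ih] S St.
  by exists 1%:M, 0; split; apply/matrixP => -[].
have [l [x [x1 xS]]] := sym_unit_eigenvector St.
have [ O [Ot OO Ox]] := orthogonal_first_row x1.
pose S' : 'M[R]_(1 + n) := O *m S *m O.
have S't : S'^T = S' by rewrite /S' !trmx_mul Ot St mulmxA.
have row0 : row 0 S' = l *: delta_mx 0 0.
  rewrite rowE /S' !mulmxA Ox xS -scalemxAl -Ox -mulmxA OO mulmx1.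
  by [].
have S'E j : S' 0 j = l * (j == 0)%:R.
  transitivity (row 0 S' 0 j); first by rewrite [RHS]mxE.
  by rewrite row0 !mxE eqxx.
have ul : ulsubmx S' = l%:M.
  apply/matrixP => i j; rewrite !ord1 [LHS]mxE [LHS]mxE.
  rewrite (_ : lshift n 0 = 0 :> 'I_(1 + n)); last exact/val_inj.
  by rewrite S'E !mxE eqxx mulr1.
have ur : ursubmx S' = 0.
  apply/matrixP => i j; rewrite !ord1 [LHS]mxE [LHS]mxE.
  rewrite (_ : lshift n 0 = 0 :> 'I_(1 + n)); last exact/val_inj.
  by rewrite S'E !mxE mulr0.
have dl : dlsubmx S' = 0 by rewrite -[S']trmxK -trmx_ursub S't ur trmx0.
have drt : (drsubmx S')^T = drsubmx S' by rewrite trmx_drsub S't.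
have [Q' [d' [QQ QS]]] := ih _ drt.
pose B : 'M[R]_(1 + n) := block_mx 1%:M 0 0 Q'.
have Bt : B^T = block_mx 1%:M 0 0 Q'^T by rewrite /B tr_block_mx trmx1 !trmx0.
have BB : B *m B^T = 1%:M.
  rewrite Bt /B mulmx_block.
  by rewrite !mulmx0 !mul0mx !addr0 !add0r mulmx1 QQ -scalar_mx_block.
have BS : B *m S' *m B^T = diag_mx (row_mx l%:M d').
  rewrite -[S']submxK ul ur dl Bt /B !mulmx_block.
  rewrite !(mulmx0, mul0mx, addr0, add0r, mul1mx, mulmx1) QS diag_mx_row.
  by congr block_mx; apply/matrixP => i j; rewrite !ord1 !mxE.
exists (B *m O), (row_mx l%:M d'); split.
  rewrite trmx_mul Ot mulmxA -[B *m O *m O]mulmxA OO mulmx1; exact: BB.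
rewrite trmx_mul Ot.
have -> : B *m O *m S *m (O *m B^T) = B *m S' *m B^T by rewrite /S' !mulmxA.
exact: BS.
Qed.

(** The spectral theorem for g^(-1/2) h g^(-1/2), with g = 1 + p^T p. The rows of [V] are then
    principal directions, orthonormal for g. *)
Lemma frame_exists n (p : 'rV[R]_n) (h : 'M[R]_n) : h^T = h ->
  exists (V : 'M[R]_n) (d : 'rV[R]_n),
    V *m (1%:M + p^T *m p) *m V^T = 1%:M /\ V *m h *m V^T = diag_mx d.
Proof.
move=> ht; pose W := Num.sqrt (1 + dotr p p).
have pp0 : 0 <= dotr p p by apply: sumr_ge0 => i _; rewrite -expr2 sqr_ge0.
have W2 : W ^+ 2 = 1 + dotr p p by rewrite sqr_sqrtr// addr_ge0.
have W0 : 0 < W by rewrite sqrtr_gt0 ltr_pwDl.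
(* For this [c], [1 + c p^T p] is the inverse square root of [1 + p^T p]. *)
pose c := - (W * (W + 1))^-1.
pose P := p^T *m p; pose C := 1%:M + c *: P.
have PP : P *m P = dotr p p *: P := rank_one_mul p.
have Ct : C^T = C by rewrite /C linearD /= trmx1 linearZ /= /P trmx_mul trmxK.
have CC : C *m (1%:M + P) *m C = 1%:M.
  rewrite -{1}[P]scale1r /C !(mul_id_add_scaled _ _ PP).
  apply: add_scaled_eq0.
  have -> : dotr p p = W ^+ 2 - 1 by rewrite W2; ring.
  by rewrite /c; field; rewrite ?mulf_neq0 ?gt_eqF//; last by rewrite addr_gt0.
have hCt : (C *m h *m C)^T = C *m h *m C by rewrite !trmx_mul Ct ht mulmxA.
have [Q [d [QQ QD]]] := sym_diagonalize hCt.
exists (Q *m C), d; rewrite trmx_mul Ct; split.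
  by rewrite -!mulmxA [C *m (_ *m (C *m _))]mulmxA [C *m _ *m (_ *m _)]mulmxA CC mul1mx.
by rewrite -QD !mulmxA.
Qed.

End spectral.

(** * Structure equations *)

Section derivation_rules.
Context {R : realType} {V : normedModType R}.
Implicit Types (f g : V -> R) (x v : V).

Lemma isD_add f g x v (df dg : R) : is_derive x v f df -> is_derive x v g dg ->
  is_derive x v (fun y => f y + g y) (df + dg).
Proof. exact: is_deriveD. Qed.

Lemma isD_sub f g x v (df dg : R) : is_derive x v f df -> is_derive x v g dg ->
  is_derive x v (fun y => f y - g y) (df - dg).
Proof. exact: is_deriveB. Qed.

Lemma isD_mul f g x v (df dg : R) : is_derive x v f df -> is_derive x v g dg ->
  is_derive x v (fun y => f y * g y) (df * g x + f x * dg).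
Proof.
move=> hf hg; apply: is_derive_eq (is_deriveM hf hg) _.
by rewrite addrC [df * _]mulrC.
Qed.

Lemma isD_scale (c : R) f x v (df : R) : is_derive x v f df ->
  is_derive x v (fun y => c * f y) (c * df).
Proof.
move=> hf; have := isD_mul (is_derive_cst c x v) hf.
by rewrite mul0r add0r.
Qed.

Lemma isD_sum (I : Type) (r : seq I) (F : I -> V -> R) (dF : I -> R) x v :
  (forall i, is_derive x v (F i) (dF i)) ->
  is_derive x v (fun y => \sum_(i <- r) F i y) (\sum_(i <- r) dF i).
Proof.
move=> h; elim: r => [|i r ih].
  rewrite big_nil (_ : (fun _ => _) = cst 0); first exact: is_derive_cst.
  by apply/funext => y; rewrite big_nil.
rewrite big_cons.
rewrite (_ : (fun _ => _) = (fun y => F i y + \sum_(j <- r) F j y)).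
  exact: isD_add.
by apply/funext => y; rewrite big_cons.
Qed.

Lemma Ck_isD k U f x v : Ck k.+1 U f -> U x -> is_derive x v f ('D_v f x).
Proof. by move=> Cf Ux; apply: derivableP; exact: Ck_derivable Cf Ux. Qed.

Lemma derive_on U (F G : V -> R) x v (d : R) : open U -> U x ->
  (forall y, U y -> F y = G y) -> is_derive x v G d -> 'D_v F x = d.
Proof.
move=> oU Ux E [_ <-]; apply: near_eq_derive.
suff : nbhs x U by apply: filterS.
by rewrite nbhsE; exists U.
Qed.

End derivation_rules.

Section frame_algebra.
Context {R : realFieldType}.
Variable k : 'I_4 -> R.
Variable A : 'I_4 -> 'I_4 -> R.
Hypothesis AE : forall a b, A a b = k a * (a == b)%:R.
Let T := \sum_a A a a.
Let H := \sum_a k a.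

Let TH : T = H.
Proof. by apply: eq_bigr => a _; rewrite AE eqxx mulr1. Qed.

Let sumA (X : 'I_4 -> 'I_4 -> R) : \sum_a \sum_b X a b * A b a = \sum_a X a a * k a.
Proof.
apply: eq_bigr => a _; rewrite (bigD1 a)//= AE eqxx mulr1 big1 ?addr0// => b ba.
by rewrite AE (negPf ba) !mulr0.
Qed.

Let sumA' (X : 'I_4 -> 'I_4 -> R) : \sum_a \sum_b A a b * X b a = \sum_a X a a * k a.
Proof.
rewrite exchange_big -sumA; apply: eq_bigr => a _; apply: eq_bigr => b _ /=.
by rewrite mulrC.
Qed.

Lemma diag_sum_fk (X : 'I_4 -> 'I_4 -> R) :
  \sum_c (H - k c) * X c c = (\sum_c X c c) * H - \sum_c X c c * k c.
Proof.
rewrite mulr_suml -sumrB; apply: eq_bigr => c _.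
by rewrite mulrBl mulrC [k c * _]mulrC.
Qed.

(** At a diagonal [A], the differential of (tr A)^2 - tr (A^2) sees only the diagonal of [X], with
    weights [2 * (H - k c)]. *)
Lemma diag_dQ (X : 'I_4 -> 'I_4 -> R) :
  (\sum_a X a a) * T + T * (\sum_a X a a) -
    \sum_a \sum_b (X a b * A b a + A a b * X b a) = 0 ->
  \sum_c (H - k c) * X c c = 0.
Proof.
rewrite TH diag_sum_fk.
have -> : \sum_a \sum_b (X a b * A b a + A a b * X b a) =
    \sum_a \sum_b X a b * A b a + \sum_a \sum_b A a b * X b a.
  by rewrite -big_split; apply: eq_bigr => a _; rewrite -big_split.
by rewrite sumA sumA'; set S1 := \sum_a _; set S2 := \sum_a _; lra.
Qed.

Lemma diag_ddQ (X Y : 'I_4 -> 'I_4 -> R) :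
  ((\sum_a Y a a) * T + (\sum_a X a a) * (\sum_a X a a)) +
  ((\sum_a X a a) * (\sum_a X a a) + T * (\sum_a Y a a)) -
    \sum_a \sum_b ((Y a b * A b a + X a b * X b a) +
                   (X a b * X b a + A a b * Y b a)) = 0 ->
  \sum_c (H - k c) * Y c c + (\sum_a X a a) ^+ 2 - \sum_a \sum_b X b a * X a b = 0.
Proof.
rewrite TH diag_sum_fk.
have -> : \sum_a \sum_b ((Y a b * A b a + X a b * X b a) +
                   (X a b * X b a + A a b * Y b a)) =
  (\sum_a \sum_b Y a b * A b a + \sum_a \sum_b A a b * Y b a) +
  2 * \sum_a \sum_b X b a * X a b.
  rewrite mulr_sumr -!big_split; apply: eq_bigr => a _ /=.
  by rewrite mulr_sumr -!big_split; apply: eq_bigr => b _ /=; ring.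
rewrite sumA sumA'.
set S1 := \sum_a _; set S2 := \sum_a _; set S3 := \sum_a _; set S4 := \sum_a _.
lra.
Qed.

End frame_algebra.

Lemma diag_sdd (R : realFieldType) (k u Ab G0 Gd Ge Gdd X Y Z : 'I_4 -> R) (W : R)
    (a c d e : 'I_4) :
  (forall b, Ab b = k b * (b == c)%:R) -> (forall b, G0 b = (a == b)%:R) ->
  (forall b, Gd b = W * (k a * (a == d)%:R * u b + u a * k b * (b == d)%:R)) ->
  (forall b, Ge b = W * (k a * (a == e)%:R * u b + u a * k b * (b == e)%:R)) ->
  \sum_b (Gdd b * Ab b + Gd b * X b + (Ge b * Y b + G0 b * Z b)) =
  Gdd c * k c +
  W * (k a * (a == d)%:R * (\sum_b u b * X b) + u a * k d * X d) +
  W * (k a * (a == e)%:R * (\sum_b u b * Y b) + u a * k e * Y e) + Z a.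
Proof.
move=> AE G0E GdE GeE.
have S (G F : 'I_4 -> R) i :
    (forall b, G b = W * (k a * (a == i)%:R * u b + u a * k b * (b == i)%:R)) ->
    \sum_b G b * F b =
    W * (k a * (a == i)%:R * (\sum_b u b * F b) + u a * k i * F i).
  move=> GE; transitivity (W * (k a * (a == i)%:R) * (\sum_b u b * F b) +
     W * u a * (\sum_b (k b * (b == i)%:R) * F b)).
    by rewrite !mulr_sumr -big_split; apply: eq_bigr => b _ /=; rewrite GE; ring.
  have -> : \sum_b k b * (b == i)%:R * F b = k i * F i.
    rewrite (bigD1 i)//= eqxx mulr1 big1 ?addr0// => b bi.
    by rewrite (negPf bi) mulr0 mul0r.
  by ring.
rewrite !big_split /= (S Gd X d GdE) (S Ge Y e GeE).
have -> : \sum_b Gdd b * Ab b = Gdd c * k c.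
  rewrite (bigD1 c)//= big1 ?addr0 => [|b bc]; last by rewrite AE (negPf bc) !mulr0.
  by rewrite AE eqxx mulr1.
have -> : \sum_b G0 b * Z b = Z a.
  rewrite (bigD1 a)//= big1 ?addr0 => [|b ba]; last first.
    by rewrite G0E eq_sym (negPf ba) mul0r.
  by rewrite G0E eqxx mul1r.
by rewrite !addrA.
Qed.

Section commute_algebra.
Context {R : realFieldType}.
Let tR : (true%:R : R) = 1. Proof. by []. Qed.
Let fR : (false%:R : R) = 0. Proof. by []. Qed.
Implicit Types ka kc ua uc Wp x t N : R.

Lemma commute_algebra_sd ka kc ua uc Wp N :
  Wp * (ka * true%:R * uc + ua * kc * false%:R) * kc + N = Wp * ka * uc * kc + N.
Proof. by rewrite tR fR; ring. Qed.

Lemma commute_algebra_codazzi ka kc ua uc Wp n1 n2 :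
  n1 - n2 = (ka - kc) * Wp * (ka * false%:R * uc + ua * kc * true%:R) ->
  n1 = n2 + (ka - kc) * Wp * (ua * kc).
Proof. by rewrite tR fR => E; lra. Qed.

(** The elimination behind [frame_commute], over plain scalars. [wac] and [wcc] stand for third
    derivatives of the graph function, [g1] and [g2] for second derivatives of the metric; the
    boolean coefficients are the Kronecker symbols left by [a != c]. *)
Lemma commute_algebra n1 n2 ka kc ua uc Wp x t Ra Rc S1 S2 y z wac wcc g1 g2 :
  wac = Wp * (Wp * ka * uc * kc + t) -> wcc = Wp * (Wp * kc * ua * ka + x) ->
  y = x + (ka - kc) * Wp * (ua * kc) -> z = t + (kc - ka) * Wp * (uc * ka) ->
  g1 = wac * uc + Wp * (ka * false%:R) * (Wp * (kc * false%:R)) +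
     (Wp * (ka * true%:R) * (Wp * (kc * true%:R)) + ua * wcc) ->
  g2 = wcc * ua + Wp * (kc * true%:R) * (Wp * (ka * true%:R)) +
     (Wp * (kc * false%:R) * (Wp * (ka * false%:R)) + uc * wac) ->
  g1 * kc + Wp * (ka * false%:R * S1 + ua * kc * x) +
    Wp * (ka * true%:R * Rc + ua * ka * y) + n1 =
  g2 * ka + Wp * (kc * true%:R * Ra + uc * kc * z) +
    Wp * (kc * false%:R * S2 + uc * ka * t) + n2 ->
  n1 - n2 = Wp * (kc * Ra - ka * Rc) + Wp ^+ 2 * ka * kc * (ka - kc) +
      2 * Wp * (uc * ka * t - ua * kc * x).
Proof.
move=> -> -> -> -> -> ->; rewrite tR fR => E.
by apply/eqP; rewrite -subr_eq0; apply/eqP; move: E; lra.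
Qed.

End commute_algebra.

(* Structure equations of the graph of [w] in a constant basis [v], with [n] the
   components of the Gauss map and [W] the area factor: [hessE] is [h = g DN] and
   [eqE] the curvature equation.  Their first derivatives at [p] give the Codazzi
   equations and [frame_dF], the second ones [frame_commute] and [frame_ddF]. *)
Section frame.
Context {R : realType} {V : normedModType R}.
Variables (U : set V) (n : 'I_4 -> V -> R) (w W : V -> R) (v : 'I_4 -> V).
Variables (gam : 'I_4 -> 'I_4 -> R) (f0 : R) (p : V) (k : 'I_4 -> R).
Let g a b x := gam a b + 'D_(v a) w x * 'D_(v b) w x.
Let N2 b c d := 'D_(v d) ('D_(v c) (n b)) p.
Let N3 b c d e := 'D_(v e) ('D_(v d) ('D_(v c) (n b))) p.
Let u a := 'D_(v a) w p.
Let H := \sum_a k a.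
Hypothesis oU : open U.
Hypothesis Up : U p.
Hypothesis Cn : forall a, Ck 4 U (n a).
Hypothesis Cw : Ck 4 U w.
Hypothesis CW : Ck 1 U W.
Hypothesis W0 : forall x, U x -> W x != 0.
Hypothesis hessE : forall x, U x -> forall a c,
  'D_(v c) ('D_(v a) w) x = W x * \sum_b g a b x * 'D_(v c) (n b) x.
Hypothesis eqE : forall x, U x ->
  (\sum_a 'D_(v a) (n a) x) ^+ 2 - \sum_a \sum_b 'D_(v a) (n b) x * 'D_(v b) (n a) x = 2 * f0.
Hypothesis gp : forall a b, g a b p = (a == b)%:R.
Hypothesis dnp : forall b c, 'D_(v c) (n b) p = k b * (b == c)%:R.

Lemma frame_N2C b c d : N2 b c d = N2 b d c.
Proof. by apply: (Ck_swap _ _ oU _ Up); apply: Ck_le (Cn b). Qed.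

Lemma frame_N3C1 b c d e : N3 b c d e = N3 b d c e.
Proof.
apply: (derive_on oU Up (G := 'D_(v c) ('D_(v d) (n b)))).
  by move=> y Uy; apply: (Ck_swap _ _ oU _ Uy); apply: Ck_le (Cn b).
by apply: Ck_isD Up; apply: (@Ck_le _ _ 1 2) => //; do 2!apply: Ck_D; exact: Cn.
Qed.

Lemma frame_N3C2 b c d e : N3 b c d e = N3 b c e d.
Proof.
exact: (@Ck_swap R V U ('D_(v c) (n b)) p (v d) (v e) oU (CkW (Ck_D (v c) (Cn b))) Up).
Qed.

Let dn b c : Ck 3 U ('D_(v c) (n b)). Proof. exact: Ck_D (Cn b). Qed.
Let ddn b c d : Ck 2 U ('D_(v d) ('D_(v c) (n b))). Proof. exact: Ck_D (dn b c). Qed.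
Let dw a : Ck 3 U ('D_(v a) w). Proof. exact: Ck_D Cw. Qed.
Let ddw a b : Ck 2 U ('D_(v b) ('D_(v a) w)). Proof. exact: Ck_D (dw a). Qed.

Lemma frame_hess a c : 'D_(v c) ('D_(v a) w) p = W p * (k a * (a == c)%:R).
Proof.
rewrite (hessE Up); congr (_ * _); rewrite (bigD1 a)//= gp eqxx mul1r dnp.
by rewrite big1 ?addr0// => b ba; rewrite gp eq_sym (negPf ba) mul0r.
Qed.

Let gd a b d x := 'D_(v d) ('D_(v a) w) x * 'D_(v b) w x +
  'D_(v a) w x * 'D_(v d) ('D_(v b) w) x.

Lemma frame_gd a b d x : U x -> is_derive x (v d) (g a b) (gd a b d x).
Proof.
move=> Ux; rewrite -[gd _ _ _ _]add0r; apply: (@isD_add _ _ (fun=> gam a b)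
  (fun y => 'D_(v a) w y * 'D_(v b) w y)).
by apply: isD_mul; [exact: Ck_isD (dw a) Ux|exact: Ck_isD (dw b) Ux].
Qed.

Lemma frame_gdp a b d : gd a b d p =
  W p * (k a * (a == d)%:R * u b + u a * k b * (b == d)%:R).
Proof. by rewrite /gd !frame_hess /u; ring. Qed.

(** The Hessian divided by [W], hence the second fundamental form. Differentiating its symmetry, and
    not that of the Hessian, keeps the derivatives of [W] out of the structure equations. *)
Let s a c x := \sum_b g a b x * 'D_(v c) (n b) x.

Lemma frame_s_sym a c x : U x -> s a c x = s c a x.
Proof.
move=> Ux; apply: (mulfI (W0 Ux)); rewrite -!(hessE Ux).
by apply: (Ck_swap _ _ oU _ Ux); apply: Ck_le Cw.
Qed.

Let sd a c d x := \sum_b (gd a b d x * 'D_(v c) (n b) x +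
  g a b x * 'D_(v d) ('D_(v c) (n b)) x).

Lemma frame_sd a c d x : U x -> is_derive x (v d) (s a c) (sd a c d x).
Proof.
move=> Ux; apply: isD_sum => b; apply: isD_mul; first exact: frame_gd.
exact: Ck_isD (dn b c) Ux.
Qed.

Lemma frame_sd_sym a c d x : U x -> sd a c d x = sd c a d x.
Proof.
move=> Ux; have [_ <-] := frame_sd a c d Ux.
by apply: (derive_on oU Ux _ (frame_sd c a d Ux)) => y; exact: frame_s_sym.
Qed.

Lemma frame_sdp a c d : sd a c d p = gd a c d p * k c + N2 a c d.
Proof.
rewrite /sd big_split /= (bigD1 c)//= big1 ?addr0 => [|b bc]; last first.
  by rewrite dnp (negPf bc) !mulr0.
rewrite dnp eqxx mulr1 (bigD1 a)//= big1 ?addr0 => [|b ba]; last first.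
  by rewrite gp eq_sym (negPf ba) mul0r.
by rewrite gp eqxx mul1r.
Qed.

Lemma frame_codazzi a c d : N2 a c d - N2 c a d =
  (k a - k c) * W p * (k a * (a == d)%:R * u c + u a * k c * (c == d)%:R).
Proof.
have := frame_sd_sym a c d Up; rewrite !frame_sdp !frame_gdp => E.
move: E; move: (N2 a c d) (N2 c a d) (W p) (u a) (u c) => n1 n2 Wp ua uc E.
by lra.
Qed.

Let T x := \sum_a 'D_(v a) (n a) x.
Let dT d x := \sum_a 'D_(v d) ('D_(v a) (n a)) x.
Let ddT d x := \sum_a 'D_(v d) ('D_(v d) ('D_(v a) (n a))) x.

Lemma frame_dT d x : U x -> is_derive x (v d) T (dT d x).
Proof. by move=> Ux; apply: isD_sum => a; exact: Ck_isD (dn a a) Ux. Qed.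

Lemma frame_ddT d x : U x -> is_derive x (v d) (dT d) (ddT d x).
Proof. by move=> Ux; apply: isD_sum => a; exact: Ck_isD (ddn a a d) Ux. Qed.

Let Q x := T x * T x - \sum_a \sum_b 'D_(v a) (n b) x * 'D_(v b) (n a) x.
Let dQ d x := dT d x * T x + T x * dT d x - \sum_a \sum_b
  ('D_(v d) ('D_(v a) (n b)) x * 'D_(v b) (n a) x +
   'D_(v a) (n b) x * 'D_(v d) ('D_(v b) (n a)) x).
Let ddQ d x := (ddT d x * T x + dT d x * dT d x) +
  (dT d x * dT d x + T x * ddT d x) - \sum_a \sum_b
  (('D_(v d) ('D_(v d) ('D_(v a) (n b))) x * 'D_(v b) (n a) x +
   'D_(v d) ('D_(v a) (n b)) x * 'D_(v d) ('D_(v b) (n a)) x) +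
   ('D_(v d) ('D_(v a) (n b)) x * 'D_(v d) ('D_(v b) (n a)) x +
   'D_(v a) (n b) x * 'D_(v d) ('D_(v d) ('D_(v b) (n a))) x)).

Lemma frame_dQ d x : U x -> is_derive x (v d) Q (dQ d x).
Proof.
move=> Ux; apply: isD_sub; first by apply: isD_mul; exact: frame_dT.
apply: isD_sum => a; apply: isD_sum => b.
by apply: isD_mul; [exact: Ck_isD (dn b a) Ux|exact: Ck_isD (dn a b) Ux].
Qed.

Lemma frame_ddQ d x : U x -> is_derive x (v d) (dQ d) (ddQ d x).
Proof.
move=> Ux; apply: isD_sub.
  by apply: isD_add; apply: isD_mul; first [exact: frame_dT|exact: frame_ddT].
apply: isD_sum => a; apply: isD_sum => b; apply: isD_add; apply: isD_mul.
- exact: Ck_isD (ddn b a d) Ux.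
- exact: Ck_isD (dn a b) Ux.
- exact: Ck_isD (dn b a) Ux.
- exact: Ck_isD (ddn a b d) Ux.
Qed.

Lemma frame_dQ0 d x : U x -> dQ d x = 0.
Proof.
move=> Ux; have [_ <-] := frame_dQ d Ux.
apply: (derive_on oU Ux _ (is_derive_cst (2 * f0) x (v d))).
by move=> y Uy; rewrite /Q -expr2 eqE.
Qed.

Lemma frame_ddQ0 d : ddQ d p = 0.
Proof.
have [_ <-] := frame_ddQ d Up.
apply: (derive_on oU Up _ (is_derive_cst 0 p (v d))).
by move=> y Uy; exact: frame_dQ0.
Qed.

Let dnp' a b : 'D_(v a) (n b) p = k a * (a == b)%:R.
Proof.
move: (dnp b a) => ->; rewrite [b == a]eq_sym.
by have [->|_] := eqVneq a b; [|rewrite !mulr0].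
Qed.

Lemma frame_dF d : \sum_c (H - k c) * N2 c c d = 0.
Proof.
exact: (@diag_dQ R k (fun a b => 'D_(v a) (n b) p) dnp' (fun a b => N2 b a d)
  (frame_dQ0 d Up)).
Qed.

Lemma frame_ddF d : \sum_c (H - k c) * N3 c c d d + (\sum_a N2 a a d) ^+ 2 -
  \sum_a \sum_b N2 a b d * N2 b a d = 0.
Proof.
exact: (@diag_ddQ R k (fun a b => 'D_(v a) (n b) p) dnp' (fun a b => N2 b a d)
  (fun a b => N3 b a d d) (frame_ddQ0 d)).
Qed.

Let gdd a b d e x := 'D_(v e) ('D_(v d) ('D_(v a) w)) x * 'D_(v b) w x +
  'D_(v d) ('D_(v a) w) x * 'D_(v e) ('D_(v b) w) x +
  ('D_(v e) ('D_(v a) w) x * 'D_(v d) ('D_(v b) w) x +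
  'D_(v a) w x * 'D_(v e) ('D_(v d) ('D_(v b) w)) x).

Lemma frame_gdd a b d e x : U x -> is_derive x (v e) (gd a b d) (gdd a b d e x).
Proof.
move=> Ux; apply: isD_add; apply: isD_mul.
- exact: Ck_isD (ddw a d) Ux.
- exact: Ck_isD (dw b) Ux.
- exact: Ck_isD (dw a) Ux.
- exact: Ck_isD (ddw b d) Ux.
Qed.

Let sdd a c d e x := \sum_b
  (gdd a b d e x * 'D_(v c) (n b) x +
   gd a b d x * 'D_(v e) ('D_(v c) (n b)) x +
   (gd a b e x * 'D_(v d) ('D_(v c) (n b)) x +
    g a b x * 'D_(v e) ('D_(v d) ('D_(v c) (n b))) x)).

Lemma frame_sdd a c d e x : U x -> is_derive x (v e) (sd a c d) (sdd a c d e x).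
Proof.
move=> Ux; apply: isD_sum => b; apply: isD_add; apply: isD_mul.
- exact: frame_gdd.
- exact: Ck_isD (dn b c) Ux.
- exact: frame_gd.
- exact: Ck_isD (ddn b c d) Ux.
Qed.

Lemma frame_sdd_sym a c d e : sdd a c d e p = sdd c a d e p.
Proof.
have [_ <-] := frame_sdd a c d e Up.
by apply: (derive_on oU Up _ (frame_sdd c a d e Up)) => y; exact: frame_sd_sym.
Qed.

Lemma frame_sddp a c d e : sdd a c d e p = gdd a c d e p * k c +
  W p * (k a * (a == d)%:R * (\sum_b u b * N2 b c e) + u a * k d * N2 d c e) +
  W p * (k a * (a == e)%:R * (\sum_b u b * N2 b c d) + u a * k e * N2 e c d) +
  N3 a c d e.
Proof.
exact: (@diag_sdd R k u (fun b => 'D_(v c) (n b) p) (fun b => g a b p)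
  (fun b => gd a b d p) (fun b => gd a b e p) (fun b => gdd a b d e p)
  (fun b => N2 b c e) (fun b => N2 b c d) (fun b => N3 b c d e) (W p) a c d e
  (dnp ^~ c) (gp a) (frame_gdp a ^~ d) (frame_gdp a ^~ e)).
Qed.

(** The derivative of [W] is multiplied by the off-diagonal entry [s a c p], which vanishes in a
    principal frame. *)
Lemma frame_third_w a c e : a != c -> 'D_(v e) ('D_(v c) ('D_(v a) w)) p =
  W p * sd a c e p.
Proof.
move=> ac.
have D : is_derive p (v e) (fun x => W x * s a c x)
    ('D_(v e) W p * s a c p + W p * sd a c e p).
  by apply: isD_mul; [exact: Ck_isD CW Up|exact: frame_sd].
have sp : s a c p = 0.
  apply: (mulfI (W0 Up)); rewrite -(hessE Up) frame_hess (negPf ac).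
  by rewrite !mulr0.
rewrite sp mulr0 add0r in D.
apply: (derive_on oU Up _ D) => y Uy; exact: hessE.
Qed.

Let Rc c := \sum_b u b * N2 b c c.

Let sd_diag a c : a != c -> sd a c a p = W p * k a * u c * k c + N2 a a c.
Proof.
rewrite eq_sym => ca; rewrite frame_sdp frame_gdp frame_N2C eqxx (negPf ca).
exact: commute_algebra_sd.
Qed.

Let N2_acc a c : a != c -> N2 a c c = N2 c c a + (k a - k c) * W p * (u a * k c).
Proof.
move=> ac; apply: (@commute_algebra_codazzi _ (k a) (k c) (u a) (u c)).
have := frame_codazzi a c c; rewrite (frame_N2C c a c) eqxx (negPf ac).
exact.
Qed.

Let w_aca a c : a != c -> 'D_(v a) ('D_(v c) ('D_(v a) w)) p =
  W p * (W p * k a * u c * k c + N2 a a c).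
Proof. by move=> ac; rewrite (frame_third_w a ac) (sd_diag ac). Qed.

Let w_cca a c : a != c -> 'D_(v a) ('D_(v c) ('D_(v c) w)) p =
  W p * (W p * k c * u a * k a + N2 c c a).
Proof.
rewrite eq_sym => ca; rewrite -(w_aca ca).
exact: (@Ck_swap R V U ('D_(v c) w) p (v c) (v a) oU (CkW (dw c)) Up).
Qed.

(** Simons identity: the twice differentiated symmetry of [s], in the directions [c] and [a],
    relates [N3 a c c a] and [N3 c a c a], and reordering derivatives gives the two sides. Second
    derivatives of the metric produce the terms cubic in the curvatures. *)
Lemma frame_commute a c : N3 a a c c - N3 c c a a =
  W p * (k c * Rc a - k a * Rc c) + W p ^+ 2 * k a * k c * (k a - k c) +
  2 * W p * (u c * k a * N2 a a c - u a * k c * N2 c c a).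
Proof.
have [->|ac] := eqVneq a c.
  by move: (N3 c c c c) (Rc c) (N2 c c c) => x y z; ring.
have ca : c != a by rewrite eq_sym.
have n3a := etrans (frame_N3C1 a a c c) (frame_N3C2 a c a c).
have n3c := frame_N3C1 c c a a.
apply: etrans (congr2 (fun x y : R => x - y) n3a n3c) _.
have := etrans (etrans (esym (frame_sddp a c c a)) (frame_sdd_sym a c c a))
  (frame_sddp c a c a).
rewrite !eqxx (negPf ac) (negPf ca).
apply: (commute_algebra (w_aca ac) (w_cca ac) (N2_acc ac) (N2_acc ca)).
  have := (frame_hess a c, frame_hess c a, frame_hess a a, frame_hess c c).
  rewrite !eqxx (negPf ac) (negPf ca) => -[[[hac hca] haa] hcc].
  exact: (congr2 +%R (congr2 +%R (erefl _) (congr2 *%R hac hca))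
    (congr2 +%R (congr2 *%R haa hcc) (erefl _))).
have := (frame_hess a c, frame_hess c a, frame_hess a a, frame_hess c c).
rewrite !eqxx (negPf ac) (negPf ca) => -[[[hac hca] haa] hcc].
exact: (congr2 +%R (congr2 +%R (erefl _) (congr2 *%R hcc haa))
  (congr2 +%R (congr2 *%R hca hac) (erefl _))).
Qed.

End frame.

(** * Curvatures of a graph *)

Lemma char_poly_conj (R : comNzRingType) n (A P Q : 'M[R]_n) : P *m Q = 1%:M ->
  char_poly (P *m A *m Q) = char_poly A.
Proof.
move=> PQ; rewrite /char_poly.
have PQ' : map_mx polyC P *m map_mx polyC Q = 1%:M by rewrite -map_mxM PQ map_mx1.
have -> : char_poly_mx (P *m A *m Q) =
    map_mx polyC P *m char_poly_mx A *m map_mx polyC Q.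
  rewrite /char_poly_mx mulmxBr mulmxBl scalar_mxC -[_%:M *m _ *m _]mulmxA PQ' mulmx1.
  by rewrite !map_mxM.
by rewrite !det_mulmx mulrAC -det_mulmx PQ' det1 mul1r.
Qed.

Lemma char_poly_diag (R : comNzRingType) n (d : 'rV[R]_n) :
  char_poly (diag_mx d) = \prod_(i < n) ('X - (d 0 i)%:P).
Proof.
rewrite char_poly_trig ?diag_mx_is_trig//.
by apply: eq_bigr => i _; rewrite mxE eqxx mulr1n.
Qed.

(** The characteristic polynomial determines its roots as a multiset, so symmetric sums do not
    depend on the ordering chosen in [principal_curvatures]. *)
Lemma sum_of_prod_XsubC (R : realType) n (k d : 'rV[R]_n) (F : R -> R) :
  \prod_(i < n) ('X - (k 0 i)%:P) = \prod_(i < n) ('X - (d 0 i)%:P) ->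
  \sum_i F (k 0 i) = \sum_i F (d 0 i).
Proof.
move=> E; pose r (y : 'rV[R]_n) := [seq y 0 i | i <- index_enum 'I_n].
have kd : perm_eq (r k) (r d) by apply: prod_XsubC_eq; rewrite !big_map.
have := perm_big (op := +%R) (x := 0) (P := xpredT) (F := F) _ kd.
by rewrite !big_map.
Qed.

Lemma sigma2_sqr (R : realType) n (k : 'rV[R]_n) :
  2 * sigma2 k = sigma1 k ^+ 2 - \sum_i k 0 i ^+ 2.
Proof.
rewrite /sigma1 /sigma2 expr2 mulr_suml.
have -> : \sum_i k 0 i * (\sum_j k 0 j) = \sum_i \sum_j k 0 i * k 0 j.
  by apply: eq_bigr => i _; rewrite mulr_sumr.
have -> : \sum_i \sum_j k 0 i * k 0 j = \sum_i k 0 i ^+ 2 +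
   (\sum_(i < n) \sum_(j < n | (i < j)%N) k 0 i * k 0 j +
    \sum_(i < n) \sum_(j < n | (j < i)%N) k 0 i * k 0 j).
  rewrite -!big_split; apply: eq_bigr => i _ /=.
  rewrite (bigD1 i)//= -expr2; congr (_ + _).
  rewrite (bigID (fun j : 'I_n => (i < j)%N))/=; congr (_ + _); apply: eq_bigl => j.
    by rewrite -val_eqE /=; case: ltngtP.
  by rewrite -val_eqE /=; case: ltngtP.
have -> : \sum_(i < n) \sum_(j < n | (j < i)%N) k 0 i * k 0 j =
    \sum_(i < n) \sum_(j < n | (i < j)%N) k 0 i * k 0 j.
  rewrite (exchange_big_dep xpredT)//=; apply: eq_bigr => i _.
  by apply: eq_bigr => j _; rewrite mulrC.
ring.
Qed.

Section curvature_traces.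
Context {R : realType} {n : nat}.
Implicit Types (u : 'rV[R]_n -> R) (x : 'rV[R]_n).

Lemma first_formE u x : first_form u x = 1%:M + (grad u x)^T *m grad u x.
Proof. by apply/matrixP => i j; rewrite !mxE big_ord1 !mxE. Qed.

(** [A] is conjugate to the diagonal matrix of the curvatures. Traces, unlike individual
    eigenvalues, are visibly smooth in [x], and the equation can be differentiated in this form. *)
Lemma curvature_traces u x (A : 'M[R]_n) : (hess u x)^T = hess u x ->
  first_form u x *m A = second_form u x ->
  mean_curvature u x = \tr A /\
  2 * sigma2 (principal_curvatures u x) = (\tr A) ^+ 2 - \tr (A *m A).
Proof.
move=> hs gA.
have ht : (second_form u x)^T = second_form u x.
  by apply/matrixP => i j; have /matrixP/(_ i j) := hs; rewrite !mxE => ->.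
have [V [d [VG Vh]]] := frame_exists (grad u x) ht.
rewrite -first_formE in VG.
have VtV : V^T *m (V *m first_form u x) = 1%:M by rewrite mulmx1C.
have Gu : first_form u x \in unitmx.
  by move: VtV; rewrite mulmxA => /mulmx1_unit[].
have AE : A = weingarten u x by rewrite /weingarten -gA mulKmx.
have AV : A = V^T *m diag_mx d *m (V *m first_form u x).
  rewrite -Vh !mulmxA -[V^T *m V *m second_form u x *m V^T *m V *m _]mulmxA.
  rewrite -[_ *m V^T *m (V *m _)]mulmxA VtV mulmx1 -gA mulmxA.
  by rewrite -[V^T *m V *m _]mulmxA VtV mul1mx.
have : char_poly A = \prod_(i < n) ('X - (d 0 i)%:P).
  by rewrite AV char_poly_conj// char_poly_diag.
rewrite AE principal_curvaturesP// -AE => pk.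
have trA : \tr A = \sum_i d 0 i.
  by rewrite AV -mulmxA mxtrace_mulC -mulmxA VG mulmx1 mxtrace_diag.
have trAA : \tr (A *m A) = \sum_i d 0 i ^+ 2.
  have -> : A *m A = V^T *m (diag_mx d *m diag_mx d) *m (V *m first_form u x).
    rewrite AV; move: (V *m first_form u x) VG => L LV.
    by rewrite -!mulmxA [L *m (V^T *m _)]mulmxA LV mul1mx.
  rewrite -mulmxA mxtrace_mulC -[_ *m V^T]mulmxA VG mulmx1 mulmx_diag mxtrace_diag.
  by apply: eq_bigr => i _; rewrite !mxE expr2.
have s1 : sigma1 (principal_curvatures u x) = \tr A.
  by rewrite trA; exact: (sum_of_prod_XsubC id pk).
split => //; rewrite sigma2_sqr s1 trAA; congr (_ - _).
exact: (sum_of_prod_XsubC (fun t => t ^+ 2) pk).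
Qed.

End curvature_traces.

(** The metric sends [N'] to [N' + u (u . N')]. Differentiating [u = N w] and
    [w ^+ 2 = 1 + |u| ^+ 2] gives [u . N' = w' / w ^+ 2], and the two terms add up to [u' / w]. *)
Lemma gauss_weingarten_algebra (R : realFieldType) n (u u' N N' : 'I_n -> R)
    (w w' : R) i :
  w != 0 -> w' * w + w * w' = \sum_j (u' j * u j + u j * u' j) ->
  (forall j, u' j = N' j * w + N j * w') -> (forall j, N j * w = u j) ->
  w * w = 1 + \sum_j u j * u j ->
  \sum_j ((i == j)%:R + u i * u j) * N' j = u' i / w.
Proof.
move=> w0 a b c d.
have -> : \sum_j ((i == j)%:R + u i * u j) * N' j = N' i + u i * \sum_j u j * N' j.
  rewrite mulr_sumr (eq_bigr (fun j => (i == j)%:R * N' j + u i * (u j * N' j))).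
    rewrite big_split /=; congr (_ + _).
    rewrite (bigD1 i)//= eqxx mul1r big1 ?addr0// => j ji.
    by rewrite eq_sym (negPf ji) mul0r.
  by move=> j _; ring.
set S := \sum_j u j * N' j.
have uN : (\sum_j u j * N j) * w = w * w - 1.
  rewrite d addrC addKr mulr_suml; apply: eq_bigr => j _.
  by rewrite -mulrA c.
have Sw : S * w = w * w' - w' * \sum_j u j * N j.
  have -> : w * w' = \sum_j u j * u' j.
    have e : \sum_j (u' j * u j + u j * u' j) = 2 * \sum_j u j * u' j.
      by rewrite mulr_sumr; apply: eq_bigr => j _; ring.
    by move: a; rewrite e => a; lra.
  rewrite /S mulr_suml mulr_sumr -sumrB; apply: eq_bigr => j _.
  by rewrite b; ring.
have Sww : S * (w * w) = w'.
  rewrite mulrA Sw mulrBl -[w' * _ * w]mulrA uN; ring.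
apply: (mulIf w0); rewrite divfK// b mulrDl; congr (_ + _).
by rewrite -Sww -c; ring.
Qed.

Section gauss_map.
Context {R : realType} {n : nat}.
Implicit Types (u : 'rV[R]_n -> R) (x v : 'rV[R]_n).

Definition area_factor u x : R := Num.sqrt (1 + \sum_i partial i u x ^+ 2).

(** The horizontal part of the unit normal, with the sign for which its derivative is g^(-1) h. *)
Definition gauss u (i : 'I_n) x : R := partial i u x * (area_factor u x)^-1.

Lemma sum_sqr_partial_ge0 u x : 0 <= \sum_i partial i u x ^+ 2.
Proof. by apply: sumr_ge0 => i _; exact: sqr_ge0. Qed.

Lemma area_factor_gt0 u x : 0 < area_factor u x.
Proof. by rewrite sqrtr_gt0 ltr_pwDl// sum_sqr_partial_ge0. Qed.

Lemma area_factor_sqr u x :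
  area_factor u x * area_factor u x = 1 + \sum_i partial i u x * partial i u x.
Proof.
by rewrite -expr2 sqr_sqrtr ?addr_ge0 ?sum_sqr_partial_ge0.
Qed.

Lemma gauss_mul u i x : gauss u i x * area_factor u x = partial i u x.
Proof. by rewrite /gauss divfK// gt_eqF// area_factor_gt0. Qed.

Variables (U : set 'rV[R]_n) (u : 'rV[R]_n -> R).
Hypothesis oU : open U.
Hypothesis Cu : forall k, Ck k U u.

Lemma Ck_partial k i : Ck k U (partial i u).
Proof. exact: Ck_D (Cu k.+1). Qed.

Lemma Ck_area_factor k : Ck k U (area_factor u).
Proof.
apply: CkW; apply: Ck_sqrt => //.
  by move=> x _; rewrite ltr_pwDl// sum_sqr_partial_ge0.
apply: Ck_add => //; first exact: Ck_cst.
apply: Ck_sum => // i; apply: (@Ck_ext _ _ _ _ (fun x => partial i u x * partial i u x)) => //.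
by apply: Ck_mul => //; exact: Ck_partial.
Qed.

Lemma Ck_gauss k i : Ck k U (gauss u i).
Proof.
apply: Ck_mul => //; first exact: Ck_partial.
apply: Ck_inv => //; last exact: Ck_area_factor.
by move=> x _; rewrite gt_eqF// area_factor_gt0.
Qed.

Lemma gauss_weingarten i x v : U x ->
  \sum_j ((i == j)%:R + partial i u x * partial j u x) * 'D_v (gauss u j) x =
  'D_v (partial i u) x / area_factor u x.
Proof.
move=> Ux; set w := area_factor u x; pose w' := 'D_v (area_factor u) x.
have w0 : w != 0 by rewrite gt_eqF// area_factor_gt0.
have dw : is_derive x v (area_factor u) w' := Ck_isD v (Ck_area_factor 1) Ux.
have dp j : is_derive x v (partial j u) ('D_v (partial j u) x).
  exact: Ck_isD v (Ck_partial 1 j) Ux.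
have a : w' * w + w * w' = \sum_j ('D_v (partial j u) x * partial j u x +
    partial j u x * 'D_v (partial j u) x).
  have [_ <-] := isD_mul dw dw.
  apply: (derive_on oU Ux (G := fun y => 1 + \sum_j partial j u y * partial j u y)).
    by move=> y _; exact: area_factor_sqr.
  rewrite -[X in is_derive _ _ _ X]add0r; apply: isD_add.
  by apply: isD_sum => j; exact: isD_mul.
have b j : 'D_v (partial j u) x = 'D_v (gauss u j) x * w + gauss u j x * w'.
  apply: (derive_on oU Ux (G := fun y => gauss u j y * area_factor u y)).
    by move=> y _; rewrite gauss_mul.
  by apply: isD_mul => //; exact: Ck_isD v (Ck_gauss 1 j) Ux.
have c j : gauss u j x * w = partial j u x := gauss_mul u j x.
have d : w * w = 1 + \sum_j partial j u x * partial j u x := area_factor_sqr u x.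
exact: (@gauss_weingarten_algebra R n (fun j => partial j u x)
  (fun j => 'D_v (partial j u) x) (fun j => gauss u j x)
  (fun j => 'D_v (gauss u j) x) w w' i w0 a b c d).
Qed.

Lemma hess_sym x : U x -> (hess u x)^T = hess u x.
Proof.
move=> Ux; apply/matrixP => i j; rewrite !mxE.
exact: (@Ck_swap R _ U u x (delta_mx 0 j) (delta_mx 0 i) oU (Cu 2) Ux).
Qed.

Definition shape_op u x : 'M[R]_n := \matrix_(i, j) 'D_(delta_mx 0 j) (gauss u i) x.

Lemma first_form_shape x : U x -> first_form u x *m shape_op u x = second_form u x.
Proof.
move=> Ux; apply/matrixP => i j; rewrite !mxE.
have E : Num.sqrt (1 + enorm (grad u x) ^+ 2) = area_factor u x.
  rewrite /enorm sqr_sqrtr; last by apply: sumr_ge0 => l _; exact: sqr_ge0.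
  by congr (Num.sqrt (1 + _)); apply: eq_bigr => l _; rewrite mxE.
rewrite E -(gauss_weingarten i (delta_mx 0 j) Ux).
by apply: eq_bigr => l _; rewrite !mxE.
Qed.

Lemma mean_curvature_shape x : U x -> mean_curvature u x = \tr (shape_op u x).
Proof.
by move=> Ux; case: (curvature_traces (hess_sym Ux) (first_form_shape Ux)).
Qed.

Lemma sigma2_shape x : U x -> 2 * sigma2 (principal_curvatures u x) =
  (\tr (shape_op u x)) ^+ 2 - \tr (shape_op u x *m shape_op u x).
Proof.
by move=> Ux; case: (curvature_traces (hess_sym Ux) (first_form_shape Ux)).
Qed.

End gauss_map.

(** * The second derivative test *)

(** If [d2] were positive, [dg] would be positive just to the right of 0 and the mean value theorem
    would give a larger value there. *)
Lemma second_derivative_test_line (R : realType) (g dg : R -> R) (d2 e : R) : 0 < e ->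
  (forall s, `|s| < e -> is_derive (s : R) (1 : R) g (dg s)) ->
  (forall s : R, `|s| < e -> g s <= g 0) -> is_derive (0 : R) (1 : R) dg d2 ->
  dg 0 = 0 /\ d2 <= 0.
Proof.
move=> e0 Dg gm D2.
have inE s : s \in `]- e, e[ -> `|s| < e by rewrite in_itv/= ltr_norml.
have dg0 : dg 0 = 0.
  have [_ <-] : is_derive (0 : R) (1 : R) g (dg 0) by apply: Dg; rewrite normr0.
  suff [_ ->] : is_derive (0 : R) (1 : R) g 0 by [].
  apply: (@derive1_at_max _ g (- e) e) => //.
  - by rewrite ge0_cp// ltW.
  - by move=> t /inE te; have [] := Dg t te.
  - by rewrite in_itv/= oppr_lt0 e0.
  - by move=> t /inE; exact: gm.
split=> //; rewrite leNgt; apply/negP => d20.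
have [dd dE] := D2.
have : (fun h : R => h^-1 *: ((dg \o shift 0) (h *: 1) - dg 0)) @ 0^' --> d2.
  by rewrite -dE; exact: dd.
move=> /cvgrPdist_lt /(_ d2 d20) /nbhs_ballP[r /= r0 hr].
pose h := Num.min e r / 2.
have m0 : 0 < Num.min e r by rewrite lt_min e0.
have h0 : 0 < h by rewrite divr_gt0.
have hm : h < Num.min e r by rewrite /h ltr_pdivrMr// mulr_natr mulr2n ltrDl.
have /andP[he hr'] : (h < e) && (h < r) by rewrite -lt_min.
have pos c : 0 < c -> c < h -> 0 < dg c.
  move=> c0 ch; have := hr c; rewrite /ball /= sub0r normrN gtr0_norm//.
  move=> /(_ (lt_trans ch hr') (lt0r_neq0 c0)).
  rewrite /= dg0 subr0 addr0 [c *: 1]mulr1 => /ltr_distlBl.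
  rewrite subrr => P; have {P} : 0 < c^-1 * dg c by exact: P.
  by rewrite pmulr_rgt0// invr_gt0.
have Dh s : 0 <= s <= h -> is_derive (s : R) (1 : R) g (dg s).
  by move=> /andP[s0 sh]; apply: Dg; rewrite ger0_norm// (le_lt_trans sh).
have [||c /[!in_itv]/= /andP[c0 ch]] := @MVT _ g dg 0 h h0.
- by move=> s /[!in_itv]/= /andP[s0 sh]; apply: Dh; rewrite !ltW.
- apply: derivable_within_continuous => s /[!in_itv]/= s0h.
  by have [] := Dh s s0h.
rewrite subr0 => E; have := gm h; rewrite gtr0_norm// => /(_ he).
by rewrite leNgt -subr_gt0 E mulr_gt0// pos.
Qed.

Lemma second_derivative_test (R : realType) (V : normedModType R) (U : set V)
    (P dP : V -> R) (p v : V) (d2 : R) : open U -> U p ->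
  (forall x, U x -> is_derive x v P (dP x)) -> (forall x, U x -> P x <= P p) ->
  is_derive p v dP d2 -> dP p = 0 /\ d2 <= 0.
Proof.
move=> oU Up DP Pm D2.
have /nbhs_ballP[e /= e0 he] := line_near v oU Up.
have be (s : R) : `|s| < e -> U (p + s *: v).
  by move=> se; apply: he; rewrite /ball /= sub0r normrN.
have p0 : p + (0 : R) *: v = p by rewrite scale0r addr0.
have := @second_derivative_test_line R (fun s => P (p + s *: v))
  (fun s => dP (p + s *: v)) d2 e e0; rewrite p0; apply.
- move=> s se; have [dx xE] := DP _ (be s se).
  by rewrite -xE; exact: derive_line.
- by move=> s /be; exact: Pm.
- have [dx <-] := D2; rewrite -{1}p0; have := @derive_line R V dP p v 0.
  by rewrite p0; exact.
Qed.

(** * First and second order conditions at a maximum of the test function *)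

Section log_test.
Context {R : realType} {V : normedModType R}.
Implicit Types (f : V -> R) (x v : V).

Lemma isD_ln f x v (df : R) : 0 < f x -> is_derive x v f df ->
  is_derive x v (fun y => ln (f y)) (df / f x).
Proof.
move=> f0 Df; rewrite mulrC; apply: (is_derive_comp1 Df).
exact: is_derive1_ln.
Qed.

Lemma isD_div f g x v (df dg : R) : g x != 0 -> is_derive x v f df ->
  is_derive x v g dg ->
  is_derive x v (fun y => f y / g y) (df / g x - f x * dg / g x ^+ 2).
Proof.
move=> g0 Df Dg.
have Dh : is_derive x v (fun y => (g y)^-1) (- (g x) ^- 2 * dg).
  have [dg1 <-] := Dg; split; first exact: derivableV.
  exact: deriveV.
apply: is_derive_eq (isD_mul Df Dh) _.
by rewrite mulNr mulrN mulrA mulrAC.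
Qed.

End log_test.

Section max_log.
Context {R : realType} {V : normedModType R}.
Variables (U : set V) (rho phi Hf : V -> R) (drho dphi dH : V -> R) (p v : V).
Variables (r2 p2 h2 be cM Hp bp dp : R).
Let b x := ln (Hf x) - cM.

Lemma max_log_test : open U -> U p ->
  (forall x, U x -> [/\ 0 < rho x, 0 < Hf x & 0 < b x]) ->
  (forall x, U x -> [/\ is_derive x v rho (drho x), is_derive x v phi (dphi x) &
    is_derive x v Hf (dH x)]) ->
  is_derive p v drho r2 -> is_derive p v dphi p2 -> is_derive p v dH h2 ->
  Hf p = Hp -> bp = b p -> dphi p = dp ->
  (forall x, U x -> 2 * ln (rho x) + be * phi x + ln (b x) <=
    2 * ln (rho p) + be * phi p + ln bp) ->
  2 * (drho p / rho p) + be * dp + dH p / Hp / bp = 0 /\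
  2 * (r2 / rho p - drho p * drho p / rho p ^+ 2) + be * p2 +
  ((h2 / Hp - dH p * dH p / Hp ^+ 2) / bp -
    dH p / Hp * (dH p / Hp) / bp ^+ 2) <= 0.
Proof.
move=> oU Up pos D Dr Dp Dh <- -> <- mx.
have Db x : U x -> is_derive x v b (dH x / Hf x).
  move=> Ux; have [_ H0 _] := pos x Ux; have [_ _ DH] := D x Ux.
  rewrite -[X in is_derive _ _ _ X]subr0; apply: isD_sub; exact: isD_ln.
have [r0 H0 b0] := pos p Up; have [Dr1 Dp1 DH1] := D p Up.
apply: (@second_derivative_test R V U
  (fun x => 2 * ln (rho x) + be * phi x + ln (b x))
  (fun x => 2 * (drho x / rho x) + be * dphi x + dH x / Hf x / b x) p v) => //.
- move=> x Ux; have [rx Hx bx] := pos x Ux; have [Drx Dpx DHx] := D x Ux.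
  apply: isD_add; last by apply: isD_ln => //; exact: Db.
  by apply: isD_add; apply: isD_scale; exact: isD_ln.
- apply: isD_add; last first.
    apply: isD_div; [by rewrite gt_eqF| |exact: Db].
    by apply: isD_div => //; rewrite gt_eqF.
  by apply: isD_add; apply: isD_scale; apply: isD_div; rewrite gt_eqF.
Qed.

End max_log.

(** The second-order conditions are weighted by [f c], and the first-order ones by the drift of the
    operator. The coefficient of [\sum_c f c * B c ^+ 2] is [(1 + e) * b] from the Jacobi
    inequality, [- b] from ln H and [- 1] from the outer logarithm. The number 13 is 12 from the
    Hessian of the cutoff plus 1 for the error [be * H / 1000]. *)
Lemma max_point_algebra (R : realFieldType) (f k u xc nn m dH h2 p2 : 'I_4 -> R)
    (W f0 H K X rho be b e : R) :
  let B c := 4 * xc c / rho - be * (nn c + k c * (xc c + nn c)) in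
  let dp c := nn c + k c * (xc c + nn c) in
  (forall c, 0 < f c) -> 0 < H -> 0 < f0 -> 0 < rho -> rho <= 8 -> 0 < be -> be <= 1 ->
  0 < b -> \sum_c f c = 3 * H -> (forall c, m c <= 1) ->
  W * (\sum_c u c * xc c) = X -> `|X| <= 3 / 100 ->
  (forall c, 2 * (-2 * xc c / rho) + be * dp c + dH c / H / b = 0) ->
  (forall c, 2 * (-2 * m c / rho - (-2 * xc c) * (-2 * xc c) / rho ^+ 2) + be * p2 c +
    ((h2 c / H - dH c * dH c / H ^+ 2) / b - dH c / H * (dH c / H) / b ^+ 2) <= 0) ->
  9 / 10 * K - H / 1000 <= \sum_c f c * p2 c - 2 * f0 * W * \sum_c u c * dp c ->
  (1 + e) / H * (\sum_c f c * dH c ^+ 2) - H * K <=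
    \sum_c f c * h2 c - 2 * f0 * W * \sum_c u c * dH c ->
  - (13 * H + 24 / 100 * f0) / rho - 8 * (\sum_c f c * xc c ^+ 2) / rho ^+ 2 +
    (9 / 10 * be - b^-1) * K + (e * b - 1) * \sum_c f c * B c ^+ 2 <= 0.
Proof.
move=> B dp fgt H0 f00 r0 r8 be0 be1 b0 sf m1 X1 Xb D1 D2 LP LH.
(* The first-order condition says that [B] is the gradient of ln b. *)
have dHE c : dH c = H * b * B c.
  have -> : H * b * B c = dH c - H * b * (2 * (-2 * xc c / rho) + be * dp c + dH c / H / b).
    by rewrite /B /dp; field; rewrite !gt_eqF.
  by rewrite D1 mulr0 subr0.
have ddH : \sum_c f c * dH c ^+ 2 = H ^+ 2 * b ^+ 2 * \sum_c f c * B c ^+ 2.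
  by rewrite mulr_sumr; apply: eq_bigr => c _; rewrite dHE; ring.
set SB := \sum_c f c * B c ^+ 2 in ddH *.
set LPv := (X in _ <= X) in LP; set LHv := (X in _ <= X) in LH.
have main : - 4 * (\sum_c f c * m c) / rho + 8 * f0 * X / rho
   - 8 * (\sum_c f c * xc c ^+ 2) / rho ^+ 2 + be * LPv + LHv / (H * b) - (b + 1) * SB <= 0.
  have -> : - 4 * (\sum_c f c * m c) / rho + 8 * f0 * X / rho
   - 8 * (\sum_c f c * xc c ^+ 2) / rho ^+ 2 + be * LPv + LHv / (H * b) - (b + 1) * SB =
   \sum_c f c * (2 * (-2 * m c / rho - (-2 * xc c) * (-2 * xc c) / rho ^+ 2) + be * p2 c +
    ((h2 c / H - dH c * dH c / H ^+ 2) / b - dH c / H * (dH c / H) / b ^+ 2)) -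
   2 * f0 * W * \sum_c u c * (2 * (-2 * xc c / rho) + be * dp c + dH c / H / b).
    have e1 : \sum_c f c *
      (2 * (-2 * m c / rho - (-2 * xc c) * (-2 * xc c) / rho ^+ 2) + be * p2 c +
      ((h2 c / H - dH c * dH c / H ^+ 2) / b - dH c / H * (dH c / H) / b ^+ 2)) =
      - 4 / rho * (\sum_c f c * m c) - 8 / rho ^+ 2 * (\sum_c f c * xc c ^+ 2) +
      be * (\sum_c f c * p2 c) + (\sum_c f c * h2 c) / (H * b) - (b + 1) * SB.
      rewrite /SB [(\sum_c f c * h2 c) / _]mulrC !mulr_sumr -sumrB -!big_split -sumrB.
      apply: eq_bigr => c _ /=; rewrite dHE; move: (B c) => Bc.
      by field; rewrite !gt_eqF.
    have e2 : \sum_c u c * (2 * (-2 * xc c / rho) + be * dp c + dH c / H / b) =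
      - 4 / rho * (\sum_c u c * xc c) + be * (\sum_c u c * dp c) +
      (\sum_c u c * dH c) / (H * b).
      rewrite [(\sum_c u c * dH c) / _]mulrC !mulr_sumr -!big_split.
      by apply: eq_bigr => c _ /=; field; rewrite !gt_eqF.
    rewrite e1 e2 -X1 /LPv /LHv.
    set s1 := \sum_c _; set s2 := \sum_c _; set s3 := \sum_c _; set s4 := \sum_c _.
    set s5 := \sum_c _; set s6 := \sum_c _; set s7 := \sum_c _.
    by field; rewrite !gt_eqF.
  rewrite [X in _ - _ * X]big1 => [|c _]; last by rewrite D1 mulr0.
  by rewrite mulr0 subr0 sumr_le0// => c _; rewrite mulr_ge0_le0// ltW.
have h1 : be * (9 / 10 * K - H / 1000) <= be * LPv by rewrite ler_pM2l.
have h2' : (1 + e) * b * SB - K / b <= LHv / (H * b).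
  have -> : (1 + e) * b * SB - K / b =
      ((1 + e) / H * (\sum_c f c * dH c ^+ 2) - H * K) / (H * b).
    by rewrite ddH; field; rewrite !gt_eqF.
  by rewrite ler_pM2r// invr_gt0 mulr_gt0.
have h3 : - (12 * H) / rho <= - 4 * (\sum_c f c * m c) / rho.
  rewrite ler_pM2r ?invr_gt0// mulNr lerN2.
  rewrite (_ : 12 * H = 4 * \sum_c f c); last by rewrite sf; ring.
  by rewrite ler_pM2l// ler_sum// => c _; rewrite ler_piMr// ltW.
have h4 : - (24 / 100 * f0) / rho <= 8 * f0 * X / rho.
  rewrite ler_pM2r ?invr_gt0//.
  have : - (3 / 100) <= X by move: Xb; rewrite ler_norml => /andP[].
  by move=> /(ler_wpM2l (ltW f00)); clear; lra.
have h5 : be * H / 1000 <= H / rho.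
  rewrite -(@ler_pM2r _ rho)// divfK ?gt_eqF//.
  have : be * rho <= 1 * 8 by apply: ler_pM => //; exact: ltW.
  by move=> /(ler_wpM2l (ltW H0)); move: H0; clear; lra.
have E1 : - (13 * H + 24 / 100 * f0) / rho = - (12 * H) / rho - H / rho - 24 / 100 * f0 / rho.
  by field; rewrite gt_eqF.
by rewrite E1; move: main h1 h2' h3 h4 h5; clear; lra.
Qed.

Lemma conj_mulmx (R : comNzRingType) n (P Q X Y : 'M[R]_n) : Q *m P = 1%:M ->
  (P *m X *m Q) *m (P *m Y *m Q) = P *m (X *m Y) *m Q.
Proof. by move=> QP; rewrite -!mulmxA [Q *m (P *m _)]mulmxA QP mul1mx. Qed.

Lemma mxtrace_conj (R : comNzRingType) n (P Q X : 'M[R]_n) : Q *m P = 1%:M ->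
  \tr (P *m X *m Q) = \tr X.
Proof. by move=> QP; rewrite -mulmxA mxtrace_mulC -mulmxA QP mulmx1. Qed.

(** The square of the gradient of the Gauss map contributes almost [K], and L N = - K N costs
    [(X + S) * K]. Smallness of the slope makes [S] and [X] small enough to leave 9/10; the terms in
    [f0] have a good sign. *)
Lemma laplace_test_algebra (R : realFieldType) (k u m nn xc N2f : 'I_4 -> R)
    (W f0 H K X S : R) :
  let f c := H - k c in
  (forall c, 0 < f c) -> 0 < f0 -> 0 < H -> \sum_c f c = 3 * H ->
  \sum_c f c * k c = 2 * f0 -> \sum_c f c * k c ^+ 2 = K ->
  (forall c, m c = 1 - u c ^+ 2) ->
  \sum_c u c ^+ 2 = S -> S <= 1 / (100 * 100) ->
  W * (\sum_c u c * xc c) = X -> `|X| <= 3 / 100 -> W * (\sum_c u c * nn c) = S ->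
  (forall a, N2f a - 2 * f0 * W * u a * k a = - (W * u a * K)) ->
  9 / 10 * K - H / 1000 <=
  \sum_c f c * ((2 * k c + k c ^+ 2) * m c) + \sum_a (xc a + nn a) * N2f a -
  2 * f0 * W * \sum_c u c * (nn c + k c * (xc c + nn c)).
Proof.
move=> f fgt f00 H0 sf fk fK mE uS S1 X1 Xb nS LN.
have u_le c : u c ^+ 2 <= S.
  by rewrite -uS (bigD1 c)//= lerDl sumr_ge0// => a _; exact: sqr_ge0.
have S0 : 0 <= S by apply: le_trans (u_le ord0); exact: sqr_ge0.
have K0 : 0 <= K by rewrite -fK sumr_ge0// => c _; rewrite mulr_ge0 ?sqr_ge0// ltW.
have T2 : \sum_a (xc a + nn a) * N2f a -
    2 * f0 * W * \sum_c u c * (nn c + k c * (xc c + nn c)) = - (X + S) * K - 2 * f0 * S.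
  rewrite -X1 -nS.
  have -> : \sum_a (xc a + nn a) * N2f a = \sum_a (2 * f0 * W * (u a * (k a * (xc a + nn a)))
      - W * K * (u a * xc a + u a * nn a)).
    apply: eq_bigr => a _; have -> : N2f a = 2 * f0 * W * u a * k a - W * u a * K.
      by rewrite -[- _](LN a); ring.
    by ring.
  rewrite sumrB -!mulr_sumr big_split /=.
  have -> : \sum_c u c * (nn c + k c * (xc c + nn c)) =
      \sum_c u c * nn c + \sum_c u c * (k c * (xc c + nn c)).
    by rewrite -big_split; apply: eq_bigr => c _ /=; ring.
  by ring.
rewrite -addrA T2.
have T1 : 2 * (2 * f0) + K - (S * (3 * H) + 2 * S * K) <=
    \sum_c f c * ((2 * k c + k c ^+ 2) * m c).
  rewrite -fk -sf -fK !mulr_sumr -!big_split -sumrB; apply: ler_sum => c _ /=.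
  have h1 : (2 * k c + k c ^+ 2) * u c ^+ 2 <= (1 + 2 * k c ^+ 2) * S.
    apply: (@le_trans _ _ ((1 + 2 * k c ^+ 2) * u c ^+ 2)).
      rewrite ler_wpM2r ?sqr_ge0// -subr_ge0.
      by rewrite (_ : _ - _ = (1 - k c) ^+ 2) ?sqr_ge0//; ring.
    by rewrite ler_wpM2l// addr_ge0// mulr_ge0// sqr_ge0.
  have := ler_wpM2l (ltW (fgt c)) h1; rewrite mE; move: (f c) => g; lra.
have XS : (X + S) * K <= (3 / 100 + 1 / 100) * K.
  by rewrite ler_wpM2r// lerD//; [exact: le_trans (ler_norm _) Xb|lra].
have SH : S * H <= 1 / (100 * 100) * H by rewrite ler_wpM2r// ltW.
have SK : S * K <= 1 / (100 * 100) * K by rewrite ler_wpM2r.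
have Sf : f0 * S <= f0 by rewrite ler_piMr ?ltW//; move: S1; lra.
move: T1 XS SH SK Sf f00 H0 K0; clear; lra.
Qed.

Lemma dotr_cauchy (R : realFieldType) n (x y : 'rV[R]_n) :
  (\sum_i x 0 i * y 0 i) ^+ 2 <= (\sum_i x 0 i ^+ 2) * (\sum_i y 0 i ^+ 2).
Proof.
have h : 0 <= \sum_i \sum_j (x 0 i * y 0 j - x 0 j * y 0 i) ^+ 2.
  by apply: sumr_ge0 => i _; apply: sumr_ge0 => j _; exact: sqr_ge0.
suff e : \sum_i \sum_j (x 0 i * y 0 j - x 0 j * y 0 i) ^+ 2 =
    2 * ((\sum_i x 0 i ^+ 2) * (\sum_i y 0 i ^+ 2) - (\sum_i x 0 i * y 0 i) ^+ 2).
  by move: h; rewrite e pmulr_rge0// subr_ge0.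
have -> : \sum_i \sum_j (x 0 i * y 0 j - x 0 j * y 0 i) ^+ 2 =
    \sum_i \sum_j x 0 i ^+ 2 * y 0 j ^+ 2 + \sum_j \sum_i x 0 i ^+ 2 * y 0 j ^+ 2 -
    2 * \sum_i \sum_j (x 0 i * y 0 i) * (x 0 j * y 0 j).
  rewrite mulr_sumr -big_split -sumrB; apply: eq_bigr => i _ /=.
  by rewrite mulr_sumr -big_split -sumrB; apply: eq_bigr => j _ /=; ring.
rewrite [X in _ + X - _]exchange_big /= expr2 !big_distrlr /=; ring.
Qed.

Lemma max_point_estimate (R : realFieldType) (k u xc nn m dH h2 p2 : 'I_4 -> R)
    (W f0 X rho b s E be : R) :
  let H := \sum_a k a in
  let f c := H - k c in
  let K := \sum_c f c * k c ^+ 2 in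
  let dp c := nn c + k c * (xc c + nn c) in
  E = 300 + 2 * s -> be = (1000 * E)^-1 -> 0 < H -> 0 < f0 ->
  2 * f0 = H ^+ 2 - \sum_a k a ^+ 2 -> 0 <= s -> s ^+ 2 = f0 ->
  \sum_c xc c ^+ 2 <= 8 -> 4 / 5 <= \sum_c xc c ^+ 2 ->
  (forall c, `|nn c| <= 1 / 100) -> 0 < rho -> rho <= 8 -> 0 < b ->
  2 * f0 * b ^+ 2 <= H ^+ 2 -> (forall c, m c <= 1) ->
  W * (\sum_c u c * xc c) = X -> `|X| <= 3 / 100 ->
  (forall c, 2 * (-2 * xc c / rho) + be * dp c + dH c / H / b = 0 /\
    2 * (-2 * m c / rho - (-2 * xc c) * (-2 * xc c) / rho ^+ 2) + be * p2 c +
    ((h2 c / H - dH c * dH c / H ^+ 2) / b - dH c / H * (dH c / H) / b ^+ 2) <= 0) ->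
  9 / 10 * K - H / 1000 <= \sum_c f c * p2 c - 2 * f0 * W * \sum_c u c * dp c ->
  (forall e, 0 <= e ->
    (forall i, e * (8 * f i ^+ 2 - 12 * f i * H + 9 * H ^+ 2) <=
      (4 * f i + H) * (3 * H - 2 * f i)) ->
    (1 + e) / H * (\sum_c f c * dH c ^+ 2) - H * K <=
      \sum_c f c * h2 c - 2 * f0 * W * \sum_c u c * dH c) ->
  b * rho ^+ 2 <= 256 / be + 140 * 1000 * E / (be ^+ 2 * f0) + 1.
Proof.
move=> H f K dp EE beE H0 f00 f0E s0 s2 x8 x45 nn1 r0 r8 b0 Hb m1 X1 Xb D LP LH.
have E300 : 300 <= E by rewrite EE; move: s0; clear; lra.
have E0 : 0 < E by apply: lt_le_trans E300.
have be0 : 0 < be by rewrite beE invr_gt0 pmulr_rgt0 ?ltr0n.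
have be1 : be <= 1.
  rewrite beE invf_le1; first by move: E300; clear; lra.
  by rewrite pmulr_rgt0 ?ltr0n.
apply: (@max_point_bound R k xc nn f
  (fun c => 4 * xc c / rho - be * (nn c + k c * (xc c + nn c)))
  f0 s rho b H K E be) => //.
  move=> c; apply: le_trans x8.
  by rewrite (bigD1 c)//= lerDl sumr_ge0// => a _; exact: sqr_ge0.
move=> eps eps0 he.
apply: (@max_point_algebra R f k u xc nn m dH h2 p2 W f0 H K X rho be b eps) => //.
- exact: cone_f_gt0 H0 f00 f0E.
- exact: cone_sum_f.
- by move=> c; have [] := D c.
- by move=> c; have [] := D c.
- exact: LH.
Qed.

(** * The linearised operator in a principal frame *)

Lemma exchange_weighted_sum (R : comPzRingType) (I : finType) (x f : I -> R)
    (T : I -> I -> R) :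
  \sum_a x a * (\sum_c f c * T a c) = \sum_c f c * (\sum_a x a * T a c).
Proof.
under eq_bigr do rewrite mulr_sumr.
rewrite exchange_big; apply: eq_bigr => c _; rewrite mulr_sumr.
by apply: eq_bigr => a _; rewrite mulrCA.
Qed.

(* The rows [v c] of [M] form a [g]-orthonormal basis of principal directions at
   [p], with curvatures [k c]; they are kept fixed as [x] varies.  The [na a] are
   the components of the Gauss map in this basis, and [f c] and
   [2 * f0 * W * uc c] are the coefficients of the linearised operator at [p]. *)
Section principal_frame.
Context {R : realType}.
Variables (U : set 'rV[R]_4) (u : 'rV[R]_4 -> R) (f0 : R) (p : 'rV[R]_4).
Variables (M : 'M[R]_4) (d : 'rV[R]_4).
Hypothesis oU : open U.
Hypothesis Cu : forall k, Ck k U u.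
Hypothesis Up : U p.
Hypothesis sigE : forall x, U x ->
  (\tr (shape_op u x)) ^+ 2 - \tr (shape_op u x *m shape_op u x) = 2 * f0.
Hypothesis MG : M *m first_form u p *m M^T = 1%:M.
Hypothesis Mh : M *m second_form u p *m M^T = diag_mx d.

(** The inverse of [M^T]. As [M] and [L] are constant, the matrix of derivatives of [na] is
    conjugate to the shape operator on all of [U], so the curvature equation holds in the frame near
    [p] and may be differentiated. *)
Let L := M *m first_form u p.
Let v c : 'rV[R]_4 := row c M.
Let na a x := \sum_j L a j * gauss u j x.
Let gam a b := \sum_i M a i * M b i.
Let k c := d 0 c.

Let ML : M^T *m L = 1%:M. Proof. exact: mulmx1C. Qed.

Lemma frame_derive F x c : Ck 1 U F -> U x ->
  'D_(v c) F x = \sum_i M c i * 'D_(delta_mx 0 i) F x.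
Proof.
move=> CF Ux; rewrite (row_sum_delta (v c)) (Ck_derive_sum _ _ _ oU CF Ux).
by apply: eq_bigr => i _; rewrite mxE.
Qed.

Lemma frame_Ck_na j a : Ck j U (na a).
Proof.
by apply: Ck_sum => // i; apply: Ck_scale => //; exact: Ck_gauss.
Qed.

Lemma frame_derive_na a c x : U x ->
  'D_(v c) (na a) x = \sum_j L a j * 'D_(v c) (gauss u j) x.
Proof.
move=> Ux; apply: (derive_on oU Ux (G := na a)) => //.
apply: isD_sum => j; apply: isD_scale.
exact: Ck_isD (v c) (Ck_gauss oU Cu 1 j) Ux.
Qed.

Lemma frame_shape a c x : U x ->
  'D_(v c) (na a) x = (L *m shape_op u x *m M^T) a c.
Proof.
move=> Ux; rewrite frame_derive_na// -mulmxA mxE; apply: eq_bigr => j _.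
congr (_ * _); rewrite (frame_derive _ (Ck_gauss oU Cu 1 j) Ux) mxE.
by apply: eq_bigr => i _; rewrite !mxE mulrC.
Qed.

Lemma frame_metric a b x : U x ->
  gam a b + 'D_(v a) u x * 'D_(v b) u x = (M *m first_form u x *m M^T) a b.
Proof.
move=> Ux; rewrite first_formE mulmxDr mulmx1 mulmxDl [RHS]mxE; congr (_ + _).
  by rewrite mxE; apply: eq_bigr => i _; rewrite mxE.
rewrite !(frame_derive _ (Cu 1) Ux) mulmxA -[M *m _ *m _ *m _]mulmxA [RHS]mxE big_ord1.
congr (_ * _); rewrite !mxE; apply: eq_bigr => i _; rewrite !mxE//.
by rewrite mulrC.
Qed.

Lemma frame_hessE x : U x -> forall a c, 'D_(v c) ('D_(v a) u) x =
  area_factor u x * \sum_b (gam a b + 'D_(v a) u x * 'D_(v b) u x) *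
    'D_(v c) (na b) x.
Proof.
move=> Ux a c.
have -> : 'D_(v c) ('D_(v a) u) x = \sum_i M a i * 'D_(v c) (partial i u) x.
  apply: (derive_on oU Ux (G := fun y => \sum_i M a i * partial i u y)).
    by move=> y Uy; rewrite (frame_derive _ (Cu 1) Uy).
  apply: isD_sum => i; apply: isD_scale.
  exact: Ck_isD (v c) (Ck_partial Cu 1 i) Ux.
pose y : 'cV[R]_4 := \col_j 'D_(v c) (gauss u j) x.
have -> : \sum_b (gam a b + 'D_(v a) u x * 'D_(v b) u x) * 'D_(v c) (na b) x =
    (M *m first_form u x *m y) a 0.
  have -> : M *m first_form u x *m y = (M *m first_form u x *m M^T) *m (L *m y).
    by rewrite -[RHS]mulmxA [M^T *m _]mulmxA ML mul1mx.
  rewrite [RHS]mxE.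
  apply: eq_bigr => b _; rewrite frame_metric// frame_derive_na//.
  by congr (_ * _); rewrite mxE; apply: eq_bigr => j _; rewrite [y _ _]mxE.
rewrite -mulmxA [X in _ * X]mxE mulr_sumr; apply: eq_bigr => i _.
have w0 : area_factor u x != 0 by rewrite gt_eqF// area_factor_gt0.
rewrite mulrCA; congr (_ * _); rewrite mxE.
have -> : \sum_j first_form u x i j * y j 0 =
    'D_(v c) (partial i u) x / area_factor u x.
  rewrite -(gauss_weingarten oU Cu i (v c) Ux).
  by apply: eq_bigr => j _; rewrite !mxE.
by rewrite mulrC divfK.
Qed.

Lemma frame_sigma2 x : U x -> (\sum_a 'D_(v a) (na a) x) ^+ 2 -
  \sum_a \sum_b 'D_(v a) (na b) x * 'D_(v b) (na a) x = 2 * f0.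
Proof.
move=> Ux; rewrite -(sigE Ux).
pose T := L *m shape_op u x *m M^T.
have -> : \sum_a 'D_(v a) (na a) x = \tr T.
  by apply: eq_bigr => a _; rewrite frame_shape.
have -> : \sum_a \sum_b 'D_(v a) (na b) x * 'D_(v b) (na a) x = \tr (T *m T).
  apply: eq_bigr => a _; rewrite mxE; apply: eq_bigr => b _.
  by rewrite !frame_shape// mulrC.
by rewrite (conj_mulmx _ _ ML) !mxtrace_conj.
Qed.

Lemma frame_trace x : U x -> \sum_a 'D_(v a) (na a) x = mean_curvature u x.
Proof.
move=> Ux; rewrite (mean_curvature_shape oU Cu Ux).
transitivity (\tr (L *m shape_op u x *m M^T)).
  by apply: eq_bigr => a _; rewrite frame_shape.
by rewrite mxtrace_conj.
Qed.

Lemma frame_metric_p a b : gam a b + 'D_(v a) u p * 'D_(v b) u p = (a == b)%:R.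
Proof. by rewrite frame_metric// MG mxE. Qed.

Lemma frame_dna b c : 'D_(v c) (na b) p = k b * (b == c)%:R.
Proof.
rewrite frame_shape// /L -[M *m _ *m shape_op u p]mulmxA.
by rewrite (first_form_shape oU Cu Up) Mh mxE mulr_natr.
Qed.

Let W := area_factor u p.
Let uc c := 'D_(v c) u p.
Let N2 b c c' := 'D_(v c') ('D_(v c) (na b)) p.
Let N3 b c c' c'' := 'D_(v c'') ('D_(v c') ('D_(v c) (na b))) p.
Let H := \sum_a k a.
Let f c := H - k c.
Let K := \sum_c f c * k c ^+ 2.
Let frC c (x : 'rV[R]_4) := \sum_i M c i * x 0 i.
Let q : 'rV[R]_4 := grad u p.

Lemma frame_ucE c : uc c = frC c q.
Proof.
rewrite /uc (frame_derive _ (Cu 1) Up); apply: eq_bigr => i _.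
by rewrite mxE.
Qed.

Lemma dotr_grad : dotr q q = W ^+ 2 - 1.
Proof.
rewrite expr2 area_factor_sqr addrC addKr; apply: eq_bigr => i _.
by rewrite !mxE.
Qed.

(** Both sides are the inverse metric, the right one by the Sherman-Morrison formula. *)
Lemma frame_dual : M^T *m M = 1%:M + (- W ^- 2) *: (q^T *m q).
Proof.
have W0 : W != 0 by rewrite gt_eqF// area_factor_gt0.
have G1 : first_form u p *m (1%:M + (- W ^- 2) *: (q^T *m q)) = 1%:M.
  rewrite first_formE -/q -{1}[q^T *m q]scale1r.
  rewrite (mul_id_add_scaled _ _ (rank_one_mul q)); apply: add_scaled_eq0.
  by rewrite dotr_grad; field.
have MML : M^T *m M *m first_form u p = 1%:M by rewrite -mulmxA; exact: ML.
by apply: etrans (esym (mulmx1 _)) _; rewrite -[X in _ *m X]G1 mulmxA MML mul1mx.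
Qed.

Lemma frame_dot (x y : 'rV[R]_4) :
  \sum_c frC c x * frC c y = dotr x y - dotr x q * dotr y q / W ^+ 2.
Proof.
have E : x *m (M^T *m M) *m y^T = (dotr x y - dotr x q * dotr y q / W ^+ 2)%:M.
  rewrite frame_dual mulmxDr mulmx1 mulmxDl -scalemxAr -scalemxAl.
  have -> : x *m (q^T *m q) *m y^T = (x *m q^T) *m (q *m y^T) by rewrite !mulmxA.
  rewrite !dotrE mul_scalar_mx !scale_scalar_mx -raddfD /=.
  congr (_%:M); congr (_ + _).
  rewrite [dotr q y](_ : _ = dotr y q); last by apply: eq_bigr => i _; rewrite mulrC.
  by rewrite mulNr [in RHS]mulrC; congr (- _); ring.
have := congr1 (fun Z : 'M[R]_1 => Z 0 0) E; rewrite [RHS]mxE eqxx mulr1n => <-.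
rewrite mulmxA -[x *m _ *m _ *m _]mulmxA mxE; apply: eq_bigr => c _.
rewrite !mxE; congr (_ * _); apply: eq_bigr => i _; rewrite !mxE//.
by rewrite mulrC.
Qed.

Lemma frame_area : W ^+ 2 * (1 - \sum_c uc c ^+ 2) = 1.
Proof.
have W0 : W != 0 by rewrite gt_eqF// area_factor_gt0.
have -> : \sum_c uc c ^+ 2 = \sum_c frC c q * frC c q.
  by apply: eq_bigr => c _; rewrite frame_ucE expr2.
by rewrite frame_dot dotr_grad; field.
Qed.

Lemma frame_trace_p : mean_curvature u p = H.
Proof.
by rewrite -(frame_trace Up); apply: eq_bigr => a _; rewrite frame_dna eqxx mulr1.
Qed.

Lemma frame_sigma2_p : 2 * f0 = H ^+ 2 - \sum_a k a ^+ 2.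
Proof.
rewrite -(frame_sigma2 Up) frame_trace// frame_trace_p; congr (_ - _).
apply: eq_bigr => a _; rewrite (bigD1 a)//= !frame_dna eqxx big1 ?addr0 => [|b ba].
  by rewrite !mulr1 expr2.
by rewrite !frame_dna (negPf ba) mulr0 mul0r.
Qed.

Lemma frame_sum_fk : \sum_c f c * k c = 2 * f0.
Proof.
rewrite frame_sigma2_p expr2 {2}/H mulr_sumr -sumrB.
by apply: eq_bigr => a _; rewrite /f; ring.
Qed.

Let W0 x : U x -> area_factor u x != 0.
Proof. by rewrite gt_eqF// area_factor_gt0. Qed.

Lemma frame_dH c x : U x -> is_derive x (v c) (mean_curvature u)
  (\sum_a 'D_(v c) ('D_(v a) (na a)) x).
Proof.
move=> Ux; have D : is_derive x (v c) (fun y => \sum_a 'D_(v a) (na a) y)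
    (\sum_a 'D_(v c) ('D_(v a) (na a)) x).
  by apply: isD_sum => a; exact: Ck_isD (v c) (Ck_D (v a) (frame_Ck_na 2 a)) Ux.
apply: near_eq_is_derive D; have : nbhs x U by rewrite nbhsE; exists U.
by apply: filterS => y Uy; rewrite frame_trace.
Qed.

Lemma frame_ddH c : is_derive p (v c)
  (fun x => \sum_a 'D_(v c) ('D_(v a) (na a)) x)
  (\sum_a N3 a a c c).
Proof.
apply: isD_sum => a.
exact: Ck_isD (v c) (Ck_D (v c) (Ck_D (v a) (frame_Ck_na 3 a))) Up.
Qed.

Lemma frame_laplace_H eps : 0 < f0 -> 0 < H -> 0 <= eps ->
  (forall i, eps * (8 * f i ^+ 2 - 12 * f i * H + 9 * H ^+ 2) <=
    (4 * f i + H) * (3 * H - 2 * f i)) ->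
  (1 + eps) / H * (\sum_c f c * (\sum_a N2 a a c) ^+ 2) - H * K <=
  \sum_c f c * (\sum_a N3 a a c c) - 2 * f0 * W * \sum_c uc c * (\sum_a N2 a a c).
Proof.
move=> f00 H0 e0 he.
have fgt c : 0 < f c by exact: cone_f_gt0 H0 f00 frame_sigma2_p c.
have f2 : \sum_a f a ^+ 2 <= 3 * H ^+ 2 by exact: cone_sum_f2 f00 frame_sigma2_p.
have J1 := frame_codazzi oU Up (frame_Ck_na 4) (Cu 4) W0 frame_hessE frame_metric_p frame_dna.
have J2 := frame_dF oU Up (frame_Ck_na 4) frame_sigma2 frame_dna.
have J3 := frame_ddF oU Up (frame_Ck_na 4) frame_sigma2 frame_dna.
have J4 := frame_commute oU Up (frame_Ck_na 4) (Cu 4) (Ck_area_factor oU Cu 1) W0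
  frame_hessE frame_metric_p frame_dna.
have J := @laplace_H_jacobi R k uc W f0 N2 N3 frame_area frame_sum_fk
  (@frame_N2C R _ U na v p oU Up (frame_Ck_na 4)) J1 J2 J3 J4 eps H0 (ltW f00) fgt f2 e0 he.
exact: J.
Qed.

Lemma frame_laplace_N a :
  \sum_c f c * N2 a c c - 2 * f0 * W * uc a * k a = - (W * uc a * K).
Proof.
exact: (@laplace_N R k uc W f0 N2 frame_sum_fk
  (@frame_N2C R _ U na v p oU Up (frame_Ck_na 4))
  (frame_codazzi oU Up (frame_Ck_na 4) (Cu 4) W0 frame_hessE frame_metric_p frame_dna)
  (frame_dF oU Up (frame_Ck_na 4) frame_sigma2 frame_dna) a).
Qed.

Let m c := gam c c.
Let nn c := uc c / W.
Let dg c i x := \sum_a M a i * 'D_(v c) (na a) x.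
Let ddg c i := \sum_a M a i * N2 a c c.

(* [x . N + |N|^2 / 2]: the second summand contributes the coercive term [K] to the
   linearised operator; the derivative of the first one contains [k c * x c], which
   is large wherever the curvature [k c] is. *)
Definition test_fun (x : 'rV[R]_4) :=
  \sum_i (x 0 i + 1 / 2 * gauss u i x) * gauss u i x.

Let dtest c x := \sum_i ((M c i + 1 / 2 * dg c i x) * gauss u i x +
  (x 0 i + 1 / 2 * gauss u i x) * dg c i x).

Let ddtest c := \sum_i ((1 / 2 * ddg c i * gauss u i p +
   (M c i + 1 / 2 * dg c i p) * dg c i p) +
  ((M c i + 1 / 2 * dg c i p) * dg c i p +
   (p 0 i + 1 / 2 * gauss u i p) * ddg c i)).

Lemma frame_coord c i x : is_derive x (v c) (fun y : 'rV[R]_4 => y 0 i) (M c i).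
Proof.
have C := @Ck_coord R 4 1 setT i.
have := Ck_isD (v c) C (I : setT x).
suff -> : 'D_(v c) (fun y : 'rV[R]_4 => y 0 i) x = M c i by [].
have [_ ->] : is_derive x (v c) (fun y : 'rV[R]_4 => y 0 i) (v c 0 i).
  exact: is_derive_coord.
by rewrite mxE.
Qed.

Lemma frame_gaussE j x : gauss u j x = \sum_a M a j * na a x.
Proof.
transitivity ((M^T *m L *m \col_i gauss u i x) j 0).
  by rewrite ML mul1mx mxE.
rewrite -mulmxA mxE; apply: eq_bigr => a _; rewrite mxE; congr (_ * _).
by rewrite mxE; apply: eq_bigr => i _; rewrite [(\col_i _) _ _]mxE.
Qed.

Lemma frame_dgauss c j x : U x -> is_derive x (v c) (gauss u j) (dg c j x).
Proof.
move=> Ux; rewrite (_ : gauss u j = fun y => \sum_a M a j * na a y); last first.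
  by apply/funext => y; exact: frame_gaussE.
apply: isD_sum => a; apply: isD_scale.
exact: Ck_isD (v c) (frame_Ck_na 1 a) Ux.
Qed.

Lemma frame_ddgauss c j : is_derive p (v c) (dg c j) (ddg c j).
Proof.
apply: isD_sum => a; apply: isD_scale.
exact: Ck_isD (v c) (Ck_D (v c) (frame_Ck_na 2 a)) Up.
Qed.

Lemma frame_dg_p c i : dg c i p = k c * M c i.
Proof.
rewrite /dg (bigD1 c)//= frame_dna eqxx mulr1 mulrC big1 ?addr0// => a ac.
by rewrite frame_dna (negPf ac) !mulr0.
Qed.

Lemma frame_dtest c x : U x -> is_derive x (v c) test_fun (dtest c x).
Proof.
move=> Ux; apply: isD_sum => i; apply: isD_mul; last exact: frame_dgauss.
by apply: isD_add; [exact: frame_coord|apply: isD_scale; exact: frame_dgauss].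
Qed.

Lemma frame_ddtest c : is_derive p (v c) (dtest c) (ddtest c).
Proof.
apply: isD_sum => i; apply: isD_add; apply: isD_mul.
- rewrite -[X in is_derive _ _ _ X]add0r.
  by apply: isD_add; apply: isD_scale; exact: frame_ddgauss.
- exact: frame_dgauss.
- by apply: isD_add; [exact: frame_coord|apply: isD_scale; exact: frame_dgauss].
- exact: frame_ddgauss.
Qed.

Let frN c : \sum_i M c i * gauss u i p = nn c.
Proof.
rewrite /nn frame_ucE mulr_suml; apply: eq_bigr => i _.
by rewrite mxE mulrA.
Qed.

Lemma frame_dtest_p c : dtest c p = nn c + k c * (frC c p + nn c).
Proof.
rewrite -frN mulrDr !mulr_sumr -!big_split; apply: eq_bigr => i _ /=.
by rewrite frame_dg_p; move: (gauss u i p) (M c i) (k c) => g Mi kc; field.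
Qed.

Lemma frame_ddtest_p c :
  ddtest c = (2 * k c + k c ^+ 2) * m c + \sum_a (frC a p + nn a) * N2 a c c.
Proof.
have -> : \sum_a (frC a p + nn a) * N2 a c c =
    \sum_i (p 0 i + gauss u i p) * ddg c i.
  rewrite /ddg; under [RHS]eq_bigr do rewrite mulr_sumr.
  rewrite exchange_big; apply: eq_bigr => a _ /=.
  rewrite -frN -big_split mulr_suml; apply: eq_bigr => i _ /=.
  by move: (N2 a c c) => n2; ring.
rewrite mulr_sumr -big_split; apply: eq_bigr => i _ /=.
rewrite frame_dg_p.
by move: (ddg c i) (gauss u i p) (p 0 i) (M c i) (k c) => D g pi Mi kc; field.
Qed.

Definition cutoff (x : 'rV[R]_4) := 8 - \sum_i x 0 i * x 0 i.

Lemma frame_drho c x : is_derive x (v c) cutoff (-2 * frC c x).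
Proof.
have -> : -2 * frC c x = 0 - \sum_i (M c i * x 0 i + x 0 i * M c i).
  by rewrite sub0r mulNr -sumrN mulr_sumr -sumrN; apply: eq_bigr => i _; ring.
apply: isD_sub.
by apply: isD_sum => i; apply: isD_mul; exact: frame_coord.
Qed.

Lemma frame_ddrho c : is_derive p (v c) (fun x => -2 * frC c x) (-2 * m c).
Proof.
apply: isD_scale; apply: isD_sum => i; apply: isD_scale.
exact: frame_coord.
Qed.

Lemma frame_m c : m c = 1 - uc c ^+ 2.
Proof.
have e1 : gam c c + uc c * uc c = 1 by rewrite [LHS]frame_metric_p eqxx.
by rewrite -e1 expr2 addrK.
Qed.

Let pq := dotr p q.

Lemma area_factor_sqr_ge1 : 1 <= W ^+ 2.
Proof.
rewrite -subr_ge0 -dotr_grad.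
by apply: sumr_ge0 => i _; rewrite -expr2 sqr_ge0.
Qed.

Lemma frame_sum_ux : W * (\sum_c uc c * frC c p) = pq / W.
Proof.
have W0' : W != 0 by rewrite gt_eqF// area_factor_gt0.
have -> : \sum_c uc c * frC c p = \sum_c frC c p * frC c q.
  by apply: eq_bigr => c _; rewrite frame_ucE mulrC.
by rewrite frame_dot dotr_grad -/pq; field.
Qed.

Lemma frame_sum_unn : W * (\sum_c uc c * nn c) = \sum_c uc c ^+ 2.
Proof.
have W0' : W != 0 by rewrite gt_eqF// area_factor_gt0.
by rewrite mulr_sumr; apply: eq_bigr => c _; rewrite /nn; field.
Qed.

Lemma frame_sum_x2 : \sum_c frC c p ^+ 2 = dotr p p - (pq / W) ^+ 2.
Proof.
have -> : \sum_c frC c p ^+ 2 = \sum_c frC c p * frC c p.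
  by apply: eq_bigr => c _; rewrite expr2.
by rewrite frame_dot expr_div_n -/pq [pq ^+ 2]expr2.
Qed.

Hypothesis q_small : dotr q q <= 1 / (100 * 100).
Hypothesis p8 : dotr p p <= 8.

Lemma frame_X_sqr : (pq / W) ^+ 2 <= dotr p p * (1 / (100 * 100)).
Proof.
have pp0 : 0 <= dotr p p by apply: sumr_ge0 => i _; rewrite -expr2 sqr_ge0.
rewrite expr_div_n; apply: (@le_trans _ _ (pq ^+ 2)).
  rewrite ler_pdivrMr ?exprn_gt0 ?area_factor_gt0// ler_peMr ?sqr_ge0//.
  exact: area_factor_sqr_ge1.
apply: le_trans (dotr_cauchy p q) _.
have E (x : 'rV[R]_4) : \sum_i x 0 i ^+ 2 = dotr x x.
  by apply: eq_bigr => i _; rewrite expr2.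
by rewrite !E ler_wpM2l.
Qed.

Lemma frame_X_le : `|pq / W| <= 3 / 100.
Proof.
apply: le_of_sqr_le => //; rewrite real_normK ?num_real//.
by apply: le_trans frame_X_sqr _; move: p8; lra.
Qed.

Lemma frame_S_le : \sum_c uc c ^+ 2 <= 1 / (100 * 100).
Proof.
apply: le_trans q_small; rewrite dotr_grad.
have E : W ^+ 2 - 1 = W ^+ 2 * \sum_c uc c ^+ 2 by rewrite -frame_area; ring.
rewrite E ler_peMl ?area_factor_sqr_ge1// sumr_ge0// => c _; exact: sqr_ge0.
Qed.

Lemma frame_nn_le c : `|nn c| <= 1 / 100.
Proof.
apply: le_of_sqr_le => //; rewrite real_normK ?num_real//.
have -> : (1 / 100 : R) ^+ 2 = 1 / (100 * 100) by field.
apply: le_trans frame_S_le; rewrite expr_div_n (bigD1 c)//=.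
apply: (@le_trans _ _ (uc c ^+ 2)); last first.
  by rewrite lerDl sumr_ge0// => a _; exact: sqr_ge0.
rewrite ler_pdivrMr ?exprn_gt0 ?area_factor_gt0// ler_peMr ?sqr_ge0//.
exact: area_factor_sqr_ge1.
Qed.

Lemma frame_laplace_test : 0 < f0 -> 0 < H ->
  9 / 10 * K - H / 1000 <=
  \sum_c f c * ddtest c - 2 * f0 * W * \sum_c uc c * (nn c + k c * (frC c p + nn c)).
Proof.
move=> f00 H0.
have -> : \sum_c f c * ddtest c = \sum_c f c * ((2 * k c + k c ^+ 2) * m c) +
    \sum_a (frC a p + nn a) * (\sum_c f c * N2 a c c).
  rewrite exchange_weighted_sum.
  by rewrite -big_split; apply: eq_bigr => c _; rewrite frame_ddtest_p mulrDr.
exact: (@laplace_test_algebra R k uc m nn (frC^~ p) (fun a => \sum_c f c * N2 a c c)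
  W f0 H K (pq / W) (\sum_c uc c ^+ 2) (cone_f_gt0 H0 f00 frame_sigma2_p) f00 H0
  (cone_sum_f k) frame_sum_fk erefl frame_m erefl frame_S_le frame_sum_ux frame_X_le
  frame_sum_unn frame_laplace_N).
Qed.

Lemma frame_max_point (U' : set 'rV[R]_4) (cM s E be b : R) :
  open U' -> U' `<=` U -> U' p -> 0 < f0 -> 0 <= s -> s ^+ 2 = f0 ->
  E = 300 + 2 * s -> be = (1000 * E)^-1 -> b = ln (mean_curvature u p) - cM ->
  (forall x, U' x -> [/\ 0 < cutoff x, 0 < mean_curvature u x &
    0 < ln (mean_curvature u x) - cM]) ->
  (forall x, U' x ->
    2 * ln (cutoff x) + be * test_fun x + ln (ln (mean_curvature u x) - cM) <=
    2 * ln (cutoff p) + be * test_fun p + ln b) ->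
  1 <= dotr p p -> 2 * f0 * b ^+ 2 <= mean_curvature u p ^+ 2 ->
  b * cutoff p ^+ 2 <= 256 / be + 140 * 1000 * E / (be ^+ 2 * f0) + 1.
Proof.
move=> oU' UU' U'p f00 s0 s2 EE beE bE pos mx p1 Hb.
have [rho0 H0' b0'] := pos p U'p.
have H0 : 0 < H by rewrite -frame_trace_p.
have b0 : 0 < b by rewrite bE.
have rho8 : cutoff p <= 8.
  by rewrite /cutoff gerBl sumr_ge0// => i _; rewrite -expr2 sqr_ge0.
have xsum : \sum_a frC a p ^+ 2 <= 8.
  rewrite frame_sum_x2; apply: le_trans p8.
  by rewrite gerBl sqr_ge0.
(* The frame sees the inverse metric, which shortens [p] by the square of its normal part only; that
   part is at most [8 / (100 * 100)]. *)
have xsum' : 4 / 5 <= \sum_a frC a p ^+ 2.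
  rewrite frame_sum_x2.
  by move: (dotr p p) (pq / W) p1 p8 frame_X_sqr => t X' h1 h2 h3; lra.
have Hb' : 2 * f0 * b ^+ 2 <= H ^+ 2 by rewrite -frame_trace_p.
have m1 c : m c <= 1 by rewrite frame_m gerBl sqr_ge0.
have T c := @max_log_test R _ U' cutoff test_fun (mean_curvature u)
    (fun x => -2 * frC c x) (dtest c) (fun x => \sum_a 'D_(v c) ('D_(v a) (na a)) x)
    p (v c) (-2 * m c) (ddtest c) (\sum_a N3 a a c c) be cM H b
    (nn c + k c * (frC c p + nn c)) oU' U'p pos
    (fun x U'x => And3 (frame_drho c x) (frame_dtest c (UU' x U'x)) (frame_dH c (UU' x U'x)))
    (frame_ddrho c) (frame_ddtest c) (frame_ddH c) frame_trace_p bE (frame_dtest_p c) mx.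
exact: (@max_point_estimate R k uc (frC^~ p) nn m (fun c => \sum_a N2 a a c)
  (fun c => \sum_a N3 a a c c) ddtest W f0 (pq / W) (cutoff p) b s E be EE beE H0 f00
  frame_sigma2_p s0 s2 xsum xsum' frame_nn_le rho0 rho8 b0 Hb' m1 frame_sum_ux frame_X_le
  T (frame_laplace_test f00 H0) (fun e => frame_laplace_H f00 H0 (eps := e))).
Qed.

End principal_frame.

(** * The interior estimate *)

(** Here [c0] and [c] are the cutoff at a given point and at the maximum; the exponential weights
    differ by a factor of at most [expR 2]. *)
Lemma exp_weighted_comparison (R : realType) (c0 c b0 b t0 t G : R) :
  1 <= c0 -> 0 <= b0 -> 0 <= G ->
  c0 * c0 * (expR t0 * b0) <= c * c * (expR t * b) -> b * c ^+ 2 <= G ->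
  `|t0| <= 1 -> `|t| <= 1 -> b0 <= G * expR 2.
Proof.
move=> c1 b00 G0 h bG; rewrite !ler_norml => /andP[t01 _] /andP[_ t1].
have h1 : expR t0 * b0 <= expR t * G.
  apply: (@le_trans _ _ (c0 * c0 * (expR t0 * b0))).
    by rewrite ler_peMl ?mulr_ge0 ?expR_ge0// mulr_ege1.
  apply: le_trans h _.
  have -> : c * c * (expR t * b) = expR t * (b * c ^+ 2) by ring.
  by rewrite ler_wpM2l ?expR_ge0.
rewrite -(@ler_pM2l _ (expR t0)) ?expR_gt0//; apply: le_trans h1 _.
rewrite mulrCA [expR t * G]mulrC -expRD ler_wpM2l// ler_expR.
by move: t01 t1; lra.
Qed.

Section constants.
Context {R : realFieldType}.
Implicit Type s : R.

Definition weight s : R := (1000 * (300 + 2 * s))^-1.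

(** The bound of [max_point_bound] with [f0] written as [s ^+ 2]. *)
Definition harnack_bound s : R :=
  256 / weight s + 140 * 1000 * (300 + 2 * s) / (weight s ^+ 2 * s ^+ 2) + 1.

Let base s : 0 <= s -> 300 <= 300 + 2 * s. Proof. by lra. Qed.

Lemma weight_gt0 s : 0 <= s -> 0 < weight s.
Proof.
move=> /base h; rewrite invr_gt0; apply: mulr_gt0; first by rewrite ltr0n.
by apply: lt_le_trans h; rewrite ltr0n.
Qed.

Lemma weight_le1 s : 0 <= s -> weight s <= 1.
Proof.
move=> s0; rewrite invf_le1; first by lra.
by rewrite -invr_gt0; exact: weight_gt0.
Qed.

Lemma harnack_bound_gt0 s : 0 <= s -> 0 < harnack_bound s.
Proof.
move=> s0; apply: ltr_pwDr; first exact: ltr01.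
apply: addr_ge0.
  by apply: divr_ge0; [exact: ler0n|exact: ltW (weight_gt0 s0)].
apply: divr_ge0; last by apply: mulr_ge0; exact: sqr_ge0.
apply: mulr_ge0; first by apply: mulr_ge0; exact: ler0n.
by apply: le_trans (base s0); exact: ler0n.
Qed.

End constants.

Section interior_estimate.
Context {R : realType}.

Lemma open_pos {T : topologicalType} (U : set T) (f : T -> R) : open U ->
  (forall x, U x -> {for x, continuous f}) -> open [set x | U x /\ 0 < f x].
Proof.
move=> oU fc; rewrite openE => x [Ux fx].
have nU : nbhs x U by rewrite nbhsE; exists U.
have nf : \forall y \near x, 0 < f y by exact: cvgr_gt (fc x Ux) _ fx.
exact: filterS2 nU nf.
Qed.

Lemma Ck_cutoff k (U : set 'rV[R]_4) : open U -> Ck k U (@cutoff R).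
Proof.
move=> oU.
apply: (@Ck_ext _ _ _ _ (fun x : 'rV[R]_4 => 8 + -1 * \sum_i x 0 i * x 0 i)) => //.
  by move=> x _; rewrite mulN1r.
apply: Ck_add => //; first exact: Ck_cst.
apply: Ck_scale => //; apply: Ck_sum => // i.
by apply: Ck_mul => //; exact: Ck_coord.
Qed.

Lemma cutoffE (x : 'rV[R]_4) : cutoff x = 8 - dotr x x. Proof. by []. Qed.

Lemma dotrr_ge0 n (x : 'rV[R]_n) : 0 <= dotr x x.
Proof. by apply: sumr_ge0 => i _; rewrite -expr2 sqr_ge0. Qed.

Lemma eballE r (x : 'rV[R]_4) : 0 <= r -> eball r x <-> dotr x x < r ^+ 2.
Proof.
move=> r0; rewrite /eball /= /enorm.
have -> : \sum_i x 0 i ^+ 2 = dotr x x by apply: eq_bigr => i _; rewrite expr2.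
split=> h; last by rewrite -[r]ger0_norm// -sqrtr_sqr ltr_sqrt// (le_lt_trans (dotrr_ge0 x)).
by rewrite -[dotr x x]sqr_sqrtr ?dotrr_ge0// ltr_pXn2r// nnegrE// sqrtr_ge0.
Qed.

Lemma open_eball r : 0 <= r -> open (@eball R 4 r).
Proof.
move=> r0.
have -> : @eball R 4 r = [set x | setT x /\ 0 < (r ^+ 2 - 8) + cutoff x].
  apply/seteqP; split=> x /=.
    by move/(eballE _ r0) => h; split=> //; rewrite cutoffE addrA subrK subr_gt0.
  by move=> [_ h]; apply/(eballE _ r0); move: h; rewrite cutoffE addrA subrK subr_gt0.
apply: open_pos; first exact: openT.
move=> x _; apply: (@Ck_continuous _ _ 0 setT) => //.
apply: Ck_add; [exact: openT|exact: Ck_cst|]; apply: Ck_cutoff; exact: openT.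
Qed.

Lemma compact_cutoff_ge0 : compact [set x : 'rV[R]_4 | 0 <= cutoff x].
Proof.
apply: (@subclosed_compact _ _ [set x : 'rV[R]_4 | forall i, `[-3, 3]%classic (x 0 i)]).
- have -> : [set x : 'rV[R]_4 | 0 <= cutoff x] =
      ~` [set x : 'rV[R]_4 | setT x /\ 0 < -1 * cutoff x].
    apply/seteqP; split=> x /=.
      by move=> h [_]; rewrite mulN1r oppr_gt0 ltNge h.
    by move=> h; rewrite leNgt; apply/negP => c; apply: h; rewrite mulN1r oppr_gt0.
  apply: open_closedC; apply: open_pos; first exact: openT.
  move=> x _; apply: (@Ck_continuous _ _ 0 setT) => //.
  apply: Ck_scale; [exact: openT|]; apply: Ck_cutoff; exact: openT.
- by apply: (@rV_compact R 4 (fun=> `[-3, 3]%classic)) => i; exact: segment_compact.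
- move=> x /=; rewrite cutoffE subr_ge0 => x8 i; rewrite in_itv /= -ler_norml.
  apply: le_of_sqr_le => //; rewrite real_normK ?num_real//.
  apply: (@le_trans _ _ (dotr x x)); last by move: x8; lra.
  rewrite /dotr (bigD1 i)//= expr2 lerDl sumr_ge0// => j _.
  by rewrite -expr2 sqr_ge0.
Qed.

Variables (u : 'rV[R]_4 -> R) (f0 : R).
Let U : set 'rV[R]_4 := eball 3.
Hypothesis f00 : 0 < f0.
Hypothesis su : smooth_on U u.
Hypothesis cu : two_convex_on U u.
Hypothesis sigma : forall x, U x -> sigma2 (principal_curvatures u x) = f0.
Hypothesis Du : forall x, U x -> enorm (grad u x) <= 1 / 100.
Let H := mean_curvature u.

Let oU : open U. Proof. by apply: open_eball. Qed.

Let Cu k : Ck k U u. Proof. exact: smooth_on_Ck. Qed.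

Lemma mean_curvature_gt0 x : U x -> 0 < H x.
Proof. by move=> /cu[]. Qed.

Lemma trace_shape_sqr x : U x ->
  (\tr (shape_op u x)) ^+ 2 - \tr (shape_op u x *m shape_op u x) = 2 * f0.
Proof. by move=> Ux; rewrite -(sigma2_shape oU Cu Ux) sigma. Qed.

Lemma principal_frame_exists x : U x -> exists (M : 'M[R]_4) (d : 'rV[R]_4),
  M *m first_form u x *m M^T = 1%:M /\ M *m second_form u x *m M^T = diag_mx d.
Proof.
move=> Ux; rewrite first_formE; apply: frame_exists.
apply/matrixP => i j; rewrite !mxE.
by have /matrixP/(_ i j) := hess_sym oU Cu Ux; rewrite !mxE => ->.
Qed.

Lemma mean_curvature_sqr_ge x : U x -> 2 * f0 <= H x ^+ 2.
Proof.
move=> Ux; have [M [d [MG Mh]]] := principal_frame_exists Ux.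
rewrite (frame_sigma2_p oU Cu Ux trace_shape_sqr MG Mh).
rewrite /H (frame_trace_p oU Cu Ux MG Mh) gerBl.
by apply: sumr_ge0 => a _; exact: sqr_ge0.
Qed.

Lemma dotr_grad_le x : U x -> dotr (grad u x) (grad u x) <= 1 / (100 * 100).
Proof.
move=> /Du; rewrite /enorm.
have -> : \sum_i grad u x 0 i ^+ 2 = dotr (grad u x) (grad u x).
  by apply: eq_bigr => i _; rewrite expr2.
have g0 := dotrr_ge0 (grad u x).
move=> h; rewrite -[dotr _ _]sqr_sqrtr//.
apply: le_trans (sqr_le_sqr (sqrtr_ge0 _) h) _.
by rewrite expr2 mulf_div !mul1r.
Qed.

Lemma test_fun_le1 x : U x -> 0 <= cutoff x -> `|test_fun u x| <= 1.
Proof.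
move=> Ux x8; pose N : 'rV[R]_4 := \row_i gauss u i x.
have NE : test_fun u x = \sum_i x 0 i * N 0 i + 1 / 2 * dotr N N.
  rewrite /dotr mulr_sumr -big_split; apply: eq_bigr => i _ /=.
  by rewrite !mxE; ring.
have N2 : dotr N N <= 1 / (100 * 100).
  apply: le_trans (dotr_grad_le Ux); apply: ler_sum => i _.
  rewrite !mxE -!expr2 /gauss exprMn exprVn ler_pdivrMr ?exprn_gt0 ?area_factor_gt0//.
  by rewrite ler_peMr ?sqr_ge0// area_factor_sqr_ge1.
have N0 := dotrr_ge0 N.
have E (y : 'rV[R]_4) : \sum_i y 0 i ^+ 2 = dotr y y.
  by apply: eq_bigr => i _; rewrite expr2.
have XN : `|\sum_i x 0 i * N 0 i| <= 3 / 100.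
  apply: le_of_sqr_le => //; rewrite real_normK ?num_real//.
  apply: le_trans (dotr_cauchy x N) _; rewrite !E.
  have : dotr x x * dotr N N <= 8 * (1 / (100 * 100)).
    apply: ler_pM => //; first exact: dotrr_ge0.
    by move: x8; rewrite cutoffE subr_ge0.
  by move: (dotr x x * dotr N N) => t; lra.
rewrite NE; apply: le_trans (ler_normD _ _) _.
rewrite [`|1 / 2 * _|]ger0_norm ?mulr_ge0//.
by move: XN N2; move: (`|_|) (dotr N N) => a b; lra.
Qed.

Lemma Ck_mean_curvature k : Ck k U H.
Proof.
apply: (@Ck_ext _ _ _ _ (fun x => \sum_i 'D_(delta_mx 0 i) (gauss u i) x)) => //.
  move=> x Ux; rewrite /H (mean_curvature_shape oU Cu Ux).
  by apply: eq_bigr => i _; rewrite mxE.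
apply: Ck_sum => // i; apply: Ck_D; exact: Ck_gauss.
Qed.

Lemma Ck_test_fun k : Ck k U (test_fun u).
Proof.
apply: Ck_sum => // i; apply: Ck_mul => //; last exact: Ck_gauss.
apply: Ck_add => //; first exact: Ck_coord.
by apply: Ck_scale => //; exact: Ck_gauss.
Qed.

Lemma log_curvature_bound (m : R) : (forall x, eball 1 x -> H x <= m) ->
  forall x, eball 2 x -> ln (H x) - ln m <= harnack_bound (Num.sqrt f0) * expR 2.
Proof.
move=> Hm x0 /eballE x02; have {}x02 : dotr x0 x0 < 4.
  by have := x02 (ler0n _ _); rewrite expr2 -natrM.
have c4 : 1 <= cutoff x0 by rewrite cutoffE; move: (dotr _ _) x02 => t; lra.
have c0 : 0 < cutoff x0 := lt_le_trans ltr01 c4.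
set s := Num.sqrt f0; set G := harnack_bound s; set be := weight s.
have s0 : 0 <= s := sqrtr_ge0 _.
have s2 : s ^+ 2 = f0 by rewrite sqr_sqrtr// ltW.
have be0 : 0 < be := weight_gt0 s0.
have be1 : be <= 1 := weight_le1 s0.
have G0 : 0 < G := harnack_bound_gt0 s0.
have U0 (r : R) x : 0 <= r -> r <= 3 -> eball r x -> U x.
  by move=> r0 r3 xr; exact: lt_le_trans xr r3.
have o1 : eball (1 : R) (0 : 'rV[R]_4).
  apply/eballE => //; rewrite /dotr big1 ?exprn_gt0// => i _.
  by rewrite mxE mulr0.
have Uo : U 0 by apply: U0 o1 => //; lra.
have m0 : 0 < m by apply: lt_le_trans (mean_curvature_gt0 Uo) (Hm _ o1).
have m2 : 2 * f0 <= m ^+ 2.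
  apply: le_trans (mean_curvature_sqr_ge Uo) _; apply: sqr_le_sqr (Hm _ o1).
  exact: ltW (mean_curvature_gt0 Uo).
pose b x := ln (H x) - ln m.
have [b0|b0] := leP (b x0) 0.
  by apply: le_trans b0 _; rewrite mulr_ge0 ?expR_ge0// ltW.
have KU x : 0 <= cutoff x -> U x.
  rewrite cutoffE subr_ge0 => h; apply/eballE; first exact: ler0n.
  by apply: le_lt_trans h _; rewrite expr2 -natrM ltr_nat.
have Cb : Ck 0 U b.
  apply: (@Ck_ext _ _ _ _ (fun x => ln (H x) + - ln m)) => //.
  apply: Ck_add => //; last exact: Ck_cst.
  by apply: CkW; apply: Ck_ln => //; [exact: mean_curvature_gt0|exact: Ck_mean_curvature].
(* The exponential of the test function. It remains continuous where the cutoff vanishes or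
   [b <= 0], so a maximum exists on the compact set; logarithms are taken only on [U'], where both
   are positive. *)
pose Psi x := (cutoff x * cutoff x) * (expR (be * test_fun u x) * b x).
have Cexp : Ck 0 U (fun x => expR (be * test_fun u x)).
  apply: Ck0 => x Ux; apply: (@continuous_comp _ _ _ (fun x => be * test_fun u x) expR).
    exact: (Ck_continuous (Ck_scale be oU (Ck_test_fun 0)) Ux).
  exact: continuous_expR.
have CPsi : Ck 0 U Psi.
  apply: Ck_mul => //; last exact: Ck_mul.
  by apply: Ck_mul => //; exact: Ck_cutoff.
have Psic x : U x -> {for x, continuous Psi} by exact: Ck_continuous CPsi.
have Kx0 : 0 <= cutoff x0 := ltW c0.
have [p /[!inE] Kp pmax] := @EVT_max_rV R 4 Psi [set x | 0 <= cutoff x]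
  (ex_intro _ x0 Kx0) compact_cutoff_ge0
  (continuous_in_subspaceT (fun x Kx => Psic x (KU x (set_mem Kx)))).
have {}pmax x : 0 <= cutoff x -> Psi x <= Psi p.
  by move=> h; apply: pmax; rewrite inE.
have Psip : 0 < Psi p.
  apply: lt_le_trans (pmax x0 Kx0).
  by apply: mulr_gt0; [exact: mulr_gt0|exact: mulr_gt0 (expR_gt0 _) b0].
have rp : 0 < cutoff p.
  rewrite lt_neqAle eq_sym Kp andbT; apply/negP => /eqP cp0.
  by move: Psip; rewrite /Psi cp0 !mul0r ltxx.
have bp : 0 < b p.
  have cc : 0 < cutoff p * cutoff p by exact: mulr_gt0.
  by move: Psip; rewrite /Psi (pmulr_rgt0 _ cc) (pmulr_rgt0 _ (expR_gt0 _)).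
have Up := KU p Kp.
pose U1 := [set x | U x /\ 0 < cutoff x].
pose U' := [set x | U1 x /\ 0 < b x].
have oU1 : open U1.
  by apply: open_pos => // x Ux; exact: Ck_continuous (Ck_cutoff 0 oU) Ux.
have oU' : open U'.
  by apply: open_pos => // x [Ux _]; exact: Ck_continuous Cb Ux.
have lnPsi x : 0 < cutoff x -> 0 < b x ->
    ln (Psi x) = 2 * ln (cutoff x) + be * test_fun u x + ln (b x).
  move=> rx bx; rewrite /Psi !lnM ?posrE ?mulr_gt0 ?expR_gt0// expRK.
  by rewrite addrA -mulr2n mulr_natl.
have [M [d [MG Mh]]] := principal_frame_exists Up.
have p8 : dotr p p <= 8 by rewrite -subr_ge0.
have p1 : 1 <= dotr p p.
  rewrite leNgt; apply/negP => h; move: bp; rewrite subr_gt0 ltNge.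
  have p_in : eball 1 p by apply/eballE => //; rewrite expr1n.
  by rewrite ler_ln ?posrE// ?Hm// mean_curvature_gt0.
(* From [H = m * expR b >= m * b] and [2 * f0 <= m ^+ 2]. *)
have Hb : 2 * f0 * b p ^+ 2 <= H p ^+ 2.
  have -> : H p = m * expR (b p).
    by rewrite expRD expRN !lnK ?posrE ?mean_curvature_gt0// mulrCA mulfV ?mulr1// gt_eqF.
  rewrite exprMn ler_pM// ?sqr_ge0//; first by rewrite mulr_ge0// ltW.
  apply: sqr_le_sqr; first exact: ltW.
  by apply: le_trans (expR_ge1Dx _); rewrite lerDr.
have mx x : U' x -> 2 * ln (cutoff x) + be * test_fun u x + ln (b x) <=
    2 * ln (cutoff p) + be * test_fun u p + ln (b p).
  move=> [[Ux rx] bx].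
  have Px : 0 < Psi x by apply: mulr_gt0; [exact: mulr_gt0|exact: mulr_gt0 (expR_gt0 _) bx].
  have le2 (y z y' z' : R) : y = y' -> z = z' -> y <= z -> y' <= z' by move=> -> ->.
  apply: le2 (lnPsi x rx bx) (lnPsi p rp bp) _.
  have mono := @ler_ln R (Psi x) (Psi p) Px Psip.
  by rewrite mono; exact: pmax (ltW rx).
have pos x : U' x -> [/\ 0 < cutoff x, 0 < H x & 0 < b x].
  by move=> [[Ux rx] bx]; split; [exact: rx|exact: mean_curvature_gt0|exact: bx].
have bound : b p * cutoff p ^+ 2 <= G.
  rewrite /G /harnack_bound -/be s2.
  exact: (frame_max_point oU Cu Up trace_shape_sqr MG Mh (dotr_grad_le Up) p8 oU'
    (fun x h => h.1.1) (conj (conj Up rp) bp) f00 s0 s2 erefl erefl erefl pos mx p1 Hb).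
have tb x : U x -> 0 <= cutoff x -> `|be * test_fun u x| <= 1.
  move=> Ux cx; rewrite normrM gtr0_norm//; apply: mulr_ile1 => //; first exact: ltW.
  exact: test_fun_le1.
have Ux0 := KU x0 Kx0.
exact: (exp_weighted_comparison c4 (ltW b0) (ltW G0) (pmax x0 Kx0) bound
  (tb x0 Ux0 Kx0) (tb p Up Kp)).
Qed.

End interior_estimate.

Theorem proposition4p1 (R : realType) :
  exists mu : R, 0 < mu < 1 /\
  exists C : \bar R -> R -> R -> R,
  forall (f0 : R) (u : 'rV[R]_4 -> R),
    0 < f0 ->
    smooth_on (eball 3) u ->
    two_convex_on (eball 3) u ->
    (forall x, eball 3 x -> sigma2 (principal_curvatures u x) = f0) ->
    (forall x, eball 3 x -> enorm (grad u x) <= mu) ->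
    (ereal_sup [set (mean_curvature u x)%:E | x in eball 2]
     <= (C (sup_norm_on (eball 3) u) (Num.sqrt f0) f0^-1)%:E *
        ereal_sup [set (mean_curvature u x)%:E | x in eball 1])%E.
Proof.
exists (1 / 100); split; first by apply/andP; split; lra.
exists (fun _ s _ => expR (harnack_bound s * expR 2)) => f0 u f00 su cu sig Du.
set A := [set _ | x in eball 1]; set C := expR _.
have ball3 (r : R) (x : 'rV[R]_4) : r <= 3 -> eball r x -> eball 3 x.
  by move=> r3 xr; exact: lt_le_trans xr r3.
have o1 : eball (1 : R) (0 : 'rV[R]_4).
  apply/eballE; first exact: ler01.
  by rewrite /dotr big1 ?exprn_gt0// => i _; rewrite mxE mulr0.
have leA x : eball 1 x -> ((mean_curvature u x)%:E <= ereal_sup A)%E.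
  by move=> x1; apply: ereal_sup_ubound; exists x.
have Hpos x : eball 3 x -> 0 < mean_curvature u x by exact: mean_curvature_gt0.
(* An infinite supremum makes the claim trivial because the constant is positive; the value -oo is
   excluded by the origin. *)
case EA : (ereal_sup A) => [m| |]; last 2 first.
- by rewrite gt0_muley ?leey// lte_fin expR_gt0.
- by have := leA _ o1; rewrite EA leeNy_eq.
have Hm x : eball 1 x -> mean_curvature u x <= m.
  by move=> /leA; rewrite EA lee_fin.
have m0 : 0 < m.
  by apply: lt_le_trans (Hm _ o1); apply: Hpos; apply: ball3 o1; lra.
rewrite -EFinM; apply: ge_ereal_sup => _ [x x2 <-]; rewrite lee_fin.
have Hx : 0 < mean_curvature u x by apply: Hpos; apply: ball3 x2; lra.
have := log_curvature_bound f00 su cu sig Du Hm x2.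
rewrite -ler_expR expRD expRN !lnK ?posrE//.
by rewrite ler_pdivrMr.
Qed.
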